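(* Let $a>0$. There is a positive constant $c$, depending only on $a$, such that the following holds. Let $f_n$, $n\in\mathbb{N}$, be centred inner functions with $\lambda_n=|f_n'(0)|\ge a$ for all $n$ and $\lambda_n\lambda_{n-1}\cdots\lambda_1\to 0$ as $n\to\infty$, and put $\mu_n=1-\lambda_n$ for $n=1,2,\ldots$. Suppose that $$\liminf_{n\to\infty}(\lambda_n\cdots\lambda_1)^{1/n}<1,\quad\text{that is (equivalently),}\quad \mu:=\limsup_{n\to\infty}\frac1n\sum_{k=1}^n\mu_k>0.$$ Then the topological entropy of $(f_n)$ satisfies $$h_{\rm top}((f_n))\ge c\,\mu.$$
   Context: $\mathbb{D}=\{z\in\mathbb{C}:|z|<1\}$ is the unit disc. An inner function is a function analytic in $\mathbb{D}$, mapping $\mathbb{D}$ into its closure, with non-tangential boundary values of modulus $1$ almost everywhere on $\partial\mathbb{D}$. It is centred if it fixes $0$. Non-tangential boundary values (defined almost everywhere on $\partial\mathbb{D}$) are denoted by the same letter as the function. Topological entropy: given centred inner functions $(f_n)$, put $F_n=f_n\circ\cdots\circ f_1$ for $n\ge1$ and let $F_0$ be the identity. For $n\ge 0$ and $\delta>0$, a subset $S$ of $\partial\mathbb{D}$ (consisting of points at which the boundary values of $F_0,\ldots,F_n$ are defined with modulus $1$) is called $(n,\delta)$-separated for $(f_n)$ if any two distinct points $\zeta,\zeta'\in S$ satisfy $$\max_{0\le k\le n}|F_k(\zeta)-F_k(\zeta')|\ge\delta.$$ Let $N(n,\delta)$ be the maximum cardinality (supremum, possibly $\infty$) of an $(n,\delta)$-separated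 subset of $\partial\mathbb{D}$ for $(f_n)$. Then $$h_{\rm top}((f_n)):=\lim_{\delta\to0}\limsup_{n\to\infty}\frac1n\log N(n,\delta)\in[0,\infty].$$ *)

(* Defs.v *)
From HB Require Import structures.
From mathcomp Require Import all_boot all_order all_algebra.
From mathcomp Require Import complex.
From mathcomp Require Import all_classical all_reals all_analysis.

Set Implicit Arguments.
Unset Strict Implicit.
Unset Printing Implicit Defensive.

Import Order.TTheory GRing.Theory Num.Theory.
Import numFieldNormedType.Exports.

Local Open Scope classical_set_scope.
Local Open Scope ring_scope.

(* The topology and (complex) differentiability used on R[i] are those of the
   normed module R[i]^o over the numFieldType R[i]; its norm `|z| is
   R[i]-valued, whereas [normc z] is the modulus as an element of R. *)
Notation normc := Normc.normc.

Section InnerFunctions.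
Variable R : realType.
Local Notation C := R[i].

Definition unit_disc : set C := [set z | normc z < 1].

Definition unit_circle : set C := [set z | normc z = 1].

(* e^(it) *)
Definition cis (t : R) : C := Complex (cos t) (sin t).

(* For M > 1 this is a nonempty subset of the disc, approaching the boundary
   only at [zeta], where it fills out a sector whose angle tends to pi as
   M --> +oo. *)
Definition stolz_region (zeta : C) (M : R) : set C :=
  [set z | normc (z - zeta) < M * (1 - normc z)].

Definition nontangential_limit (g : C -> C) (zeta w : C) : Prop :=
  forall M : R, 1 < M ->
    (g : C^o -> C^o) z @[z --> within (stolz_region zeta M) (nbhs (zeta : C^o))]
      --> (w : C^o).

(* Equal to 0 where g has no non-tangential limit. *)
Definition boundary_value (g : C -> C) (zeta : C) : C :=
  xget 0 [set w | nontangential_limit g zeta w].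

Definition has_unimodular_boundary_value (g : C -> C) (zeta : C) : Prop :=
  exists2 w, unit_circle w & nontangential_limit g zeta w.

(* Functions on the disc are represented by functions on C whose values
   outside the disc are arbitrary.  "Almost everywhere" on the circle is
   Lebesgue almost everywhere in the angle t. *)
Definition inner_function (g : C -> C) : Prop :=
  [/\ forall z, unit_disc z -> derivable (g : C^o -> C^o) z 1,
      forall z, unit_disc z -> normc (g z) <= 1 &
      {ae (@lebesgue_measure R), forall t : R,
        `[0, 2 * pi[%classic t -> has_unimodular_boundary_value g (cis t)}].

Definition centred (g : C -> C) : Prop := g 0 = 0.

Definition multiplier (g : C -> C) : R := normc (derive1 (g : C -> C^o) 0).

(* The sequences of maps are indexed from 1: [f 0] is never used. *)
Fixpoint forward_comp (f : nat -> C -> C) (n : nat) : C -> C :=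
  if n is m.+1 then f m.+1 \o forward_comp f m else id.

Definition bowen_separated (f : nat -> C -> C) (n : nat) (delta : R) (S : set C) :
    Prop :=
  [/\ S `<=` unit_circle,
      forall zeta, S zeta -> forall k, (k <= n)%N ->
        has_unimodular_boundary_value (forward_comp f k) zeta &
      forall zeta zeta', S zeta -> S zeta' -> zeta <> zeta' ->
        delta <= \big[Num.max/0]_(k < n.+1)
          normc (boundary_value (forward_comp f k) zeta -
                 boundary_value (forward_comp f k) zeta')].

Definition separation_number (f : nat -> C -> C) (n : nat) (delta : R) :
    \bar R :=
  ereal_sup [set counting S | S in bowen_separated f n delta].

Definition htop (f : nat -> C -> C) : \bar R :=
  lim ((limn_esup (fun n : nat =>
    ((n%:R^-1)%:E * lne (separation_number f n delta))%E))
    @[delta --> 0^'+]).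

End InnerFunctions.

(* Main.v *)
(** Group the maps into consecutive blocks G_1, ..., G_m, each stopped as soon as
    the product of its multipliers is at most 1/2; by the lower bound a this
    product is then at least a/2, so that m ln (2/a) is at least the sum of the
    mu_k, up to a constant. For unimodular u, multiplication by (1 + conj u z)/2
    after composition with a centred inner function G with |G'(0)| <= 1/2
    multiplies the mean square on circles by at most (1 + 1/2)/2 = 3/4: the
    powers of G are orthonormal, and the cross term is damped by G'(0). Hence the
    test product of a boundary point x, built from its orbit
    (u_j = H_j(x), H_j = G_j o ... o G_1),
      K_x(z) = prod_(j <= m) (1 + conj (H_j(x)) H_j(z)) / 2,
    has mean square at most (3/4)^m. On the other hand
    |1 + conj u w|^2/4 = 1 - |u - w|^2/4 for unimodular u and w, so that
    |K_x(y)|^2 >= (15/16)^(m+1) whenever the orbits of x and y stay within 1/2.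
    A separated set S can therefore be enlarged as long as
    #S (3/4)^m < (15/16)^(m+1), which yields (n,1/2)-separated sets with
    at least (15/16) (5/4)^m points, and the rate ln (5/4) / ln (2/a).

    That all the F_k have unimodular non-tangential limits almost everywhere is
    not inherited from the f_k directly: it is Fatou's theorem, obtained from the
    Poisson formula, the Hardy-Littlewood maximal inequality and the
    Borel-Cantelli lemma along radii at which the mean square of F is close
    to 1. *)

Require Import Defs.
From HB Require Import structures.
From mathcomp Require Import all_boot all_order all_algebra.
From mathcomp Require Import complex.
From mathcomp Require Import all_classical all_reals all_analysis.
From mathcomp Require Import measurable_realfun ring lra finmap.

Set Implicit Arguments.
Unset Strict Implicit.
Unset Printing Implicit Defensive.

Import Order.TTheory GRing.Theory Num.Theory.
Import numFieldNormedType.Exports.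

Local Open Scope classical_set_scope.
Local Open Scope ring_scope.

(** Boundary values compose badly: those of g after f are not visibly the values of g at boundary
    points of f. All estimates are therefore made on circles of radius r < 1, where everything is
    continuous. Unimodularity becomes the condition that the mean square of G comes arbitrarily
    close to 1, which survives composition. The orthonormality of the powers of G then holds up to
    an error proportional to the defect 1 - [E2 0 r G], and monotonicity of mean squares in r
    removes this error at every fixed radius. Boundary values are used only to translate the
    definition of an inner function and, at the end, in Fatou's theorem and in the limit of the test
    products. The thresholds are matched: stopping at multiplier 1/2 gives the decay 3/4 per block,
    closeness 1/2 gives 15/16 per factor, and 15/16 = (5/4)(3/4) leaves the growth 5/4; what matters
    is 3/4 < 15/16. The single scale 1/2 is enough for the entropy, because separation numbers do
    not decrease as delta decreases. *)

Local Notation Re := complex.Re.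
Local Notation Im := complex.Im.

(** * The modulus, and continuity of complex-valued functions *)

Section Modulus.
Context {R : realType}.
Local Notation C := R[i].
Implicit Types z w : C.

Lemma sqr_modulus z : normc z ^+ 2 = Re z ^+ 2 + Im z ^+ 2.
Proof. by case: z => a b /=; rewrite sqr_sqrtr// addr_ge0// sqr_ge0. Qed.

Lemma modulus_ge0 z : 0 <= normc z.
Proof. by case: z => a b /=; exact: sqrtr_ge0. Qed.

Lemma modulus_eq0 z : (normc z == 0) = (z == 0).
Proof.
apply/eqP/eqP => [|->]; [exact: Normc.eq0_normc | exact: Normc.normc0].
Qed.

Lemma modulus_gt0 z : (0 < normc z) = (z != 0).
Proof. by rewrite lt_neqAle modulus_ge0 andbT eq_sym modulus_eq0. Qed.

Lemma ler_modulusB z w : normc (z - w) <= normc z + normc w.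
Proof. by rewrite -(normcN w); exact: le_normcD. Qed.

Lemma modulusBC z w : normc (z - w) = normc (w - z).
Proof. by rewrite -normcN opprB. Qed.

Lemma modulus_sub_ge z w : normc z - normc w <= normc (z - w).
Proof. by rewrite lerBlDr; have := le_normcD (z - w) w; rewrite subrK. Qed.

Lemma modulusX z n : normc (z ^+ n) = normc z ^+ n.
Proof.
elim: n => [|n IH]; first by rewrite !expr0 Normc.normc1.
by rewrite !exprS Normc.normcM IH.
Qed.

Lemma modulus_real (x : R) : normc x%:C%C = `|x|.
Proof. by rewrite /= expr0n addr0 sqrtr_sqr. Qed.

Lemma modulus_conj z : normc (z^*)%C = normc z.
Proof. by case: z => a b /=; rewrite sqrrN. Qed.

Lemma Re_le_modulus z : `|Re z| <= normc z.
Proof.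
by case: z => a b /=; rewrite -sqrtr_sqr ler_wsqrtr// lerDl sqr_ge0.
Qed.

Lemma Im_le_modulus z : `|Im z| <= normc z.
Proof.
by case: z => a b /=; rewrite -sqrtr_sqr ler_wsqrtr// lerDr sqr_ge0.
Qed.

Lemma modulus_le_ReIm z : normc z <= `|Re z| + `|Im z|.
Proof.
rewrite -(ler_pXn2r (_ : 0 < 2)%N) ?nnegrE ?modulus_ge0 ?addr_ge0//.
rewrite sqr_modulus sqrrD !real_normK ?num_real// -addrA (addrC (_ *+ 2)) addrA.
by rewrite lerDl mulrn_wge0// mulr_ge0.
Qed.

Lemma cReD z w : Re (z + w) = Re z + Re w. Proof. by case: z w => ? ? []. Qed.
Lemma cImD z w : Im (z + w) = Im z + Im w. Proof. by case: z w => ? ? []. Qed.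
Lemma cReN z : Re (- z) = - Re z. Proof. by case: z. Qed.
Lemma cImN z : Im (- z) = - Im z. Proof. by case: z. Qed.
Lemma cReM z w : Re (z * w) = Re z * Re w - Im z * Im w.
Proof. by case: z w => ? ? []. Qed.
Lemma cImM z w : Im (z * w) = Re z * Im w + Im z * Re w.
Proof. by case: z w => ? ? []. Qed.
Lemma cRe_conj z : Re (z^*)%C = Re z. Proof. by case: z. Qed.
Lemma cIm_conj z : Im (z^*)%C = - Im z. Proof. by case: z. Qed.

Lemma complex_ext z w : Re z = Re w -> Im z = Im w -> z = w.
Proof. by case: z w => ? ? [? ?] /= -> ->. Qed.

Lemma cconjM z w : conjc (z * w) = conjc z * conjc w.
Proof. exact: rmorphM. Qed.

Lemma cconjB z w : conjc (z - w) = conjc z - conjc w.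
Proof. exact: rmorphB. Qed.

Lemma cconjX z n : conjc (z ^+ n) = conjc z ^+ n.
Proof. exact: rmorphXn. Qed.

Lemma mulC_conj z : z * (z^*)%C = (normc z ^+ 2)%:C%C.
Proof.
rewrite sqr_modulus; case: z => a b; rewrite [LHS]/(_ * _)/=.
by congr Complex; rewrite ?expr2; lra.
Qed.

Lemma sum_modulus_le (I : Type) (r : seq I) (P : pred I) (F : I -> C) :
  normc (\sum_(i <- r | P i) F i) <= \sum_(i <- r | P i) normc (F i).
Proof.
apply: (big_ind2 (fun (z : C) (x : R) => normc z <= x)) => //.
- by rewrite Normc.normc0.
- by move=> z x w y zx wy; exact: le_trans (le_normcD _ _) (lerD zx wy).
Qed.

Lemma prod_modulus (I : Type) (r : seq I) (P : pred I) (F : I -> C) :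
  normc (\prod_(i <- r | P i) F i) = \prod_(i <- r | P i) normc (F i).
Proof.
exact: (big_morph _ (@Normc.normcM R) (@Normc.normc1 R)).
Qed.

Lemma modulus_cis (t : R) : normc (cis t) = 1.
Proof. by rewrite /cis/= cos2Dsin2 sqrtr1. Qed.

Lemma cisD (s t : R) : cis (s + t) = cis s * cis t.
Proof.
by rewrite /cis cosD sinD [RHS]/(_ * _)/=; congr Complex; rewrite addrC [sin s * _]mulrC.
Qed.

Lemma cis0 : cis 0 = 1 :> C. Proof. by rewrite /cis cos0 sin0. Qed.

Lemma cisD2pi (t : R) : cis (t + 2 * pi) = cis t.
Proof. by rewrite /cis mulr_natl cosD2pi sinD2pi. Qed.

End Modulus.

Section ComplexContinuity.
Context {R : realType}.
Local Notation C := R[i].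

Definition ccont (f : C -> C) (z : C) : Prop :=
  forall e : R, 0 < e -> exists2 d : R, 0 < d &
    forall w, normc (w - z) < d -> normc (f w - f z) < e.

(** Componentwise, the form that real integration consumes; [pcontP] recovers the epsilon-delta form
    needed for composition. *)
Definition pcont (h : R -> C) (t : R) : Prop :=
  {for t, continuous (fun s => Re (h s))} /\
  {for t, continuous (fun s => Im (h s))}.

Lemma pcontP (h : R -> C) (t : R) : pcont h t <->
  forall e : R, 0 < e -> exists2 d : R, 0 < d &
    forall s, `|s - t| < d -> normc (h s - h t) < e.
Proof.
split=> [[hr hi] e e0|H].
- have e2 : 0 < e / 2 by rewrite divr_gt0.
  have [d1 /= d10 H1] := (nbhs_normP _ _).1 ((cvgrPdist_lt _ _).1 hr _ e2).
  have [d2 /= d20 H2] := (nbhs_normP _ _).1 ((cvgrPdist_lt _ _).1 hi _ e2).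
  exists (Num.min d1 d2); first by rewrite lt_min d10 d20.
  move=> s; rewrite lt_min distrC => /andP[s1 s2].
  rewrite modulusBC.
  apply: le_lt_trans (modulus_le_ReIm _) _; rewrite cReD cImD cReN cImN.
  rewrite (splitr e) ltrD//; [exact: H1 | exact: H2].
- split; apply/cvgrPdist_lt => e e0; have [d d0 Hd] := H e e0;
    near=> s; rewrite distrC.
  + rewrite -cReN -cReD; apply: le_lt_trans (Re_le_modulus _) _.
    apply: Hd; rewrite distrC; near: s.
    by apply/nbhs_normP; exists d => //= s; rewrite /ball_/=.
  + rewrite -cImN -cImD; apply: le_lt_trans (Im_le_modulus _) _.
    apply: Hd; rewrite distrC; near: s.
    by apply/nbhs_normP; exists d => //= s; rewrite /ball_/=.
Unshelve. all: by end_near. Qed.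

Lemma pcont_comp (f : C -> C) (h : R -> C) t :
  ccont f (h t) -> pcont h t -> pcont (fun s => f (h s)) t.
Proof.
move=> cf /pcontP ch; apply/pcontP => e /cf[d /ch[d' d'0 H'] H].
by exists d' => // s /H' /H.
Qed.

Lemma pcont_cst (c : C) t : pcont (fun=> c) t.
Proof. by split; exact: cvg_cst. Qed.

Lemma pcontD f g t : pcont f t -> pcont g t -> pcont (fun s => f s + g s) t.
Proof.
move=> [f1 f2] [g1 g2]; split.
- by under [X in {for t, continuous X}]eq_fun do rewrite cReD; exact: cvgD.
- by under [X in {for t, continuous X}]eq_fun do rewrite cImD; exact: cvgD.
Qed.

Lemma pcontN f t : pcont f t -> pcont (fun s => - f s) t.
Proof.
move=> [f1 f2]; split.
- by under [X in {for t, continuous X}]eq_fun do rewrite cReN; exact: cvgN.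
- by under [X in {for t, continuous X}]eq_fun do rewrite cImN; exact: cvgN.
Qed.

Lemma pcontB f g t : pcont f t -> pcont g t -> pcont (fun s => f s - g s) t.
Proof. by move=> pf pg; apply: pcontD => //; exact: pcontN. Qed.

Lemma pcontM f g t : pcont f t -> pcont g t -> pcont (fun s => f s * g s) t.
Proof.
move=> [f1 f2] [g1 g2]; split.
- under [X in {for t, continuous X}]eq_fun do rewrite cReM.
  by apply: cvgB; exact: cvgM.
- under [X in {for t, continuous X}]eq_fun do rewrite cImM.
  by apply: cvgD; exact: cvgM.
Qed.

Lemma pcont_conj f t : pcont f t -> pcont (fun s => conjc (f s)) t.
Proof.
move=> [f1 f2]; split.
- by under [X in {for t, continuous X}]eq_fun do rewrite cRe_conj.
- by under [X in {for t, continuous X}]eq_fun do rewrite cIm_conj; exact: cvgN.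
Qed.

Lemma pcontX f n t : pcont f t -> pcont (fun s => f s ^+ n) t.
Proof.
move=> pf; elim: n => [|n IH].
  by under [X in pcont X]eq_fun do rewrite expr0; exact: pcont_cst.
by under [X in pcont X]eq_fun do rewrite exprS; exact: pcontM.
Qed.

Lemma pcont_sum (I : Type) (r : seq I) (P : pred I) (F : I -> R -> C) t :
  (forall i, P i -> pcont (F i) t) -> pcont (fun s => \sum_(i <- r | P i) F i s) t.
Proof.
move=> H; elim: r => [|i r IH].
  by under [X in pcont X]eq_fun do rewrite big_nil; exact: pcont_cst.
under [X in pcont X]eq_fun do rewrite big_cons.
by case: (boolP (P i)) => Pi //; apply: pcontD => //; exact: H.
Qed.

Lemma pcont_real (f : R -> R) t :
  {for t, continuous f} -> pcont (fun s => (f s)%:C%C) t.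
Proof. by move=> cf; split=> //=; exact: cvg_cst. Qed.

Lemma pcont_modulus f t : pcont f t -> {for t, continuous (fun s => normc (f s))}.
Proof.
move=> /pcontP H; apply/cvgrPdist_lt => e /H[d d0 Hd]; near=> s.
rewrite distrC; apply: (@le_lt_trans _ _ (normc (f s - f t))).
  rewrite ler_norml modulus_sub_ge andbT lerNl opprB modulusBC.
  exact: modulus_sub_ge.
apply: Hd; rewrite distrC; near: s.
by apply/nbhs_normP; exists d => //= s; rewrite /ball_/=.
Unshelve. all: by end_near. Qed.

Lemma pcont_cis (t : R) : pcont (@cis R) t.
Proof. by split=> /=; [exact: continuous_cos | exact: continuous_sin]. Qed.

End ComplexContinuity.

(** * Integrals over segments and complex differentiability *)

Section RealIntegral.
Context {R : realType}.
Local Notation C := R[i].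
Local Notation mu := (@lebesgue_measure R).
Implicit Types (a b c x : R) (f g : R -> R).

(** Two-sided continuity at each point, endpoints included, rather than continuity within the
    segment: it is stable under sums and products by plain limit laws. *)
Definition rcont a b f := forall x, a <= x <= b -> {for x, continuous f}.

Definition rint a b f : R := \int[mu]_(x in `[a, b]) f x.

Lemma rcont_within a b f : rcont a b f -> {within `[a, b], continuous f}.
Proof.
by move=> H; apply: continuous_in_subspaceT => x /set_mem/=; rewrite in_itv/=; exact: H.
Qed.

Lemma rcont_integrable a b f : rcont a b f -> mu.-integrable `[a, b] (EFin \o f).
Proof.
by move=> /rcont_within; apply: continuous_compact_integrable; exact: segment_compact.
Qed.

Lemma eq_rint a b f g : (forall x, a <= x <= b -> f x = g x) ->
  rint a b f = rint a b g.
Proof.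
by move=> fg; apply: eq_Rintegral => x /set_mem/=; rewrite in_itv/=; exact: fg.
Qed.

Lemma rintD a b f g : rcont a b f -> rcont a b g ->
  rint a b (fun x => f x + g x) = rint a b f + rint a b g.
Proof. by move=> cf cg; apply: RintegralD => //; exact: rcont_integrable. Qed.

Lemma rintZ a b k f : rcont a b f ->
  rint a b (fun x => k * f x) = k * rint a b f.
Proof. by move=> cf; apply: RintegralZl => //; exact: rcont_integrable. Qed.

Lemma rintN a b f : rcont a b f -> rint a b (fun x => - f x) = - rint a b f.
Proof.
move=> cf; rewrite -mulN1r -rintZ//; apply: eq_rint => x _; by rewrite mulN1r.
Qed.

Lemma rcontN a b f : rcont a b f -> rcont a b (fun x => - f x).
Proof. by move=> cf x xab; apply: cvgN; exact: cf. Qed.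

Lemma rcontD a b f g : rcont a b f -> rcont a b g -> rcont a b (fun x => f x + g x).
Proof. by move=> cf cg x xab; apply: cvgD; [exact: cf | exact: cg]. Qed.

Lemma rcontM a b f g : rcont a b f -> rcont a b g -> rcont a b (fun x => f x * g x).
Proof. by move=> cf cg x xab; apply: cvgM; [exact: cf | exact: cg]. Qed.

Lemma rcont_cst a b k : rcont a b (fun=> k).
Proof. by move=> x xab; exact: cvg_cst. Qed.

Lemma rcontZ a b k f : rcont a b f -> rcont a b (fun x => k * f x).
Proof. by move=> cf; apply: rcontM => //; exact: rcont_cst. Qed.

Lemma rintB a b f g : rcont a b f -> rcont a b g ->
  rint a b (fun x => f x - g x) = rint a b f - rint a b g.
Proof. by move=> cf cg; rewrite rintD ?rintN//; exact: rcontN. Qed.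

Lemma rint_cst a b k : a <= b -> rint a b (fun=> k) = k * (b - a).
Proof.
move=> ab; rewrite /rint Rintegral_cst//= lebesgue_measure_itv/= lte_fin.
move: ab; rewrite le_eqVlt => /predU1P[->|->]; last by rewrite -EFinD.
by rewrite ltxx subrr.
Qed.

Lemma le_rint a b f g : rcont a b f -> rcont a b g ->
  (forall x, a <= x <= b -> f x <= g x) -> rint a b f <= rint a b g.
Proof.
move=> cf cg fg; apply: le_Rintegral => //; exact: rcont_integrable.
Qed.

Lemma rint_ge0 a b f : (forall x, a <= x <= b -> 0 <= f x) -> 0 <= rint a b f.
Proof.
by move=> f0; apply: Rintegral_ge0 => x /=; rewrite in_itv/=; exact: f0.
Qed.

Lemma rint_cat a b c f : a <= b -> b <= c -> rcont a c f ->
  rint a c f = rint a b f + rint b c f.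
Proof.
move=> ab bc /rcont_integrable fi.
have := @Rintegral_itvB _ f (BLeft a) (BRight c) b fi; rewrite !bnd_simp => /(_ ab bc).
rewrite Rintegral_itv_obnd_cbnd; last first.
  by apply: integrableS fi => //; apply: subset_itvr; rewrite bnd_simp.
by rewrite /rint => <-; rewrite addrC subrK.
Qed.

Lemma EFin_rint a b f : rcont a b f ->
  (rint a b f)%:E = (\int[mu]_(x in `[a, b]) (f x)%:E)%E.
Proof.
move=> cf; rewrite /rint /Rintegral fineK//.
by apply: integrable_fin_num => //; exact: rcont_integrable.
Qed.

Lemma rint_sum (I : Type) (r : seq I) (F : I -> R -> R) a b :
  (forall i, rcont a b (F i)) ->
  rint a b (fun x => \sum_(i <- r) F i x) = \sum_(i <- r) rint a b (F i).
Proof.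
move=> cF; elim: r => [|i r IH].
  rewrite big_nil (@eq_rint _ _ _ (fun=> 0)).
    by rewrite /rint /Rintegral integral0.
  by move=> x _; rewrite big_nil.
rewrite big_cons -IH -rintD//.
  by apply: eq_rint => x _; rewrite big_cons.
elim: r {IH} => [|j r IH].
  by rewrite (_ : (fun _ => _) = fun=> 0) => [|]; [exact: rcont_cst|
    apply/funext => y; rewrite big_nil].
rewrite (_ : (fun _ => _) = fun y => F j y + \sum_(k <- r) F k y); last first.
  by apply/funext => y; rewrite big_cons.
exact: rcontD.
Qed.

End RealIntegral.

Section ComplexIntegral.
Context {R : realType}.
Local Notation C := R[i].
Implicit Types (a b c x : R) (f g : R -> C).

Definition pconts a b f := forall x, a <= x <= b -> pcont f x.

Definition cint a b f : C :=
  Complex (rint a b (fun x => Re (f x))) (rint a b (fun x => Im (f x))).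

Lemma pconts_Re a b f : pconts a b f -> rcont a b (fun x => Re (f x)).
Proof. by move=> H x /H[]. Qed.

Lemma pconts_Im a b f : pconts a b f -> rcont a b (fun x => Im (f x)).
Proof. by move=> H x /H[]. Qed.

Local Hint Resolve pconts_Re pconts_Im : core.

Lemma eq_cint a b f g : (forall x, a <= x <= b -> f x = g x) ->
  cint a b f = cint a b g.
Proof. by move=> fg; congr Complex; apply: eq_rint => x /fg ->. Qed.

Lemma cintD a b f g : pconts a b f -> pconts a b g ->
  cint a b (fun x => f x + g x) = cint a b f + cint a b g.
Proof.
move=> cf cg; rewrite /cint [RHS]/(_ + _)/= -!rintD//; auto.
by congr Complex; apply: eq_rint => x _; rewrite ?cReD ?cImD.
Qed.

Lemma cintZ a b k f : pconts a b f ->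
  cint a b (fun x => k * f x) = k * cint a b f.
Proof.
move=> cf; rewrite /cint; case: k => k1 k2; rewrite [RHS]/(_ * _)/=.
rewrite -!rintZ//; auto; rewrite -rintB -?rintD; try by apply: rcontZ; auto.
by congr (Complex _ _); apply: eq_rint => x _; [rewrite cReM|rewrite cImM].
Qed.

Lemma cintN a b f : pconts a b f -> cint a b (fun x => - f x) = - cint a b f.
Proof.
move=> cf; rewrite -mulN1r -cintZ//; apply: eq_cint => x _; by rewrite mulN1r.
Qed.

Lemma cintB a b f g : pconts a b f -> pconts a b g ->
  cint a b (fun x => f x - g x) = cint a b f - cint a b g.
Proof.
move=> cf cg; rewrite cintD ?cintN// => x xab; apply: pcontN; exact: cg.
Qed.

Lemma cint_cst a b k : a <= b -> cint a b (fun=> k) = k * (b - a)%:C%C.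
Proof.
move=> ab; rewrite /cint !rint_cst//; case: k => k1 k2.
by rewrite [RHS]/(_ * _)/= !mulr0 subr0 add0r.
Qed.

Lemma cint_cat a b c f : a <= b -> b <= c -> pconts a c f ->
  cint a c f = cint a b f + cint b c f.
Proof.
by move=> ab bc cf; rewrite /cint [RHS]/(_ + _)/= -!rint_cat//; auto.
Qed.

Lemma cint_sum (I : Type) (r : seq I) (F : I -> R -> C) a b :
  (forall i, pconts a b (F i)) ->
  cint a b (fun x => \sum_(i <- r) F i x) = \sum_(i <- r) cint a b (F i).
Proof.
move=> cF; elim: r => [|i r IH].
  rewrite big_nil (@eq_cint _ _ _ (fun=> 0)).
    by rewrite /cint /rint /Rintegral integral0.
  by move=> x _; rewrite big_nil.
rewrite big_cons -IH -cintD//.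
  by apply: eq_cint => x _; rewrite big_cons.
by move=> x xab; apply: pcont_sum => j _; exact: cF.
Qed.

Lemma cint_conj a b f : pconts a b f ->
  cint a b (fun x => conjc (f x)) = conjc (cint a b f).
Proof.
move=> cf; rewrite /cint/= -rintN//; last by auto.
by congr (Complex _ _); apply: eq_rint => x _; [rewrite cRe_conj|rewrite cIm_conj].
Qed.

Lemma cint_real a b (f : R -> R) : cint a b (fun x => (f x)%:C%C) = (rint a b f)%:C%C.
Proof. by rewrite /cint/= /rint /Rintegral integral0. Qed.

(* Rotating the integral onto the positive real axis reduces the bound to that
   of a real integrand. *)
Lemma modulus_cint a b f : pconts a b f ->
  normc (cint a b f) <= rint a b (fun x => normc (f x)).
Proof.
move=> cf; set I := cint a b f.
have [I0|I0] := eqVneq I 0.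
  by rewrite I0 Normc.normc0; apply: rint_ge0 => x _; exact: modulus_ge0.
pose k : C := conjc I * (normc I)^-1%:C%C.
have nI : 0 < normc I by rewrite modulus_gt0.
have nk : normc k = 1.
  rewrite Normc.normcM modulus_conj modulus_real ger0_norm ?invr_ge0 ?modulus_ge0//.
  by rewrite divff// gt_eqF.
have E : normc I = Re (cint a b (fun x => k * f x)).
  rewrite cintZ// -/I /k mulrAC [conjc I * I]mulrC mulC_conj -rmorphM/=.
  by rewrite expr2 mulfK// gt_eqF.
rewrite E; apply: le_rint.
- apply: pconts_Re => x xab; apply: pcontM; [exact: pcont_cst | exact: cf].
- by move=> x xab; apply: pcont_modulus; exact: cf.
- move=> x _; apply: le_trans (ler_norm _) _; apply: le_trans (Re_le_modulus _) _.
  by rewrite Normc.normcM nk mul1r.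
Qed.

Lemma modulus_cint_le a b f (M : R) : a <= b -> pconts a b f ->
  (forall x, a <= x <= b -> normc (f x) <= M) -> normc (cint a b f) <= M * (b - a).
Proof.
move=> ab cf fM; apply: le_trans (modulus_cint cf) _.
rewrite -rint_cst//; apply: le_rint => //; last exact: rcont_cst.
by move=> x xab; apply: pcont_modulus; exact: cf.
Qed.

Lemma modulus_cint_sub_le a b f (k : C) (M : R) : a <= b -> pconts a b f ->
  (forall x, a <= x <= b -> normc (f x - k) <= M) ->
  normc (cint a b f - k * (b - a)%:C%C) <= M * (b - a).
Proof.
move=> ab cf fM; rewrite -cint_cst// -cintB//; last by move=> *; exact: pcont_cst.
apply: modulus_cint_le => // x xab; apply: pcontB; first exact: cf.
exact: pcont_cst.
Qed.

End ComplexIntegral.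

Section ComplexDerivative.
Context {R : realType}.
Local Notation C := R[i].
Implicit Types (f g : C -> C) (z l : C).

(** A first-order expansion with a real-valued error: h = 0 is allowed and nothing is divided, so
    the product and chain rules are pure estimates. *)
Definition cdiff f z l : Prop :=
  forall e : R, 0 < e -> exists2 d : R, 0 < d &
    forall h, normc h < d -> normc (f (z + h) - f z - l * h) <= e * normc h.

Lemma cdiff_ccont f z l : cdiff f z l -> ccont f z.
Proof.
move=> /(_ 1 ltr01)[d d0 H] e e0.
have l0 : 0 < normc l + 1 by rewrite ltr_wpDl ?modulus_ge0.
exists (Num.min d (e / (normc l + 1))); first by rewrite lt_min d0 divr_gt0.
move=> w; rewrite lt_min => /andP[/H]; rewrite [z + _]addrC subrK => H1.
rewrite ltr_pdivlMr// => H2; apply: le_lt_trans H2.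
rewrite -[f w - f z](subrK (l * (w - z))).
apply: le_trans (le_normcD _ _) _.
by rewrite Normc.normcM; lra.
Qed.

Lemma cdiff_cst k z : cdiff (fun=> k) z 0.
Proof.
move=> e e0; exists 1 => // h _.
by rewrite mul0r !subrr Normc.normc0 mulr_ge0 ?modulus_ge0// ltW.
Qed.

Lemma cdiff_id z : cdiff id z 1.
Proof.
move=> e e0; exists 1 => // h _.
by rewrite mul1r [z + h]addrC addrK subrr Normc.normc0 mulr_ge0 ?modulus_ge0// ltW.
Qed.

Lemma cdiffD f g z l m : cdiff f z l -> cdiff g z m ->
  cdiff (fun w => f w + g w) z (l + m).
Proof.
move=> cf cg e e0; have e2 : 0 < e / 2 by rewrite divr_gt0.
have [d1 d10 H1] := cf _ e2; have [d2 d20 H2] := cg _ e2.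
exists (Num.min d1 d2); first by rewrite lt_min d10.
move=> h; rewrite lt_min => /andP[/H1 {}H1 /H2 {}H2].
rewrite (_ : _ - _ = (f (z + h) - f z - l * h) + (g (z + h) - g z - m * h)); last by ring.
by apply: le_trans (le_normcD _ _) _; rewrite (splitr e) mulrDl lerD.
Qed.

Lemma cdiffM f g z l m : cdiff f z l -> cdiff g z m ->
  cdiff (fun w => f w * g w) z (l * g z + f z * m).
Proof.
move=> cf cg e e0.
(* B dominates |f z|, |l| and, once h is small, |g (z + h)|; each of the three error terms below
   then gets e / 3. *)
pose B := normc (f z) + normc (g z) + normc l + 1.
have B0 : 0 < B by rewrite ltr_wpDl// !addr_ge0// modulus_ge0.
have e2 : 0 < e / (3 * B) by rewrite divr_gt0// mulr_gt0.
have [d1 d10 H1] := cf _ e2; have [d2 d20 H2] := cg _ e2.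
have [d3 d30 H3] := cdiff_ccont cg e2.
have [d4 d40 H4] := cdiff_ccont cg ltr01.
exists (Num.min (Num.min d1 d2) (Num.min d3 d4)).
  by rewrite !lt_min d10 d20 d30 d40.
move=> h; rewrite !lt_min => /andP[/andP[/H1 {}H1 /H2 {}H2] /andP[h3 h4]].
have {h3}H3 : normc (g (z + h) - g z) < e / (3 * B).
  by apply: H3; rewrite [z + h]addrC addrK.
have {h4}H4 : normc (g (z + h) - g z) < 1.
  by apply: H4; rewrite [z + h]addrC addrK.
have gB : normc (g (z + h)) <= B.
  rewrite -(subrK (g z) (g (z + h))); apply: le_trans (le_normcD _ _) _.
  rewrite /B; have := modulus_ge0 (f z); have := modulus_ge0 l; lra.
rewrite (_ : _ - _ = (f (z + h) - f z - l * h) * g (z + h) +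
  (l * h * (g (z + h) - g z) + f z * (g (z + h) - g z - m * h))); last by ring.
have E : e = e / (3 * B) * B + (B * (e / (3 * B)) + B * (e / (3 * B))).
  by field; rewrite gt_eqF.
have n0 := modulus_ge0 h.
rewrite [in leRHS]E (mulrDl _ _ (normc h)) (mulrDl (B * _)).
apply: le_trans (le_normcD _ _) (lerD _ _).
  rewrite Normc.normcM mulrAC; apply: ler_pM; rewrite ?modulus_ge0//.
apply: le_trans (le_normcD _ _) (lerD _ _).
  rewrite !Normc.normcM mulrAC; apply: ler_wpM2r => //.
  apply: ler_pM; rewrite ?modulus_ge0//; last exact: ltW.
  rewrite /B; have := modulus_ge0 (f z); have := modulus_ge0 (g z); lra.
rewrite Normc.normcM -mulrA; apply: ler_pM; rewrite ?modulus_ge0//.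
rewrite /B; have := modulus_ge0 l; have := modulus_ge0 (g z); lra.
Qed.

Lemma cdiff_comp f g z l m : cdiff f z l -> cdiff g (f z) m ->
  cdiff (fun w => g (f w)) z (m * l).
Proof.
move=> cf cg e e0.
pose B := normc l + normc m + 2.
have B0 : 0 < B by rewrite ltr_wpDl// addr_ge0// modulus_ge0.
have e2 : 0 < e / (2 * B) by rewrite divr_gt0// mulr_gt0.
have [d1 d10 H1] := cg _ e2.
have [d2 d20 H2] := cf _ e2; have [d3 d30 H3] := cf _ ltr01.
have [d4 d40 H4] := cdiff_ccont cf d10.
exists (Num.min (Num.min d2 d3) d4); first by rewrite !lt_min d20 d30 d40.
move=> h; rewrite !lt_min => /andP[/andP[/H2 {}H2 /H3 {}H3] h4].
have {h4}H4 : normc (f (z + h) - f z) < d1.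
  by apply: H4; rewrite [z + h]addrC addrK.
have {}H1 := H1 _ H4; rewrite [f z + _]addrC subrK in H1.
have n0 := modulus_ge0 h.
have fB : normc (f (z + h) - f z) <= B * normc h.
  rewrite -(subrK (l * h) (f (z + h) - f z)); apply: le_trans (le_normcD _ _) _.
  rewrite Normc.normcM; apply: le_trans (lerD H3 (lexx _)) _.
  rewrite -mulrDl ler_wpM2r// /B; have := modulus_ge0 m; lra.
rewrite (_ : _ - _ = (g (f (z + h)) - g (f z) - m * (f (z + h) - f z)) +
   m * (f (z + h) - f z - l * h)); last by ring.
have E : e = e / (2 * B) * B + B * (e / (2 * B)) by field; rewrite gt_eqF.
rewrite [in leRHS]E mulrDl; apply: le_trans (le_normcD _ _) (lerD _ _).
  by apply: le_trans H1 _; rewrite -[leRHS]mulrA; apply: ler_wpM2l fB; exact: ltW.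
rewrite Normc.normcM -mulrA; apply: ler_pM; rewrite ?modulus_ge0//.
rewrite /B; have := modulus_ge0 l; lra.
Qed.

Lemma cdiffX f z l n : cdiff f z l -> exists m, cdiff (fun w => f w ^+ n) z m.
Proof.
move=> cf; elim: n => [|n [m IH]]; first by exists 0; exact: cdiff_cst.
exists (l * f z ^+ n + f z * m).
under eq_fun do rewrite exprS; exact: (cdiffM cf IH).
Qed.

Lemma cdiff_unique f z l m : cdiff f z l -> cdiff f z m -> l = m.
Proof.
move=> cf cg; apply/eqP; rewrite -subr_eq0 -modulus_eq0 eq_le modulus_ge0 andbT.
apply/ler_addgt0Pl => e e0; rewrite addr0.
have e2 : 0 < e / 2 by rewrite divr_gt0.
have [d1 d10 H1] := cf _ e2; have [d2 d20 H2] := cg _ e2.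
pose d := Num.min d1 d2 / 2.
have d0 : 0 < Num.min d1 d2 by rewrite lt_min d10.
have dh : normc (d%:C%C : C) = d by rewrite modulus_real gtr0_norm// divr_gt0.
have dd : d < Num.min d1 d2 by rewrite /d; lra.
have [dd1 dd2] : d < d1 /\ d < d2 by apply/andP; rewrite -lt_min.
have := H1 d%:C%C; rewrite dh => /(_ dd1) {}H1.
have := H2 d%:C%C; rewrite dh => /(_ dd2) {}H2.
have d00 : 0 < d by rewrite divr_gt0.
rewrite -(ler_pM2r d00) -[in leLHS]dh -Normc.normcM.
rewrite (_ : _ * _ = (f (z + d%:C%C) - f z - m * d%:C%C)
                   - (f (z + d%:C%C) - f z - l * d%:C%C)); last by ring.
apply: le_trans (ler_modulusB _ _) _.
by rewrite (splitr e) mulrDl lerD.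
Qed.

End ComplexDerivative.

(** * Goursat's theorem in logarithmic coordinates *)

(** Stated over any numeric field because it is applied to the real exponential, cosine and sine,
    and again to maps of R[i] in [derivable_cdiff]. *)
Lemma derivable_small (K : numFieldType) (f : K^o -> K^o) (x : K^o) :
  derivable f x 1 -> forall e : K, 0 < e -> exists2 d : K, 0 < d &
    forall h : K, `|h| < d -> `|f (x + h) - f x - 'D_1 f x * h| <= e * `|h|.
Proof.
move=> fx e e0.
have /cvgrPdist_le /(_ _ e0) : h^-1 *: ((f \o shift x) (h *: (1 : K^o)) - f x)
  @[h --> (0 : K)^'] --> 'D_1 f x by exact: fx.
rewrite near_withinE => /nbhs_normP[d /= d0 H]; exists d => // h hd.
have [->|h0] := eqVneq h 0.
  by rewrite addr0 subrr mulr0 subr0 normr0 mulr0.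
have := H h; rewrite /ball_/= sub0r normrN [h%:A]mulr1 => /(_ hd h0) A.
rewrite (_ : _ - _ * h = - (('D_1 f x - h^-1 *: (f (h + x) - f x)) * h)).
  by rewrite normrN normrM ler_wpM2r.
by rewrite mulrBl opprB [_ *: _]/(_ * _) mulrAC mulVf// mul1r (addrC h).
Qed.

Section ComplexExponential.
Context {R : realType}.
Local Notation C := R[i].
Implicit Types (z w : C).

Lemma is_derive_small (f : R -> R) (x df : R) : is_derive x 1 f df ->
  forall e, 0 < e -> exists2 d, 0 < d &
    forall h, `|h| < d -> `|f (x + h) - f x - df * h| <= e * `|h|.
Proof. by move=> [fx <-] e e0; exact: derivable_small. Qed.

Definition cexp z : C := (expR (Re z))%:C%C * cis (Im z).

Lemma cexpD z w : cexp (z + w) = cexp z * cexp w.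
Proof. by rewrite /cexp cReD cImD expRD cisD rmorphM/= mulrACA. Qed.

Lemma modulus_cexp z : normc (cexp z) = expR (Re z).
Proof. by rewrite Normc.normcM modulus_cis mulr1 modulus_real ger0_norm ?expR_ge0. Qed.

Lemma cexp0 : cexp 0 = 1.
Proof. by rewrite /cexp/= expR0 cis0 mulr1. Qed.

Lemma cdiff_cexp0 : cdiff cexp 0 1.
Proof.
(* The four pieces [E1] to [E4] below cost 2, 2, 2 and 1 times (e / 10) |h|, within e |h|. *)
move=> e e0; have e1 : 0 < e / 10 by rewrite divr_gt0.
have [d1 d10 H1] := is_derive_small (is_derive_expR (0 : R)) e1.
have [d2 d20 H2] := is_derive_small (is_derive_cos (0 : R)) e1.
have [d3 d30 H3] := is_derive_small (is_derive_sin (0 : R)) e1.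
have [d4 d40 H4] := is_derive_small (is_derive_expR (0 : R)) ltr01.
pose d := Num.min (Num.min (Num.min d1 d2) (Num.min d3 d4)) (Num.min (1 / 2) (e / 10)).
exists d; first by rewrite /d !lt_min d10 d20 d30 d40 divr_gt0.
move=> h; rewrite /d !lt_min.
move=> /andP[/andP[/andP[h1 h2] /andP[h3 h4]] /andP[h5 h6]].
have hr := Re_le_modulus h; have hi := Im_le_modulus h.
have := H1 _ (le_lt_trans hr h1); have := H4 _ (le_lt_trans hr h4).
have := H2 _ (le_lt_trans hi h2); have := H3 _ (le_lt_trans hi h3).
rewrite !add0r expR0 cos0 sin0 oppr0 !mul0r !(subr0, addr0) !mul1r cexp0 /cexp.
set x := Re h in hr *; set y := Im h in hi *.
have -> : h = Complex x y by rewrite /x /y; case: (h).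
set X := expR x; set c := cos y; set s := sin y => A1 A2 A3 A4.
set n := normc (Complex x y).
have nE : n = normc h by rewrite /n /x /y; case: (h).
rewrite -nE in hr hi h5 h6.
rewrite (_ : _ - _ = Complex (X * (c - 1) + (X - 1 - x)) (X * (s - y) + y * (X - 1))); last first.
  by apply: complex_ext; rewrite !(cReD, cImD, cReN, cImN, cReM, cImM)/= -/c -/s; ring.
apply: le_trans (modulus_le_ReIm _) _ => /=.
have X2 : `|X| <= 2.
  rewrite -(subrK 1 X); apply: le_trans (ler_normD _ _) _.
  rewrite normr1; have := ler_normD (X - 1 - x) x; rewrite subrK; lra.
have X1 : `|X - 1| <= 2 * n.
  by have := ler_normD (X - 1 - x) x; rewrite subrK; lra.
have n0 : 0 <= n by exact: modulus_ge0.
have E1 : `|X * (c - 1)| <= 2 * (e / 10 * n).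
  by rewrite normrM ler_pM// (le_trans A2)// ler_wpM2l// ltW.
have E2 : `|X * (s - y)| <= 2 * (e / 10 * n).
  by rewrite normrM ler_pM// (le_trans A1)// ler_wpM2l// ltW.
have E3 : `|y * (X - 1)| <= e / 10 * (2 * n).
  by rewrite normrM ler_pM//; lra.
have E4 : `|X - 1 - x| <= e / 10 * n.
  by rewrite (le_trans A4)// ler_wpM2l// ltW.
have := ler_normD (X * (c - 1)) (X - 1 - x).
have := ler_normD (X * (s - y)) (y * (X - 1)).
have : 0 <= e * n by rewrite mulr_ge0// ltW.
lra.
Qed.

Lemma cdiff_cexp z : cdiff cexp z (cexp z).
Proof.
have : cdiff (fun w => cexp z * cexp (w - z)) z (0 * cexp (z - z) + cexp z * (1 * (1 + 0))).
  apply: cdiffM; first exact: cdiff_cst.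
  apply: (@cdiff_comp _ (fun w => w - z) cexp).
    by apply: cdiffD; [exact: cdiff_id | exact: cdiff_cst].
  by rewrite subrr; exact: cdiff_cexp0.
rewrite mul0r add0r addr0 !mulr1.
rewrite (_ : (fun w => _) = cexp)//.
by apply/funext => w; rewrite -cexpD addrC subrK.
Qed.

End ComplexExponential.

(** * Vanishing of rectangle integrals by bisection *)

Section Goursat.
Context {R : realType}.
Local Notation C := R[i].
Implicit Types (g : C -> C) (x y w h : R).

(** Counterclockwise boundary integral of the rectangle with corner (x, y), width w and height h.
    Opposite sides share one integral, so that they can be compared pointwise. *)
Definition rect_int g x y w h : C :=
  cint x (x + w) (fun s => g (Complex s y) - g (Complex s (y + h))) +
  'i%C * cint y (y + h) (fun t => g (Complex (x + w) t) - g (Complex x t)).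

Definition holo_rect g x y w h := forall s t, x <= s <= x + w -> y <= t <= y + h ->
  exists l, cdiff g (Complex s t) l.

Lemma pcont_horizontal y s : pcont (fun s => Complex s y) s.
Proof. by split=> /=; [exact: cvg_id | exact: cvg_cst]. Qed.

Lemma pcont_vertical x t : pcont (fun t => Complex x t) t.
Proof. by split=> /=; [exact: cvg_cst | exact: cvg_id]. Qed.

Lemma holo_rect_horizontal g x y w h t : holo_rect g x y w h -> y <= t <= y + h ->
  pconts x (x + w) (fun s => g (Complex s t)).
Proof.
move=> gR yt s xs; apply: pcont_comp; last exact: pcont_horizontal.
by have [l gl] := gR _ _ xs yt; exact: cdiff_ccont gl.
Qed.

Lemma holo_rect_vertical g x y w h s : holo_rect g x y w h -> x <= s <= x + w ->
  pconts y (y + h) (fun t => g (Complex s t)).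
Proof.
move=> gR xs t yt; apply: pcont_comp; last exact: pcont_vertical.
by have [l gl] := gR _ _ xs yt; exact: cdiff_ccont gl.
Qed.

Lemma rect_int_splitx g x y w h : 0 <= w -> 0 <= h ->
  holo_rect g x y w h -> rect_int g x y w h =
  rect_int g x y (w / 2) h + rect_int g (x + w / 2) y (w / 2) h.
Proof.
move=> w0 h0 gR; have E : x + w / 2 + w / 2 = x + w by lra.
have xm : x <= x + w / 2 <= x + w by apply/andP; split; lra.
have xl : x <= x <= x + w by apply/andP; split; lra.
have xr : x <= x + w <= x + w by apply/andP; split; lra.
have yl : y <= y <= y + h by apply/andP; split; lra.
have yr : y <= y + h <= y + h by apply/andP; split; lra.
rewrite /rect_int E (@cint_cat _ _ (x + w / 2)); [|lra|lra|]; last first.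
  by move=> s xs; apply: pcontB; exact: (holo_rect_horizontal gR).
rewrite !cintB; try exact: (holo_rect_vertical gR).
- ring.
- move=> s xs; apply: (holo_rect_horizontal gR) => //; move: xs => /andP[? ?]; apply/andP; split; lra.
- move=> s xs; apply: (holo_rect_horizontal gR) => //; move: xs => /andP[? ?]; apply/andP; split; lra.
- move=> s xs; apply: (holo_rect_horizontal gR) => //; move: xs => /andP[? ?]; apply/andP; split; lra.
- move=> s xs; apply: (holo_rect_horizontal gR) => //; move: xs => /andP[? ?]; apply/andP; split; lra.
Qed.

Lemma rect_int_splity g x y w h : 0 <= w -> 0 <= h ->
  holo_rect g x y w h -> rect_int g x y w h =
  rect_int g x y w (h / 2) + rect_int g x (y + h / 2) w (h / 2).
Proof.
move=> w0 h0 gR; have E : y + h / 2 + h / 2 = y + h by lra.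
have ym : y <= y + h / 2 <= y + h by apply/andP; split; lra.
have xl : x <= x <= x + w by apply/andP; split; lra.
have xr : x <= x + w <= x + w by apply/andP; split; lra.
have yl : y <= y <= y + h by apply/andP; split; lra.
have yr : y <= y + h <= y + h by apply/andP; split; lra.
rewrite /rect_int E (@cint_cat _ y (y + h / 2)); [|lra|lra|]; last first.
  by move=> t yt; apply: pcontB; exact: (holo_rect_vertical gR).
rewrite !cintB; try exact: (holo_rect_horizontal gR).
- ring.
- move=> s xs; apply: (holo_rect_vertical gR) => //; move: xs => /andP[? ?]; apply/andP; split; lra.
- move=> s xs; apply: (holo_rect_vertical gR) => //; move: xs => /andP[? ?]; apply/andP; split; lra.
- move=> s xs; apply: (holo_rect_vertical gR) => //; move: xs => /andP[? ?]; apply/andP; split; lra.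
- move=> s xs; apply: (holo_rect_vertical gR) => //; move: xs => /andP[? ?]; apply/andP; split; lra.
Qed.

(** Used once for each direction of subdivision: the two factors 2 make up the factor 4 of a
    quarter. *)
Lemma half_large (a b : C) :
  normc (a + b) <= 2 * normc a \/ normc (a + b) <= 2 * normc b.
Proof.
by have := le_normcD a b; have [] := leP (normc a) (normc b); [right|left]; lra.
Qed.

Lemma rect_int_quarter g x y w h : 0 <= w -> 0 <= h -> holo_rect g x y w h ->
  exists x' y', [/\ x <= x' <= x + w / 2, y <= y' <= y + h / 2 &
    normc (rect_int g x y w h) <= 4 * normc (rect_int g x' y' (w / 2) (h / 2))].
Proof.
move=> w0 h0 gR; rewrite (rect_int_splitx w0 h0 gR).
have sub x' : x <= x' <= x + w / 2 -> holo_rect g x' y (w / 2) h.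
  move=> /andP[a b] s t /andP[c d] yt; apply: gR => //; apply/andP; split; lra.
have [x' [xx' xle]] : exists x', x <= x' <= x + w / 2 /\
  normc (rect_int g x y (w / 2) h + rect_int g (x + w / 2) y (w / 2) h) <=
    2 * normc (rect_int g x' y (w / 2) h).
  have [H|H] := half_large (rect_int g x y (w / 2) h) (rect_int g (x + w / 2) y (w / 2) h).
    by exists x; split=> //; apply/andP; split; lra.
  by exists (x + w / 2); split=> //; apply/andP; split; lra.
have w20 : 0 <= w / 2 by lra.
have E := rect_int_splity w20 h0 (sub _ xx').
have [H|H] := half_large (rect_int g x' y (w / 2) (h / 2))
    (rect_int g x' (y + h / 2) (w / 2) (h / 2)).
  exists x', y; split=> //; first by rewrite lexx lerDl divr_ge0.
  by rewrite -E in H; lra.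
exists x', (y + h / 2); split=> //; first by rewrite lexx lerDl divr_ge0.
by rewrite -E in H; lra.
Qed.

(* The quarters being small around p, only the remainder of the first-order
   expansion of g at p contributes: opposite sides cancel its affine part. *)
Lemma rect_int_small g x y w h (p l : C) (e : R) : 0 <= w -> 0 <= h ->
  holo_rect g x y w h ->
  x <= Re p <= x + w -> y <= Im p <= y + h ->
  (forall z, x <= Re z <= x + w -> y <= Im z <= y + h ->
     normc (g z - g p - l * (z - p)) <= e * normc (z - p)) -> 0 <= e ->
  normc (rect_int g x y w h) <= 2 * e * (w + h) ^+ 2.
Proof.
move=> w0 h0 gR px py H e0.
have xl : x <= x <= x + w by apply/andP; split; lra.
have xr : x <= x + w <= x + w by apply/andP; split; lra.
have yl : y <= y <= y + h by apply/andP; split; lra.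
have yr : y <= y + h <= y + h by apply/andP; split; lra.
have H' z : x <= Re z <= x + w -> y <= Im z <= y + h ->
    normc (g z - g p - l * (z - p)) <= e * (w + h).
  move=> zx zy; apply: le_trans (H _ zx zy) _; apply: ler_wpM2l => //.
  apply: le_trans (modulus_le_ReIm _) _; rewrite cReD cImD cReN cImN.
  apply: lerD; rewrite ler_norml; apply/andP; split;
  move: zx zy px py => /andP[? ?] /andP[? ?] /andP[? ?] /andP[? ?]; lra.
set I := rect_int _ _ _ _ _.
(* The subtracted constants are the paired integrands of the affine part of g; their contributions -
   i l h w and i l w h cancel. *)
have -> : I = (cint x (x + w) (fun s => g (Complex s y) - g (Complex s (y + h)))
                - (l * (- 'i%C * h%:C%C)) * (x + w - x)%:C%C)
            + 'i%C * (cint y (y + h) (fun t => g (Complex (x + w) t) - g (Complex x t))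
                - (l * w%:C%C) * (y + h - y)%:C%C).
  rewrite /I /rect_int !(addrC x w) !(addrC y h) !addrK; ring.
have N1 : normc ('i%C : C) = 1.
  by rewrite /= expr0n expr1n add0r sqrtr1.
apply: le_trans (le_normcD _ _) _; rewrite Normc.normcM N1 mul1r.
have -> : 2 * e * (w + h) ^+ 2 = 2 * (e * (w + h)) * (x + w - x) +
   2 * (e * (w + h)) * (y + h - y) by ring.
apply: lerD; apply: modulus_cint_sub_le; try lra.
- by move=> s xs; apply: pcontB; exact: (holo_rect_horizontal gR).
- move=> s xs.
  rewrite (_ : _ - _ = (g (Complex s y) - g p - l * (Complex s y - p)) -
     (g (Complex s (y + h)) - g p - l * (Complex s (y + h) - p))).
    by apply: le_trans (ler_modulusB _ _) _; have := H' (Complex s y) xs yl;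
       have := H' (Complex s (y + h)) xs yr; lra.
  rewrite (_ : Complex s (y + h) = Complex s y + 'i%C * h%:C%C); first by ring.
  by rewrite [RHS]/(_ + _)/=; congr Complex; ring.
- by move=> t yt; apply: pcontB; exact: (holo_rect_vertical gR).
- move=> t yt.
  rewrite (_ : _ - _ = (g (Complex (x + w) t) - g p - l * (Complex (x + w) t - p)) -
     (g (Complex x t) - g p - l * (Complex x t - p))).
    by apply: le_trans (ler_modulusB _ _) _; have := H' (Complex x t) xl yt;
       have := H' (Complex (x + w) t) xr yt; lra.
  rewrite (_ : Complex (x + w) t = Complex x t + w%:C%C); first by ring.
  by rewrite [RHS]/(_ + _)/=; congr Complex; ring.
Qed.

(** The intervals [u n, u n + w / 2^n] are nested, and the supremum of their left endpoints lies in
    all of them. This locates the limit point of the bisection and, later, the limit of a geometric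
    Cauchy sequence. *)
Lemma nested_halves (u : nat -> R) (w : R) : 0 <= w ->
  (forall n, u n <= u n.+1 <= u n + w / 2 ^+ n / 2) ->
  exists p, forall n, u n <= p <= u n + w / 2 ^+ n.
Proof.
move=> w0 H.
have pos n : 0 <= w / 2 ^+ n by rewrite divr_ge0// exprn_ge0.
have up n k : u n <= u (n + k)%N /\ u (n + k)%N + w / 2 ^+ (n + k) <= u n + w / 2 ^+ n.
  elim: k => [|k [IH1 IH2]]; first by rewrite addn0.
  rewrite addnS; have /andP[A B] := H (n + k)%N.
  split; first exact: le_trans IH1 A.
  apply: le_trans IH2; rewrite exprSr invfM mulrA; lra.
have bd n m : u m <= u n + w / 2 ^+ n.
  have [le|/ltnW le] := leqP n m.
    rewrite -(subnKC le); have [_ A] := up n (m - n)%N; have := pos (n + (m - n))%N; lra.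
  rewrite -(subnKC le); have [A _] := up m (n - m)%N; have := pos (m + (n - m))%N; lra.
exists (sup (range u)) => n; apply/andP; split.
  apply: sup_ubound; last by exists n.
  by exists (u 0%N + w / 2 ^+ 0) => _ [m _ <-]; exact: bd.
by apply: ge_sup => [|_ [m _ <-]]; [exists (u 0%N), 0%N | exact: bd].
Qed.

(** If the integral had modulus I > 0, the n-th quarter would carry at least I / 4^n, while
    differentiability at the limit point makes it at most 2 e (w + h)^2 / 4^n. *)
Lemma goursat g x y w h : 0 <= w -> 0 <= h -> holo_rect g x y w h ->
  rect_int g x y w h = 0.
Proof.
move=> w0 h0 gR; apply: contrapT => /eqP I0.
pose I := normc (rect_int g x y w h).
have Ipos : 0 < I by rewrite /I modulus_gt0.
pose W n : R := w / 2 ^+ n; pose H n : R := h / 2 ^+ n.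
have W0 n : 0 <= W n by rewrite divr_ge0// exprn_ge0.
have H0 n : 0 <= H n by rewrite divr_ge0// exprn_ge0.
have WS n : W n.+1 = W n / 2 by rewrite /W exprSr invfM mulrA.
have HS n : H n.+1 = H n / 2 by rewrite /H exprSr invfM mulrA.
(* The state carries its own step number, since the sides depend on it; conditioning on holomorphy
   makes the relation total, as choice requires. *)
pose P (s : nat * (R * R)) (s' : nat * (R * R)) :=
  let: (n, (a, b)) := s in let: (m, (a', b')) := s' in
  m = n.+1 /\ (holo_rect g a b (W n) (H n) ->
  [/\ a <= a' <= a + W n / 2, b <= b' <= b + H n / 2 &
    normc (rect_int g a b (W n) (H n)) <= 4 * normc (rect_int g a' b' (W n.+1) (H n.+1))]).
have [F PF] : exists F, forall s, P s (F s).
  suff H' s : {s' | P s s'} by exists (fun s => sval (H' s)) => s; exact: svalP.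
  apply: cid; case: s => n [a b].
  have [gab|] := pselect (holo_rect g a b (W n) (H n)); last by exists (n.+1, (a, b)).
  have [a' [b' ?]] := rect_int_quarter (W0 n) (H0 n) gab.
  by exists (n.+1, (a', b')); split=> // _; rewrite WS HS.
pose S n := iter n F (0%N, (x, y)).
have S1 n : (S n).1 = n.
  elim: n => //= n IH; have := PF (S n).
  by move: IH; rewrite /S /=; case: (iter n F _) => k [a b] /= ->;
    case: (F _) => m [a' b'] [].
pose X n := (S n).2.1; pose Y n := (S n).2.2.
have SE n : S n = (n, (X n, Y n)) by rewrite /X /Y -{2}(S1 n); case: (S n) => ? [].
have step n : holo_rect g (X n) (Y n) (W n) (H n) ->
  [/\ X n <= X n.+1 <= X n + W n / 2, Y n <= Y n.+1 <= Y n + H n / 2 &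
    normc (rect_int g (X n) (Y n) (W n) (H n)) <=
      4 * normc (rect_int g (X n.+1) (Y n.+1) (W n.+1) (H n.+1))].
  by have := PF (S n); rewrite -[F (S n)]/(S n.+1) !SE => -[_].
have hol n : holo_rect g (X n) (Y n) (W n) (H n).
  elim: n => [|n IH]; first by rewrite /W /H expr0 !divr1.
  have [/andP[? ?] /andP[? ?] _] := step _ IH.
  move=> s t /andP[? ?] /andP[? ?]; move: (WS n) (HS n) => ? ?.
  by apply: IH; apply/andP; split; lra.
have [px Hpx] := @nested_halves X w w0 (fun n => let: And3 a _ _ := step n (hol n) in a).
have [py Hpy] := @nested_halves Y h h0 (fun n => let: And3 _ b _ := step n (hol n) in b).
have {}Hpx : forall n, X n <= px <= X n + W n := Hpx.
have {}Hpy : forall n, Y n <= py <= Y n + H n := Hpy.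
have Ile n : I <= 4 ^+ n * normc (rect_int g (X n) (Y n) (W n) (H n)).
  elim: n => [|n IH]; first by rewrite mul1r /W /H expr0 !divr1.
  have [_ _ A] := step n (hol n).
  by apply: le_trans IH _; rewrite exprSr -mulrA ler_wpM2l// exprn_ge0.
have [l gl] : exists l, cdiff g (Complex px py) l.
  by apply: (hol 0%N); [exact: Hpx | exact: Hpy].
(* The + 1 keeps the denominator positive for a degenerate rectangle and makes 2 e (w + h)^2
   strictly smaller than I. *)
have wh0 : 0 < 2 * (w + h) ^+ 2 + 1 by rewrite ltr_wpDl// mulr_ge0// sqr_ge0.
have e0 : 0 < I / (2 * (w + h) ^+ 2 + 1) by rewrite divr_gt0.
set e := I / _ in e0.
have [d d0 Hd] := gl _ e0.
have [n nd] : exists n, (w + h) / 2 ^+ n < d.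
  have /cvgrPdist_lt/(_ _ d0) : (w + h) * (2^-1) ^+ n @[n --> \oo] --> (w + h) * 0.
    apply: cvgMr; apply: cvg_expr; rewrite ger0_norm; lra.
  move=> [N _ /(_ N (leqnn N))]/=; rewrite mulr0 sub0r normrN exprVn => A.
  by exists N; apply: le_lt_trans A; exact: ler_norm.
have := @rect_int_small g (X n) (Y n) (W n) (H n) (Complex px py) l e
  (W0 n) (H0 n) (hol n) (Hpx n) (Hpy n) _ (ltW e0).
have zd z : X n <= Re z <= X n + W n -> Y n <= Im z <= Y n + H n ->
     normc (g z - g (Complex px py) - l * (z - Complex px py)) <=
     e * normc (z - Complex px py).
  move=> zx zy.
  have := Hd (z - Complex px py); rewrite [_ + (z - _)]addrC subrK; apply.
  apply: le_lt_trans nd; apply: le_trans (modulus_le_ReIm _) _; rewrite mulrDl.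
  rewrite cReD cImD cReN cImN/= -/(W n) -/(H n).
  move: zx zy (Hpx n) (Hpy n) => /andP[? ?] /andP[? ?] /andP[? ?] /andP[? ?].
  by apply: lerD; rewrite ler_norml; apply/andP; split; lra.
move=> /(_ zd) B.
have p4 : 0 < (4 : R) ^+ n by rewrite exprn_gt0.
have : I <= 4 ^+ n * (2 * e * (W n + H n) ^+ 2).
  by apply: le_trans (Ile n) _; rewrite ler_wpM2l// ltW.
have -> : 4 ^+ n * (2 * e * (W n + H n) ^+ 2) = e * (2 * (w + h) ^+ 2).
  rewrite /W /H -mulrDl expr_div_n -exprM mulnC exprM.
  rewrite (_ : (2 : R) ^+ 2 = 4); last by ring.
  by field; rewrite gt_eqF.
have : e * (2 * (w + h) ^+ 2 + 1) = I by rewrite /e divfK// gt_eqF.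
lra.
Qed.

End Goursat.

(** * Averages over circles *)

Section CircleAverage.
Context {R : realType}.
Local Notation C := R[i].
Implicit Types (b r s t : R) (f g : R -> C) (u v : R -> R).

Definition pcontT f := forall t, pcont f t.

(** The starting point b of the period is a parameter because Poisson integrals near e^(it) are
    taken over [t - pi, t + pi]. *)
Definition avg b f : C := ((2 * pi)^-1)%:C%C * cint b (b + 2 * pi) f.
Definition ravg b u : R := (2 * pi)^-1 * rint b (b + 2 * pi) u.

Lemma twopi_gt0 : 0 < 2 * pi :> R.
Proof. by rewrite mulr_gt0// pi_gt0. Qed.

Lemma twopi_itv b : b <= b + 2 * pi.
Proof. by have := twopi_gt0; lra. Qed.

Let H := twopi_itv.

Lemma pcontT_pconts f a b : pcontT f -> pconts a b f.
Proof. by move=> cf t _; exact: cf. Qed.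

Lemma continuous_rcont u a b : continuous u -> rcont a b u.
Proof. by move=> cu t _; exact: cu. Qed.

Lemma pcontT_modulus f : pcontT f -> continuous (fun t => normc (f t)).
Proof. by move=> cf t; exact: pcont_modulus. Qed.

Local Hint Resolve pcontT_pconts continuous_rcont pcontT_modulus : core.

Lemma eq_avg b f g : f =1 g -> avg b f = avg b g.
Proof. by move=> fg; congr (avg b _); exact/funext. Qed.

Lemma eq_ravg b u v : u =1 v -> ravg b u = ravg b v.
Proof. by move=> fg; congr (ravg b _); exact/funext. Qed.

Lemma avgD b f g : pcontT f -> pcontT g ->
  avg b (fun t => f t + g t) = avg b f + avg b g.
Proof. by move=> cf cg; rewrite /avg cintD ?mulrDr; auto. Qed.

Lemma avgB b f g : pcontT f -> pcontT g ->
  avg b (fun t => f t - g t) = avg b f - avg b g.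
Proof. by move=> cf cg; rewrite /avg cintB ?mulrBr; auto. Qed.

Lemma avgZ b k f : pcontT f -> avg b (fun t => k * f t) = k * avg b f.
Proof. by move=> cf; rewrite /avg cintZ; [rewrite mulrCA | auto]. Qed.

Lemma avg_conj b f : pcontT f -> avg b (fun t => conjc (f t)) = conjc (avg b f).
Proof. by move=> cf; rewrite /avg cint_conj ?rmorphM/= ?oppr0; auto. Qed.

Lemma avg_sum b (I : Type) (l : seq I) (F : I -> R -> C) :
  (forall i, pcontT (F i)) ->
  avg b (fun t => \sum_(i <- l) F i t) = \sum_(i <- l) avg b (F i).
Proof. by move=> cF; rewrite /avg cint_sum ?mulr_sumr; auto. Qed.

Lemma avg_cst b k : avg b (fun=> k) = k.
Proof.
rewrite /avg cint_cst// (addrC b) addrK mulrCA -rmorphM/= mulVf ?mulr1//.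
by rewrite gt_eqF// twopi_gt0.
Qed.

Lemma avg_real b u : avg b (fun t => (u t)%:C%C) = (ravg b u)%:C%C.
Proof. by rewrite /avg cint_real -rmorphM. Qed.

Lemma ravgD b u v : continuous u -> continuous v ->
  ravg b (fun t => u t + v t) = ravg b u + ravg b v.
Proof. by move=> cf cg; rewrite /ravg rintD ?mulrDr; auto. Qed.

Lemma ravgB b u v : continuous u -> continuous v ->
  ravg b (fun t => u t - v t) = ravg b u - ravg b v.
Proof. by move=> cf cg; rewrite /ravg rintB ?mulrBr; auto. Qed.

Lemma ravgZ b k u : continuous u -> ravg b (fun t => k * u t) = k * ravg b u.
Proof. by move=> cf; rewrite /ravg rintZ; [rewrite mulrCA | auto]. Qed.

Lemma ravg_cst b k : ravg b (fun=> k) = k.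
Proof.
rewrite /ravg rint_cst// (addrC b) addrK mulrCA mulVf ?mulr1//.
by rewrite gt_eqF// twopi_gt0.
Qed.

Lemma ravg_sum b (I : Type) (l : seq I) (F : I -> R -> R) :
  (forall i, continuous (F i)) ->
  ravg b (fun t => \sum_(i <- l) F i t) = \sum_(i <- l) ravg b (F i).
Proof. by move=> cF; rewrite /ravg rint_sum ?mulr_sumr; auto. Qed.

Lemma le_ravg b u v : continuous u -> continuous v ->
  (forall t, u t <= v t) -> ravg b u <= ravg b v.
Proof.
move=> cu cv uv; rewrite /ravg ler_wpM2l ?invr_ge0 ?(ltW twopi_gt0)//.
by apply: le_rint; auto.
Qed.

Lemma modulus_avg b f : pcontT f -> normc (avg b f) <= ravg b (fun t => normc (f t)).
Proof.
move=> cf; rewrite Normc.normcM modulus_real ger0_norm ?invr_ge0 ?(ltW twopi_gt0)//.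
by rewrite ler_wpM2l ?invr_ge0 ?(ltW twopi_gt0)//; apply: modulus_cint; auto.
Qed.

Lemma modulus_avg_le b f M : pcontT f -> (forall t, normc (f t) <= M) ->
  normc (avg b f) <= M.
Proof.
move=> cf fM; rewrite -[leRHS](ravg_cst b); apply: le_trans (modulus_avg b cf) _.
by apply: le_ravg; auto => t; exact: cvg_cst.
Qed.

Lemma modulus_avg_sub b f k M : pcontT f -> (forall t, normc (f t - k) <= M) ->
  normc (avg b f - k) <= M.
Proof.
move=> cf fM; rewrite -[k](avg_cst b) -avgB//; last by move=> t; exact: pcont_cst.
apply: modulus_avg_le => // t; apply: pcontB; [exact: cf | exact: pcont_cst].
Qed.

Definition circ r t : C := r%:C%C * cis t.

Lemma modulus_circ r t : 0 <= r -> normc (circ r t) = r.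
Proof. by move=> r0; rewrite Normc.normcM modulus_cis mulr1 modulus_real ger0_norm. Qed.

Lemma pcont_circ r : pcontT (circ r).
Proof. by move=> t; apply: pcontM; [exact: pcont_cst | exact: pcont_cis]. Qed.

Lemma circ_neq0 r t : 0 < r -> circ r t != 0.
Proof. by move=> r0; rewrite -modulus_gt0 modulus_circ ?ltW. Qed.

Lemma circV r t : 0 < r -> (circ r t)^-1 = (r ^- 2)%:C%C * conjc (circ r t).
Proof.
move=> r0; apply: (mulfI (circ_neq0 t r0)); rewrite divff ?circ_neq0//.
rewrite mulrCA mulC_conj modulus_circ ?ltW// -rmorphM/= mulVf//.
by rewrite gt_eqF// exprn_gt0.
Qed.

Lemma pcontT_circV r : 0 < r -> pcontT (fun t => (circ r t)^-1).
Proof.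
move=> r0 t; rewrite (_ : (fun t => _) = fun t => (r ^- 2)%:C%C * conjc (circ r t)).
  by apply: pcontM; [exact: pcont_cst | apply: pcont_conj; exact: pcont_circ].
by apply/funext => s; exact: circV.
Qed.

End CircleAverage.

#[global] Hint Resolve pcontT_pconts continuous_rcont pcontT_modulus : core.

(** * Radius independence and the mean value property *)

Section Holomorphic.
Context {R : realType}.
Local Notation C := R[i].
Implicit Types (b r s t : R) (f g h : C -> C) (z w : C).

Definition holo f := forall z, normc z < 1 -> exists l, cdiff f z l.

Lemma cdiffV z : z != 0 -> cdiff (fun w => w^-1) z (- z ^- 2).
Proof.
rewrite -modulus_gt0 => z0 e e0; set n := normc z in z0.
exists (Num.min (n / 2) (e * n ^+ 3 / 2)).
  by rewrite lt_min !divr_gt0// mulr_gt0// exprn_gt0.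
move=> h; rewrite lt_min => /andP[h1 h2].
have zn0 : z != 0 by rewrite -modulus_gt0.
have zh : n / 2 <= normc (z + h).
  by have := modulus_sub_ge z (- h); rewrite opprK normcN -/n; lra.
have zh0 : z + h != 0 by rewrite -modulus_gt0; lra.
rewrite (_ : _ - _ = h * (h / (z ^+ 2 * (z + h)))); last by field; rewrite zn0 zh0.
rewrite Normc.normcM mulrC ler_wpM2r ?modulus_ge0//.
rewrite Normc.normcM Normc.normcV Normc.normcM modulusX -/n.
rewrite ler_pdivrMr ?mulr_gt0 ?exprn_gt0 ?modulus_gt0//.
apply: le_trans (ltW h2) _; rewrite -!mulrA ler_wpM2l ?(ltW e0)//.
by rewrite !ler_wpM2l// ltW.
Qed.

(** In the coordinate log z the annulus is a rectangle: Goursat's theorem applies to h composed with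
    [cexp], and 2 pi i periodicity cancels the two horizontal sides. The disc is punctured at 0 so
    that h may be f z / z^n. *)
Lemma avg_radius_indep b h r s :
  (forall z, 0 < normc z < 1 -> exists l, cdiff h z l) ->
  0 < r < 1 -> 0 < s < 1 ->
  avg b (fun t => h (circ r t)) = avg b (fun t => h (circ s t)).
Proof.
move=> hh; wlog : r s / s <= r => [W|sr /andP[r0 r1] /andP[s0 s1]].
  by move=> hr hs; have [/W|/ltW/W] := leP s r; [apply | move=> ->].
have g x : x < 0 -> forall t, exists l, cdiff (fun z => h (cexp z)) (Complex x t) l.
  move=> x0 t; have [|l hl] := hh (cexp (Complex x t)).
    by rewrite modulus_cexp expR_gt0 -[ltRHS]expR0 ltr_expR.
  by exists (l * cexp (Complex x t)); apply: cdiff_comp hl; exact: cdiff_cexp.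
have gR : holo_rect (fun z => h (cexp z)) (ln s) b (ln r - ln s) (2 * pi).
  move=> x t /andP[_ xr] _; apply: g; apply: le_lt_trans xr _.
  by rewrite addrC subrK ln_lt0// r0.
have w0 : 0 <= ln r - ln s by rewrite subr_ge0 ler_ln.
have := goursat w0 (ltW twopi_gt0) gR.
have E x t : cexp (Complex x (t + 2 * pi)) = cexp (Complex x t) :> C.
  by rewrite /cexp/= cisD2pi.
have El x t : 0 < x -> cexp (Complex (ln x) t) = circ x t.
  by move=> x0; rewrite /cexp/= lnK.
rewrite /rect_int (@eq_cint _ _ _ _ (fun=> 0)); last by move=> x _; rewrite E subrr.
rewrite cint_cst ?lerDl// mul0r add0r => /eqP; rewrite mulf_eq0.
have -> : ('i%C == 0 :> C) = false.
  by apply/negbTE; rewrite -modulus_gt0 /= expr0n expr1n add0r sqrtr1.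
rewrite orFb (addrC (ln s)) subrK (@eq_cint _ _ _ _ (fun t => h (circ r t) - h (circ s t))); last first.
  by move=> t _; rewrite !El.
have ch x : 0 < x -> x < 1 -> pcontT (fun t => h (circ x t)).
  move=> x0 x1 t; apply: pcont_comp; last exact: pcont_circ.
  have [|l hl] := hh (circ x t); last exact: cdiff_ccont hl.
  by rewrite modulus_circ ?ltW// x0.
rewrite cintB; [|exact/pcontT_pconts/ch..].
by rewrite subr_eq0 => /eqP E'; rewrite /avg E'.
Qed.

Lemma holo_ccont f z : holo f -> normc z < 1 -> ccont f z.
Proof. by move=> hf /hf[l]; exact: cdiff_ccont. Qed.

Lemma holo_circ f r : holo f -> 0 <= r < 1 -> pcontT (fun t => f (circ r t)).
Proof.
move=> hf /andP[r0 r1] t; apply: pcont_comp; last exact: pcont_circ.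
by apply: holo_ccont => //; rewrite modulus_circ.
Qed.

(** The average does not depend on the radius, and it tends to f 0 as the radius shrinks. *)
Lemma avg_holo b f r : holo f -> 0 <= r < 1 -> avg b (fun t => f (circ r t)) = f 0.
Proof.
move=> hf /andP[]; rewrite le_eqVlt => /predU1P[<- _|r0 r1].
  by under eq_avg do rewrite /circ mul0r; rewrite avg_cst.
apply/eqP; rewrite -subr_eq0 -modulus_eq0 eq_le modulus_ge0 andbT.
apply/ler_addgt0Pl => e e0; rewrite addr0.
have [|d d0 Hd] := @holo_ccont _ 0 hf _ e e0; first by rewrite Normc.normc0.
pose s := Num.min (d / 2) (1 / 2).
have s0 : 0 < s by rewrite lt_min !divr_gt0.
have s1 : s < 1 by rewrite gt_min; apply/orP; right; lra.
have sd : s < d by rewrite gt_min; apply/orP; left; lra.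
rewrite (@avg_radius_indep b f r s); [|by move=> z /andP[_]; exact: hf|by rewrite r0|by rewrite s0].
apply: modulus_avg_sub; first by apply: holo_circ => //; rewrite ltW.
by move=> t; apply/ltW/Hd; rewrite subr0 modulus_circ ?ltW.
Qed.

Lemma holo_cst k : holo (fun=> k).
Proof. by move=> z _; exists 0; exact: cdiff_cst. Qed.

Lemma holo_id : holo id.
Proof. by move=> z _; exists 1; exact: cdiff_id. Qed.

Lemma holoD f g : holo f -> holo g -> holo (fun z => f z + g z).
Proof.
by move=> hf hg z z1; have [l fl] := hf z z1; have [m gm] := hg z z1; exists (l + m); exact: cdiffD.
Qed.

Lemma holoM f g : holo f -> holo g -> holo (fun z => f z * g z).
Proof.
by move=> hf hg z z1; have [l fl] := hf z z1; have [m gm] := hg z z1;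
  exists (l * g z + f z * m); exact: cdiffM.
Qed.

Lemma holoX f n : holo f -> holo (fun z => f z ^+ n).
Proof. by move=> hf z z1; have [l fl] := hf z z1; exact: cdiffX fl. Qed.

Lemma holo_comp f g : holo f -> holo g -> (forall z, normc z < 1 -> normc (f z) < 1) ->
  holo (fun z => g (f z)).
Proof.
move=> hf hg fD z z1; have [l fl] := hf z z1; have [m gm] := hg _ (fD _ z1).
by exists (m * l); exact: cdiff_comp.
Qed.

Lemma holo_sum (I : Type) (l : seq I) (F : I -> C -> C) :
  (forall i, holo (F i)) -> holo (fun z => \sum_(i <- l) F i z).
Proof.
move=> hF; elim: l => [|i l IH].
  by under [X in holo X]eq_fun do rewrite big_nil; exact: holo_cst.
by under [X in holo X]eq_fun do rewrite big_cons; exact: holoD.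
Qed.

End Holomorphic.

(** * Poisson and Taylor representations *)

Section PoissonKernel.
Context {R : realType}.
Local Notation C := R[i].
Implicit Types (q z w : C) (N : nat).

Definition pois q : R := (1 - normc q ^+ 2) / normc (1 - q) ^+ 2.

Lemma modulus_1B q : 1 - normc q <= normc (1 - q).
Proof. by have := modulus_sub_ge 1 q; rewrite Normc.normc1. Qed.

Lemma pois_ge0 q : normc q < 1 -> 0 <= pois q.
Proof.
move=> q1; rewrite divr_ge0 ?sqr_ge0// subr_ge0 expr_le1 ?modulus_ge0//; exact: ltW.
Qed.

(** The two terms are sums of geometric series in q and in its conjugate; this links Poisson
    integrals to Taylor series. *)
Lemma poisE q : normc q < 1 ->
  (pois q)%:C%C = (1 - q)^-1 + conjc q / (1 - conjc q).
Proof.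
move=> q1.
have q0 : 1 - q != 0 by rewrite -modulus_gt0; have := modulus_1B q; lra.
have q0' : 1 - conjc q != 0.
  by rewrite -modulus_gt0; have := modulus_1B (conjc q); rewrite modulus_conj; lra.
rewrite /pois rmorphM fmorphV rmorphB/= rmorph1 -mulC_conj.
have -> : (normc (1 - q) ^+ 2)%:C%C = (1 - q) * (1 - conjc q).
  by rewrite -mulC_conj rmorphB/= oppr0.
by field; rewrite q0 q0'.
Qed.

Lemma sum_geometric q N : 1 - q != 0 -> \sum_(i < N) q ^+ i = (1 - q ^+ N) / (1 - q).
Proof.
move=> q0; apply: (mulIf q0); rewrite divfK// mulrC.
by rewrite -opprB mulNr -[1 - q ^+ N]opprB subrX1.
Qed.

Lemma pois_partial_sum q N : normc q < 1 ->
  normc ((pois q)%:C%C - (\sum_(i < N) q ^+ i + \sum_(i < N) conjc q ^+ i.+1))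
    <= 2 * (normc q ^+ N / (1 - normc q)).
Proof.
move=> q1; have n0 := modulus_ge0 q.
have q0 : 1 - q != 0 by rewrite -modulus_gt0; have := modulus_1B q; lra.
have q0' : 1 - conjc q != 0.
  by rewrite -modulus_gt0; have := modulus_1B (conjc q); rewrite modulus_conj; lra.
have -> : \sum_(i < N) conjc q ^+ i.+1 = conjc q * \sum_(i < N) conjc q ^+ i.
  by rewrite mulr_sumr; apply: eq_bigr => i _; rewrite exprS.
rewrite poisE// !sum_geometric//.
rewrite (_ : _ - _ = q ^+ N / (1 - q) + conjc q ^+ N.+1 / (1 - conjc q)); last first.
  by rewrite exprS; field; rewrite q0 q0'.
rewrite mulr_natl mulr2n; apply: le_trans (le_normcD _ _) (lerD _ _).
  rewrite Normc.normcM Normc.normcV modulusX ler_wpM2l ?exprn_ge0//.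
  by rewrite lef_pV2 ?posrE ?modulus_gt0//; [exact: modulus_1B | lra].
rewrite Normc.normcM Normc.normcV modulusX modulus_conj ler_pM ?exprn_ge0 ?invr_ge0 ?modulus_ge0//.
  by rewrite exprS ler_piMl ?exprn_ge0// ltW.
by rewrite lef_pV2 ?posrE ?modulus_gt0//; [rewrite -(modulus_conj q); exact: modulus_1B | lra].
Qed.

End PoissonKernel.

Section TaylorPoisson.
Context {R : realType}.
Local Notation C := R[i].
Implicit Types (b r s t : R) (z w : C) (N n : nat) (f : C -> C).

Lemma cvg_geometric_bound (K q e : R) : 0 <= q < 1 -> 0 < e ->
  exists N0, forall N, (N0 <= N)%N -> `|K * q ^+ N| < e.
Proof.
move=> /andP[q0 q1] e0.
have /cvgrPdist_lt/(_ _ e0) : K * q ^+ n @[n --> \oo] --> K * 0.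
  by apply: cvgMr; apply: cvg_expr; rewrite ger0_norm.
by move=> [N0 _ H]; exists N0 => N /H /=; rewrite mulr0 sub0r normrN.
Qed.

Lemma le_of_geometric_bound (x K q : R) : 0 <= q < 1 ->
  (forall N, x <= K * q ^+ N) -> x <= 0.
Proof.
move=> q01 H; apply/ler_addgt0Pl => e e0; rewrite addr0.
have [N /(_ N (leqnn N)) HN] := cvg_geometric_bound K q01 e0.
by apply: le_trans (H N) _; apply/ltW/(le_lt_trans _ HN)/ler_norm.
Qed.

Lemma le_left_limit1 (P : R -> R) (A : R) : {for 1, continuous P} ->
  (forall r, 0 < r < 1 -> P r <= A) -> P 1 <= A.
Proof.
move=> cP H; apply/ler_addgt0Pl => e e0; rewrite -lerBlDl.
have [d /= d0 Hd] := (nbhs_normP _ _).1 ((cvgrPdist_lt _ _).1 cP _ e0).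
pose r := 1 - Num.min (d / 2) (1 / 2).
have m0 : 0 < Num.min (d / 2) (1 / 2) by rewrite lt_min !divr_gt0.
have m1 : Num.min (d / 2) (1 / 2) <= 1 / 2 by rewrite ge_min lexx orbT.
have m2 : Num.min (d / 2) (1 / 2) <= d / 2 by rewrite ge_min lexx.
have r01 : 0 < r < 1 by rewrite /r; apply/andP; split; lra.
apply: le_trans (H r r01).
have := Hd r; rewrite /ball_/=.
have -> : `|1 - r| < d by rewrite /r opprB addrC subrK gtr0_norm//; lra.
by move=> /(_ isT) /ltW; rewrite ler_norml => /andP[_]; rewrite lerBlDr lerBlDl addrC.
Qed.

Section MeanValues.
Variables (f : C -> C) (B : R).
Hypotheses (hf : holo f) (fB : forall z, normc z < 1 -> normc (f z) <= B).

(** Cauchy's integral for the n-th coefficient, on the fixed circle of radius 1/2; [tcoefE] moves it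
    to any other radius. *)
Definition tcoef b n : C :=
  avg b (fun t => f (circ (1 / 2) t) * (circ (1 / 2) t)^-1 ^+ n).

Lemma bound_ge0 : 0 <= B.
Proof. by apply: le_trans (modulus_ge0 _) (fB (z := 0) _); rewrite Normc.normc0. Qed.

Lemma tcoefE b n r : 0 < r < 1 ->
  tcoef b n = avg b (fun t => f (circ r t) * (circ r t)^-1 ^+ n).
Proof.
move=> r01; apply: (@avg_radius_indep _ b (fun z => f z * z^-1 ^+ n)) => //.
  move=> z /andP[z0 z1]; have [l fl] := hf z1.
  have [m Vm] : exists m, cdiff (fun w => w^-1 ^+ n) z m.
    by apply: cdiffX; apply: cdiffV; rewrite -modulus_gt0.
  by exists (l * z^-1 ^+ n + f z * m); exact: cdiffM.
by apply/andP; split; lra.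
Qed.

Lemma pcontT_tcoef n r : 0 < r < 1 ->
  pcontT (fun t => f (circ r t) * (circ r t)^-1 ^+ n).
Proof.
move=> /andP[r0 r1] t; apply: pcontM; first by apply: holo_circ => //; rewrite ltW.
by apply: pcontX; exact: pcontT_circV.
Qed.

Lemma fcirc_le r t : 0 < r < 1 -> normc (f (circ r t)) <= B.
Proof. by move=> /andP[r0 r1]; apply: fB; rewrite modulus_circ ?ltW. Qed.

(** On the circle of radius r the integral gives |a_n| r^n <= B; then r tends to 1. *)
Lemma tcoef_bound b n : normc (tcoef b n) <= B.
Proof.
rewrite -[leLHS]mulr1 -[X in _ * X](expr1n _ n).
apply: (@le_left_limit1 (fun r => normc (tcoef b n) * r ^+ n)).
  by apply: cvgM; [exact: cvg_cst | exact: exprn_continuous].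
move=> r r01; have /andP[r0 r1] := r01.
rewrite -ler_pdivlMr ?exprn_gt0// (tcoefE b n r01).
apply: modulus_avg_le; first exact: pcontT_tcoef.
move=> t; rewrite Normc.normcM modulusX Normc.normcV modulus_circ ?(ltW r0)// exprVn.
by rewrite ler_wpM2r ?invr_ge0 ?exprn_ge0 ?(ltW r0)//; exact: fcirc_le.
Qed.

Definition tsum b N z : C := \sum_(i < N) tcoef b i * z ^+ i.

Definition pint b r z : C :=
  avg b (fun t => f (circ r t) * (pois (z * (circ r t)^-1))%:C%C).

Lemma modulus_ratio r t z : 0 < r -> normc (z * (circ r t)^-1) = normc z / r.
Proof. by move=> r0; rewrite Normc.normcM Normc.normcV modulus_circ ?ltW. Qed.

Lemma continuous_pois r z : 0 < r -> normc z < r ->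
  continuous (fun t => pois (z * (circ r t)^-1)).
Proof.
move=> r0 zr t.
have cq : pcont (fun t => z * (circ r t)^-1) t.
  by apply: pcontM; [exact: pcont_cst | exact: pcontT_circV].
have c1 : {for t, continuous (fun t => normc (z * (circ r t)^-1))} by exact: pcont_modulus.
have c2 : {for t, continuous (fun t => normc (1 - z * (circ r t)^-1))}.
  by apply: pcont_modulus; apply: pcontB => //; exact: pcont_cst.
apply: cvgM.
  by apply: cvgB; [exact: cvg_cst | apply: cvgM; exact: c1].
apply: cvgV.
  rewrite expf_neq0// gt_eqF//; apply: lt_le_trans (modulus_1B _).
  by rewrite modulus_ratio// subr_gt0 ltr_pdivrMr// mul1r.
by apply: cvgM; exact: c2.
Qed.

Lemma pcontT_pint r z : 0 < r < 1 -> normc z < r ->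
  pcontT (fun t => f (circ r t) * (pois (z * (circ r t)^-1))%:C%C).
Proof.
move=> /andP[r0 r1] zr t; apply: pcontM; first by apply: holo_circ => //; rewrite ltW.
by apply: pcont_real; exact: continuous_pois.
Qed.

(** Integrating f against the truncated kernel gives the Taylor sum: powers of q pick out the
    coefficients, and conjugate powers produce multiples of f(w) w^(i+1), which average to their
    value 0 at the origin. The error is the tail of the kernel. *)
Lemma tsum_pint b N r z : 0 < r < 1 -> normc z < r ->
  normc (tsum b N z - pint b r z) <=
    2 * B / (1 - normc z / r) * (normc z / r) ^+ N.
Proof.
move=> r01 zr; have /andP[r0 r1] := r01.
pose q t := z * (circ r t)^-1.
have cq : pcontT q.
  by move=> t; apply: pcontM; [exact: pcont_cst | exact: pcontT_circV].
have cf : pcontT (fun t => f (circ r t)) by apply: holo_circ => //; rewrite ltW.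
have E : tsum b N z = avg b (fun t => f (circ r t) *
    (\sum_(i < N) q t ^+ i + \sum_(i < N) conjc (q t) ^+ i.+1)).
  have cs1 i : pcontT (fun t => f (circ r t) * q t ^+ i).
    by move=> t; apply: pcontM => //; exact: pcontX.
  have cs2 i : pcontT (fun t => f (circ r t) * conjc (q t) ^+ i).
    by move=> t; apply: pcontM => //; apply: pcontX; exact: pcont_conj.
  under eq_avg do rewrite mulrDr !mulr_sumr.
  rewrite avgD; [|by move=> t; apply: pcont_sum => i _; exact: cs1
                 |by move=> t; apply: pcont_sum => i _; exact: cs2].
  rewrite !avg_sum; [|by move=> i; exact: cs2|by move=> i; exact: cs1].
  rewrite [X in _ + X]big1 ?addr0; last first.
    move=> i _; rewrite (@eq_avg _ _ _ (fun t => (conjc z * (r ^- 2)%:C%C) ^+ i.+1 *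
       (f (circ r t) * circ r t ^+ i.+1))).
      rewrite avgZ; last by move=> t; apply: pcontM => //; apply: pcontX; exact: pcont_circ.
      rewrite (@avg_holo _ b (fun w => f w * w ^+ i.+1)); last by rewrite (ltW r0).
        by rewrite expr0n/= !mulr0.
      by apply: holoM => //; apply: holoX; exact: holo_id.
    move=> t; have cE : conjc ((circ r t)^-1) = (r ^- 2)%:C%C * circ r t.
      by rewrite circV// cconjM conjcK conjc_real.
    rewrite /q cconjM cE !exprMn; ring.
  apply: eq_bigr => i _; rewrite (tcoefE b i r01) mulrC -avgZ; last exact: pcontT_tcoef.
  by apply: eq_avg => t; rewrite /q exprMn mulrCA.
have cd : pcontT (fun t => f (circ r t) *
    (\sum_(i < N) q t ^+ i + \sum_(i < N) conjc (q t) ^+ i.+1)).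
  move=> t; apply: pcontM => //; apply: pcontD; apply: pcont_sum => i _; apply: pcontX => //.
  exact: pcont_conj.
rewrite E /pint -avgB//; last exact: pcontT_pint.
apply: modulus_avg_le.
  by move=> t; apply: pcontB => //; exact: pcontT_pint.
move=> t; rewrite -mulrBr Normc.normcM modulusBC.
have q1 : normc (q t) < 1 by rewrite /q modulus_ratio// ltr_pdivrMr// mul1r.
rewrite -/(q t) mulrAC (mulrC 2) -!mulrA; apply: ler_pM; rewrite ?modulus_ge0//.
  exact: fcirc_le.
have -> : normc z / r = normc (q t) by rewrite /q modulus_ratio.
exact: (pois_partial_sum N q1).
Qed.

Lemma ratio01 r z : 0 < r -> normc z < r -> 0 <= normc z / r < 1.
Proof. by move=> r0 zr; rewrite divr_ge0 ?modulus_ge0 ?(ltW r0)//= ltr_pdivrMr// mul1r. Qed.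

(** Both integrals are limits of the same Taylor sums, which do not depend on the radius. *)
Lemma pint_radius b r s z : 0 < r < 1 -> 0 < s < 1 -> normc z < r -> normc z < s ->
  pint b r z = pint b s z.
Proof.
move=> r01 s01 zr zs; have /andP[r0 _] := r01; have /andP[s0 _] := s01.
apply/eqP; rewrite -subr_eq0 -modulus_eq0 eq_le modulus_ge0 andbT.
pose q := Num.max (normc z / r) (normc z / s).
have /andP[qr0 qr1] := ratio01 r0 zr; have /andP[qs0 qs1] := ratio01 s0 zs.
have qr : normc z / r <= q by rewrite le_max lexx.
have qs : normc z / s <= q by rewrite le_max lexx orbT.
have q01 : 0 <= q < 1 by rewrite gt_max qr1 qs1 (le_trans qr0 qr).
have K r' : 0 < r' -> normc z / r' < 1 -> 0 <= 2 * B / (1 - normc z / r').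
  by move=> r'0 h; rewrite divr_ge0 ?mulr_ge0 ?bound_ge0// subr_ge0 ltW.
apply: (le_of_geometric_bound (K := 2 * B / (1 - normc z / r) + 2 * B / (1 - normc z / s)) q01) => N.
rewrite (_ : _ - _ = (tsum b N z - pint b s z) - (tsum b N z - pint b r z)); last first.
  by rewrite opprB [RHS]addrC addrA subrK.
apply: le_trans (ler_modulusB _ _) _; rewrite mulrDl addrC; apply: lerD.
  apply: le_trans (tsum_pint b N r01 zr) _; apply: ler_wpM2l; first exact: K.
  by apply: lerXn2r => //; rewrite nnegrE (le_trans qr0 qr).
apply: le_trans (tsum_pint b N s01 zs) _; apply: ler_wpM2l; first exact: K.
  by apply: lerXn2r => //; rewrite nnegrE (le_trans qr0 qr).
Qed.

Lemma le_geometric_tail N z : normc z < 1 ->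
  \sum_(i < N) normc z ^+ i <= (1 - normc z)^-1.
Proof.
move=> z1; have z0 : 1 - normc z != 0 by rewrite subr_eq0 eq_sym lt_eqF.
rewrite -[leRHS]mul1r -ler_pdivrMr ?invr_gt0 ?subr_gt0// invrK.
have := subrX1 (normc z) N => /(congr1 -%R); rewrite opprB -mulNr opprB => E.
by rewrite mulrC -E gerBl exprn_ge0 ?modulus_ge0.
Qed.

End MeanValues.

Section RadiusIndependence.
Variables (f : C -> C) (B : R).
Hypotheses (hf : holo f) (fB : forall z, normc z < 1 -> normc (f z) <= B).

Let B0 : 0 <= B := bound_ge0 fB.

(** [tsum_pint] for the constant 1, whose Taylor sums with at least one term equal 1. *)
Lemma avg_pois b r z : 0 < r < 1 -> normc z < r ->
  ravg b (fun t => pois (z * (circ r t)^-1)) = 1.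
Proof.
move=> r01 zr; have /andP[r0 r1] := r01.
have c1 : holo (fun=> 1 : C) by exact: holo_cst.
have B1 w : normc w < 1 -> normc (1 : C) <= 1 by rewrite Normc.normc1.
have E N : tsum (fun=> 1) b N.+1 z = 1.
  rewrite /tsum big_ord_recl expr0 mulr1 big1 ?addr0.
    by rewrite /tcoef; under eq_avg do rewrite expr0 mulr1; exact: avg_cst.
  move=> i _; rewrite (tcoefE c1 b _ r01).
  rewrite (@eq_avg _ _ _ (fun t => (r ^- 2)%:C%C ^+ (lift ord0 i) *
      conjc (circ r t ^+ (lift ord0 i)))); last first.
    by move=> t; rewrite mul1r circV// exprMn cconjX.
  have cc : pcontT (fun t => circ r t ^+ lift ord0 i).
    by move=> t; apply: pcontX; exact: pcont_circ.
  rewrite avgZ; last by move=> t; exact: pcont_conj.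
  rewrite avg_conj// (@avg_holo _ b (fun w => w ^+ _)) ?(ltW r0)//.
    have z0 : (0 : C) ^+ lift ord0 i = 0 by rewrite expr0n.
    by rewrite z0 conjc0 mulr0 mul0r.
  by apply: holoX; exact: holo_id.
apply: (@complexI R); rewrite -avg_real rmorph1.
apply/eqP; rewrite eq_sym -subr_eq0 -modulus_eq0 eq_le modulus_ge0 andbT.
have q01 := ratio01 r0 zr.
apply: (le_of_geometric_bound (K := 2 * 1 / (1 - normc z / r) * (normc z / r)) q01) => N.
have := tsum_pint c1 B1 b N.+1 r01 zr; rewrite E exprS mulrA.
by rewrite /pint; under eq_avg do rewrite mul1r.
Qed.

(* The Poisson kernel is an approximate identity: it is small away from w. *)
Lemma pint_limit b w e : 0 < normc w < 1 -> 0 < e ->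
  exists2 d, 0 < d & forall s, 0 < s < 1 -> 1 - s < d ->
    normc (pint f b (normc w) (s%:C%C * w) - f w) <= e.
Proof.
move=> /andP[]; set r := normc w => r0 r1 e0.
have r01 : 0 < r < 1 by rewrite r0.
have e2 : 0 < e / 2 by rewrite divr_gt0.
have [d d0 Hd] := holo_ccont hf r1 e2.
pose K := 2 * B / d ^+ 2 * (8 * r ^+ 2) + 1.
have X0 : 0 <= 2 * B / d ^+ 2 by rewrite divr_ge0 ?sqr_ge0// mulr_ge0.
have K0 : 0 < K by rewrite ltr_wpDl// mulr_ge0// mulr_ge0// sqr_ge0.
exists (e / 2 / K); first by rewrite divr_gt0.
move=> s /andP[s0 s1]; rewrite ltr_pdivlMr// => sd.
have sw : normc (s%:C%C * w) = s * r by rewrite Normc.normcM modulus_real ger0_norm// ltW.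
have swr : normc (s%:C%C * w) < r by rewrite sw gtr_pMl.
pose q t := s%:C%C * w * (circ r t)^-1.
have q1 t : normc (q t) = s by rewrite /q modulus_ratio// sw mulfK// gt_eqF.
have cp : continuous (fun t => pois (q t)) by exact: continuous_pois.
have cf : pcontT (fun t => f (circ r t)) by apply: holo_circ => //; rewrite ltW.
have pp t : 0 <= pois (q t) by apply: pois_ge0; rewrite q1.
have cpc : pcontT (fun t => (pois (q t))%:C%C).
  by move=> t; apply: pcont_real; exact: cp.
have cfw : pcontT (fun t => f (circ r t) - f w).
  by move=> t; apply: pcontB => //; exact: pcont_cst.
have E1 : f w = avg b (fun t => f w * (pois (q t))%:C%C).
  by rewrite avgZ// avg_real (avg_pois b r01 swr) mulr1.
rewrite {1}E1 /pint -avgB; last 2 first.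
  by move=> t; apply: pcontM.
  by move=> t; apply: pcontM => //; exact: pcont_cst.
under eq_avg do rewrite -mulrBl.
have cm : pcontT (fun t => (f (circ r t) - f w) * (pois (q t))%:C%C).
  by move=> t; apply: pcontM.
apply: le_trans (modulus_avg b cm) _.
apply: (@le_trans _ _ (ravg b (fun t => e / 2 * pois (q t) + 2 * B / d ^+ 2 * (4 * (1 - s ^+ 2) * r ^+ 2)))).
  apply: le_ravg.
  - exact: pcontT_modulus.
  - by move=> t; apply: cvgD; [apply: cvgM; [exact: cvg_cst | exact: cp] | exact: cvg_cst].
  move=> t; rewrite Normc.normcM modulus_real ger0_norm//.
  pose x := normc (circ r t - w).
  (* Near w continuity gives e / 2; at distance d or more, the crude bound 2 B is at most 2 B (x /
     d)^2. The square will cancel the denominator of the kernel. *)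
  have fx : normc (f (circ r t) - f w) <= e / 2 + 2 * B / d ^+ 2 * x ^+ 2.
    have [/Hd/ltW H|dx] := ltP x d.
      by apply: le_trans H _; rewrite lerDl mulr_ge0// sqr_ge0.
    apply: le_trans (ler_modulusB _ _) _.
    apply: (@le_trans _ _ (2 * B)).
      rewrite mulr_natl mulr2n; apply: lerD; first by exact: fcirc_le.
      exact: fB.
    apply: ler_wpDl; first exact: ltW.
    rewrite -mulrA ler_peMr ?mulr_ge0// mulrC ler_pdivlMr ?exprn_gt0// mul1r.
    by rewrite lerXn2r ?nnegrE ?(ltW d0)// (le_trans (ltW d0)).
  apply: le_trans (ler_wpM2r (pp t) fx) _; rewrite mulrDl lerD2l -[leLHS]mulrA.
  rewrite ler_wpM2l//.
  have cn0 := circ_neq0 t r0.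
  have y : normc (1 - q t) = normc (circ r t - s%:C%C * w) / r.
    by rewrite -(modulus_ratio t _ r0) /q mulrBl divff.
  set Y := normc (circ r t - s%:C%C * w) in y.
  have Y0 : (1 - s) * r <= Y.
    by have := modulus_sub_ge (circ r t) (s%:C%C * w); rewrite sw modulus_circ ?(ltW r0)// -/Y; lra.
  have Yp : 0 < Y by apply: lt_le_trans Y0; rewrite mulr_gt0// subr_gt0.
  (* Replacing w by s w moves it by (1 - s) r, which is at most Y. *)
  have xY : x <= 2 * Y.
    rewrite /x (_ : _ - w = (circ r t - s%:C%C * w) - (1 - s)%:C%C * w); last first.
      by rewrite rmorphB rmorph1; ring.
    apply: le_trans (ler_modulusB _ _) _; rewrite -/Y Normc.normcM modulus_real -/r.
    rewrite ger0_norm; lra.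
  have xx : x ^+ 2 <= 4 * Y ^+ 2.
    rewrite (_ : 4 * Y ^+ 2 = (2 * Y) ^+ 2); last by ring.
    by rewrite lerXn2r ?nnegrE ?modulus_ge0// mulr_ge0// ltW.
  rewrite /pois q1 y expr_div_n invfM invrK.
  have s20 : 0 <= 1 - s ^+ 2 by rewrite subr_ge0 expr_le1 ?(ltW s0)//; exact: ltW.
  rewrite mulrCA; apply: le_trans (ler_wpM2l _ (ler_wpM2r _ xx)) _ => //.
    by rewrite mulr_ge0 ?invr_ge0 ?sqr_ge0.
  rewrite le_eqVlt; apply/orP; left; apply/eqP; field.
  by rewrite gt_eqF.
rewrite ravgD; last 2 first.
  by move=> t; apply: cvgM; [exact: cvg_cst | exact: cp].
  by move=> t; exact: cvg_cst.
have E2 : ravg b (fun t => pois (q t)) = 1 := avg_pois b r01 swr.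
rewrite (@ravgZ _ b (e / 2) (fun t => pois (q t)))// E2 ravg_cst mulr1 [leRHS]splitr lerD2l.
apply: le_trans (ltW sd); rewrite /K.
have r20 : 0 <= r ^+ 2 by rewrite sqr_ge0.
have : 1 - s ^+ 2 <= 2 * (1 - s).
  rewrite (_ : 1 - s ^+ 2 = (1 + s) * (1 - s)); last by ring.
  by rewrite ler_wpM2r//; lra.
set X := 2 * B / d ^+ 2 in X0 *; set r2 := r ^+ 2 in r20 *; set s2 := 1 - s ^+ 2 => A.
have : X * r2 * s2 <= X * r2 * (2 * (1 - s)) by rewrite ler_wpM2l// mulr_ge0.
lra.
Qed.

End RadiusIndependence.

End TaylorPoisson.

(** * The Poisson formula and the Taylor expansion *)

Section Taylor.
Context {R : realType}.
Local Notation C := R[i].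
Implicit Types (b r s t : R) (z w : C) (N n : nat) (f : C -> C).

Section Representation.
Variables (f : C -> C) (B : R).
Hypotheses (hf : holo f) (fB : forall z, normc z < 1 -> normc (f z) <= B).

Let B0 : 0 <= B := bound_ge0 fB.

(** The integral over the circle through z tends to f z along the points s z as s tends to 1. The
    integral over radius r is continuous along these points, being there a uniform limit of Taylor
    sums. Both agree at s z by [pint_radius], so the second one equals f z at z. *)
Lemma pintE b r z : 0 < r < 1 -> normc z < r -> pint f b r z = f z.
Proof.
move=> r01 zr; have /andP[r0 r1] := r01.
(* At z = 0 the circle through z degenerates; the kernel is then 1 and the mean value property
   suffices. *)
have [z0|z0] := eqVneq z 0.
  rewrite z0 /pint; under eq_avg do
    rewrite mul0r /pois Normc.normc0 subr0 Normc.normc1 expr0n/= subr0 expr1n divr1 mulr1.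
  by rewrite avg_holo// (ltW r0).
have zp : 0 < normc z by rewrite modulus_gt0.
have z01 : 0 < normc z < 1 by rewrite zp (lt_trans zr).
apply/eqP; rewrite -subr_eq0 -modulus_eq0 eq_le modulus_ge0 andbT.
apply/ler_addgt0Pl => e e0; rewrite addr0.
have e4 : 0 < e / 4 by rewrite divr_gt0.
have q01 := ratio01 r0 zr; have /andP[q0 q1] := q01.
have [N HN] := cvg_geometric_bound (2 * B / (1 - normc z / r)) q01 e4.
have {}HN : 2 * B / (1 - normc z / r) * (normc z / r) ^+ N <= e / 4.
  by apply/ltW/(le_lt_trans _ (HN N (leqnn N)))/ler_norm.
have [d1 d10 H1] := pint_limit hf fB b z01 e4.
have cN : pcont (fun s => tsum f b N (s%:C%C * z)) 1.
  apply: pcont_sum => i _; apply: pcontM; first exact: pcont_cst.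
  apply: pcontX; apply: pcontM; last exact: pcont_cst.
  by apply: pcont_real; exact: cvg_id.
have [d2 d20 H2] := (pcontP _ _).1 cN _ e4.
pose m := Num.min (Num.min d1 d2) 1 / 2.
have m0 : 0 < Num.min (Num.min d1 d2) 1 by rewrite !lt_min d10 d20 ltr01.
have [md1 md2 m1] : [/\ Num.min (Num.min d1 d2) 1 <= d1,
  Num.min (Num.min d1 d2) 1 <= d2 & Num.min (Num.min d1 d2) 1 <= 1].
  by rewrite !ge_min !lexx !orbT.
pose s := 1 - m.
have s01 : 0 < s < 1 by rewrite /s /m; apply/andP; split; lra.
have /andP[s0 s1] := s01.
have sz : normc (s%:C%C * z) = s * normc z.
  by rewrite Normc.normcM modulus_real ger0_norm// ltW.
have szz : normc (s%:C%C * z) < normc z by rewrite sz gtr_pMl.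
have szr : normc (s%:C%C * z) < r := lt_trans szz zr.
have A1 : normc (pint f b (normc z) (s%:C%C * z) - f z) <= e / 4.
  by apply: H1 => //; rewrite /s /m; lra.
have A2 : normc (tsum f b N (s%:C%C * z) - tsum f b N z) <= e / 4.
  apply/ltW; have := H2 s; rewrite mul1r; apply.
  by rewrite distrC /s opprB addrC subrK gtr0_norm /m; lra.
have A3 := le_trans (tsum_pint hf fB b N r01 zr) HN.
have A4 : normc (tsum f b N (s%:C%C * z) - pint f b r (s%:C%C * z)) <= e / 4.
  apply: le_trans (tsum_pint hf fB b N r01 szr) _; apply: le_trans HN.
  have sq : normc (s%:C%C * z) / r <= normc z / r.
    by rewrite ler_pM2r ?invr_gt0// ltW.
  have sq0 : 0 <= normc (s%:C%C * z) / r by rewrite divr_ge0 ?modulus_ge0// ltW.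
  apply: ler_pM.
  - by rewrite divr_ge0 ?mulr_ge0// subr_ge0 (le_trans sq)// ltW.
  - by rewrite exprn_ge0.
  - apply: ler_wpM2l; first by rewrite mulr_ge0.
    by rewrite lef_pV2 ?posrE ?subr_gt0//; [rewrite lerB | exact: le_lt_trans sq q1].
  - exact: lerXn2r.
rewrite (pint_radius hf fB b r01 z01 szr szz) in A4.
rewrite (_ : _ - f z = (pint f b (normc z) (s%:C%C * z) - f z)
  + (tsum f b N (s%:C%C * z) - pint f b (normc z) (s%:C%C * z))
  - (tsum f b N (s%:C%C * z) - tsum f b N z)
  - (tsum f b N z - pint f b r z)); last by ring.
apply: le_trans (ler_modulusB _ _) _.
apply: le_trans (lerD (ler_modulusB _ _) (lexx _)) _.
apply: le_trans (lerD (lerD (le_normcD _ _) (lexx _)) (lexx _)) _.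
lra.
Qed.

(** Written at r z so that the kernel does not involve r: values at two radii then differ by a
    single Poisson integral, which is how [stolz_step] uses it. *)
Lemma poisson_formula b r z : 0 < r < 1 -> normc z < 1 ->
  f (r%:C%C * z) = avg b (fun t => f (circ r t) * (pois (z * conjc (cis t)))%:C%C).
Proof.
move=> r01 z1; have /andP[r0 r1] := r01.
rewrite -(pintE b r01); last first.
  by rewrite Normc.normcM modulus_real ger0_norm ?(ltW r0)// gtr_pMr.
apply: eq_avg => t; rewrite circV// /circ cconjM conjc_real.
congr (_ * (pois _)%:C%C).
rewrite (_ : _ * _ = ((r * (r ^- 2 * r))%:C%C) * (z * conjc (cis t))).
  rewrite (_ : r * _ = 1) ?mul1r//; field; by rewrite gt_eqF.
by rewrite !rmorphM/=; ring.
Qed.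

(** A longer partial sum, of length N + M, is close to f z by the Poisson formula; the terms from N
    on are summed with the coefficient bound B. *)
Lemma taylor_tail z N : normc z < 1 ->
  normc (f z - tsum f 0 N z) <= B * (normc z ^+ N / (1 - normc z)).
Proof.
move=> z1; have z10 : 0 < 1 - normc z by rewrite subr_gt0.
apply/ler_addgt0Pl => e e0.
pose r := (normc z + 1) / 2.
have zr : normc z < r by rewrite /r; lra.
have r01 : 0 < r < 1 by have := modulus_ge0 z; rewrite /r => ?; apply/andP; split; lra.
have /andP[r0 r1] := r01.
have q01 := ratio01 r0 zr.
have [M HM] := cvg_geometric_bound (2 * B / (1 - normc z / r)) q01 e0.
have {}HM : normc (f z - tsum f 0 (N + M) z) <= e.
  rewrite -(pintE 0 r01 zr) modulusBC; apply: le_trans (tsum_pint hf fB 0 (N + M) r01 zr) _.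
  by apply/ltW/(le_lt_trans _ (HM (N + M)%N (leq_addl _ _)))/ler_norm.
rewrite (_ : _ - _ = (f z - tsum f 0 (N + M) z) + (tsum f 0 (N + M) z - tsum f 0 N z)); last by ring.
apply: le_trans (le_normcD _ _) (lerD HM _).
rewrite /tsum big_split_ord/= addrAC subrr add0r.
apply: le_trans (sum_modulus_le _ _ _) _.
apply: (@le_trans _ _ (\sum_(i < M) B * normc z ^+ N * normc z ^+ i)).
  apply: ler_sum => i _; rewrite Normc.normcM modulusX exprD -mulrA.
  rewrite ler_wpM2r ?mulr_ge0 ?exprn_ge0 ?modulus_ge0//; exact: tcoef_bound.
rewrite -mulr_sumr -mulrA ler_wpM2l//.
by rewrite ler_wpM2l ?exprn_ge0 ?modulus_ge0//; exact: le_geometric_tail.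
Qed.

End Representation.

Definition taylor f n : C := tcoef f 0 n.

Lemma taylor_bound f B n : holo f -> (forall z, normc z < 1 -> normc (f z) <= B) ->
  normc (taylor f n) <= B.
Proof. by move=> hf fB; exact: tcoef_bound. Qed.

Lemma taylor_expansion f B N z : holo f ->
  (forall z, normc z < 1 -> normc (f z) <= B) -> normc z < 1 ->
  normc (f z - \sum_(i < N) taylor f i * z ^+ i) <= B * (normc z ^+ N / (1 - normc z)).
Proof. by move=> hf fB; exact: taylor_tail. Qed.

(* The derivative bound is the Cauchy estimate, the other one Schwarz's lemma:
   both follow from the first coefficients alone. *)
Lemma taylor0 f B : holo f -> (forall z, normc z < 1 -> normc (f z) <= B) ->
  taylor f 0 = f 0.
Proof.
move=> hf fB; have := @taylor_expansion f B 1 0 hf fB.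
rewrite Normc.normc0 ltr01 => /(_ isT); rewrite big_ord1 expr0 mulr1 expr1 mul0r mulr0.
move=> H; apply/esym/eqP; rewrite -subr_eq0 -modulus_eq0 eq_le modulus_ge0 andbT//.
Qed.

Lemma taylor1 f B l : holo f -> (forall z, normc z < 1 -> normc (f z) <= B) ->
  cdiff f 0 l -> taylor f 1 = l.
Proof.
move=> hf fB fl; have B0 := bound_ge0 fB.
suff H : cdiff f 0 (taylor f 1) by exact: cdiff_unique H fl.
move=> e e0; pose d := Num.min (1 / 2) (e / (2 * B + 1)).
have B1 : 0 < 2 * B + 1 by rewrite ltr_wpDl// mulr_ge0.
exists d; first by rewrite lt_min !divr_gt0.
move=> h; rewrite lt_min !ltr_pdivlMr// => /andP[h1 h2].
have h0 := modulus_ge0 h.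
have := @taylor_expansion f B 2 h hf fB; have hlt : normc h < 1 by lra.
move=> /(_ hlt); rewrite add0r; rewrite big_ord_recr big_ord1/= expr0 expr1 mulr1 (taylor0 hf fB).
rewrite opprD addrA => /le_trans; apply.
apply: (@le_trans _ _ (B * (normc h ^+ 2 * 2))).
  rewrite ler_wpM2l// ler_wpM2l ?sqr_ge0//.
  by rewrite -[leRHS]invrK lef_pV2 ?posrE ?invr_gt0//; lra.
rewrite expr2; set n := normc h in h0 h2 *.
rewrite (_ : B * _ = n * (2 * B) * n); last by ring.
by rewrite ler_wpM2r//; lra.
Qed.

End Taylor.

(** * Parseval's identity and mean squares *)

Section Parseval.
Context {R : realType}.
Local Notation C := R[i].
Implicit Types (b r s t : R) (z w : C) (N n m : nat) (f g : C -> C) (a c : nat -> C).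

Definition bdd f (B : R) := forall z, normc z < 1 -> normc (f z) <= B.

(** The coefficients are a parameter because Parseval is also applied to dilated differences and to
    Taylor tails, whose coefficients are explicit modifications of those of another function. *)
Definition expands f a (B : R) := (forall n, normc (a n) <= B) /\
  forall z N, normc z < 1 ->
    normc (f z - \sum_(i < N) a i * z ^+ i) <= B * (normc z ^+ N / (1 - normc z)).

Definition E2 b r f : R := ravg b (fun t => normc (f (circ r t)) ^+ 2).

Definition psum a r N : R := \sum_(i < N) normc (a i) ^+ 2 * r ^+ (2 * i).

Lemma taylor_expands f B : holo f -> bdd f B -> expands f (taylor f) B.
Proof.
by move=> hf fB; split=> [n|z N z1]; [exact: taylor_bound | exact: taylor_expansion].
Qed.

Lemma continuous_sqr_modulus (h : R -> C) : pcontT h ->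
  continuous (fun t => normc (h t) ^+ 2).
Proof. by move=> ch t; apply: cvgM; apply: pcont_modulus; exact: ch. Qed.

Local Hint Resolve continuous_sqr_modulus : core.

Lemma E2_continuous f r : holo f -> 0 <= r < 1 ->
  continuous (fun t => normc (f (circ r t)) ^+ 2).
Proof. by move=> hf r01; apply: continuous_sqr_modulus; exact: holo_circ. Qed.

Lemma le_psum a r N M : 0 <= r -> (N <= M)%N -> psum a r N <= psum a r M.
Proof.
move=> r0 /subnKC <-; rewrite /psum big_split_ord/= lerDl.
by apply: sumr_ge0 => i _; rewrite mulr_ge0 ?sqr_ge0 ?exprn_ge0.
Qed.

Lemma le_psum_radius a r s N : 0 <= r -> r <= s -> psum a r N <= psum a s N.
Proof.
move=> r0 rs; apply: ler_sum => i _; rewrite ler_wpM2l ?sqr_ge0//.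
by rewrite lerXn2r ?nnegrE// (le_trans r0).
Qed.

Lemma avg_monomials b r n m : 0 <= r < 1 ->
  avg b (fun t => circ r t ^+ n * conjc (circ r t ^+ m)) =
  if n == m then (r ^+ (2 * n))%:C%C else 0.
Proof.
move=> r01; have /andP[r0 r1] := r01.
have base p q : avg b (fun t => circ r t ^+ (q + p) * conjc (circ r t ^+ p)) =
    if q == 0%N then (r ^+ (2 * p))%:C%C else 0.
  rewrite (@eq_avg _ _ _ (fun t => (r ^+ (2 * p))%:C%C * circ r t ^+ q)); last first.
    move=> t; rewrite exprD -mulrA mulC_conj modulusX modulus_circ//.
    by rewrite -exprM mulnC mulrC.
  rewrite avgZ; last by move=> t; apply: pcontX; exact: pcont_circ.
  rewrite (@avg_holo _ b (fun w => w ^+ q))//; last by apply: holoX; exact: holo_id.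
  by rewrite expr0n; case: eqP => _; rewrite ?mulr1 ?mulr0.
have [le|/ltnW le] := leqP m n.
  by rewrite -{1}(subnK le) base subn_eq0 eqn_leq le andbT; case: ifP => // nm;
    congr ((r ^+ (2 * _))%:C%C); apply/eqP; rewrite eqn_leq nm le.
rewrite (@eq_avg _ _ _ (fun t => conjc (circ r t ^+ m * conjc (circ r t ^+ n)))); last first.
  by move=> t; rewrite cconjM conjcK mulrC.
rewrite avg_conj; last first.
  move=> t; apply: pcontM; first by apply: pcontX; exact: pcont_circ.
  by apply: pcont_conj; apply: pcontX; exact: pcont_circ.
rewrite -(subnK le) base subn_eq0 eqn_leq (subnK le) le/=.
by case: ifP => _; rewrite ?conjc0 ?conjc_real.
Qed.

Lemma pcontT_poly c r N : pcontT (fun t => \sum_(i < N) c i * circ r t ^+ i).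
Proof.
move=> t; apply: pcont_sum => i _; apply: pcontM; first exact: pcont_cst.
by apply: pcontX; exact: pcont_circ.
Qed.

Lemma parseval_poly b c r N : 0 <= r < 1 ->
  ravg b (fun t => normc (\sum_(i < N) c i * circ r t ^+ i) ^+ 2) = psum c r N.
Proof.
move=> r01; apply: (@complexI R); rewrite -avg_real.
under eq_avg do rewrite -mulC_conj.
rewrite (@eq_avg _ _ _ (fun t => \sum_(i < N) \sum_(j < N)
  (c i * conjc (c j)) * (circ r t ^+ i * conjc (circ r t ^+ j)))); last first.
  move=> t; rewrite (rmorph_sum (@conjc R)) big_distrlr/=.
  by apply: eq_bigr => i _; apply: eq_bigr => j _; rewrite cconjM; ring.
have cij (i j : nat) : pcontT (fun t => circ r t ^+ i * conjc (circ r t ^+ j)).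
  move=> t; apply: pcontM; first by apply: pcontX; exact: pcont_circ.
  by apply: pcont_conj; apply: pcontX; exact: pcont_circ.
have cij' (i j : nat) : pcontT (fun t => (c i * conjc (c j)) * (circ r t ^+ i * conjc (circ r t ^+ j))).
  by move=> t; apply: pcontM; [exact: pcont_cst | exact: cij].
rewrite avg_sum; last by move=> i t; apply: pcont_sum => j _; exact: cij'.
rewrite /psum rmorph_sum/=; apply: eq_bigr => i _.
rewrite avg_sum// (bigD1 i)//= avgZ// avg_monomials// eqxx big1 ?addr0.
  by rewrite mulC_conj -rmorphM.
move=> j ji; rewrite avgZ// avg_monomials//.
by rewrite eq_sym (inj_eq val_inj) (negbTE ji) mulr0.
Qed.

Lemma sqr_modulus_close (x y : C) (B e : R) : 0 <= e -> normc x <= B -> normc (x - y) <= e ->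
  `|normc x ^+ 2 - normc y ^+ 2| <= e * (2 * B + e).
Proof.
move=> e0 xB xy; rewrite subr_sqr normrM.
have x0 := modulus_ge0 x; have y0 := modulus_ge0 y.
have H1 := modulus_sub_ge x y; have H2 := modulus_sub_ge y x.
rewrite modulusBC in H2.
apply: ler_pM => //; first by rewrite ler_norml; apply/andP; split; lra.
by rewrite ger0_norm ?addr_ge0//; lra.
Qed.

Lemma expands_bound f a B : expands f a B -> 0 <= B.
Proof. by move=> [/(_ 0%N) H _]; apply: le_trans H; exact: modulus_ge0. Qed.

(** The identity is exact for polynomials by orthogonality, and f differs from its partial sum by at
    most [tau N] on the whole circle. *)
Lemma E2_psum b f a B A r : holo f -> expands f a B -> bdd f A -> 0 <= r < 1 ->
  psum a r N @[N --> \oo] --> E2 b r f.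
Proof.
move=> hf fa fA r01; have /andP[r0 r1] := r01.
have B0 := expands_bound fa.
have A0 : 0 <= A := bound_ge0 fA.
pose tau N := B * (r ^+ N / (1 - r)).
have K0 : 0 <= B / (1 - r) by rewrite divr_ge0// subr_ge0 ltW.
have tau0 N : 0 <= tau N by rewrite mulr_ge0// divr_ge0 ?exprn_ge0// subr_ge0 ltW.
have cvg_tau : tau N @[N --> \oo] --> (0 : R).
  rewrite (_ : tau = fun N => B / (1 - r) * r ^+ N); last first.
    by apply/funext => N; rewrite /tau mulrA mulrAC.
  rewrite -[X in _ --> X](mulr0 (B / (1 - r))); apply: cvgMr.
  by apply: cvg_expr; rewrite ger0_norm.
have key N : `|E2 b r f - psum a r N| <= tau N * (2 * A + tau N).
  rewrite -(parseval_poly b a N r01) /E2.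
  have cf := E2_continuous hf r01.
  have cp := continuous_sqr_modulus (@pcontT_poly a r N).
  rewrite -ravgB// ler_norml; apply/andP; split.
    rewrite -(ravg_cst b (- _)); apply: le_ravg.
    - by move=> t; exact: cvg_cst.
    - by move=> t; apply: cvgB; [exact: cf | exact: cp].
    - move=> t; have tr : normc (circ r t) < 1 by rewrite modulus_circ.
      have := sqr_modulus_close (tau0 N) (fA _ tr) (y := \sum_(i < N) a i * circ r t ^+ i).
      rewrite ler_norml => /(_ _)/andP[]//.
      by have := fa.2 _ N tr; rewrite modulus_circ.
  rewrite -[leRHS](ravg_cst b); apply: le_ravg.
    - by move=> t; apply: cvgB; [exact: cf | exact: cp].
    - by move=> t; exact: cvg_cst.
    - move=> t; have tr : normc (circ r t) < 1 by rewrite modulus_circ.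
      have := sqr_modulus_close (tau0 N) (fA _ tr) (y := \sum_(i < N) a i * circ r t ^+ i).
      rewrite ler_norml => /(_ _)/andP[]//.
      by have := fa.2 _ N tr; rewrite modulus_circ.
apply/cvgrPdist_le => e e0.
have : tau N * (2 * A + tau N) @[N --> \oo] --> 0 * (2 * A + 0).
  by apply: cvgM => //; apply: cvgD => //; exact: cvg_cst.
rewrite mul0r => /cvgrPdist_le /(_ _ e0) => H; near=> N.
apply: le_trans (key N) _; apply: le_trans (ler_norm _) _.
by rewrite -normrN -sub0r; near: N; exact: H.
Unshelve. all: by end_near. Qed.

Lemma psum_le_E2 b f a B A r N : holo f -> expands f a B -> bdd f A -> 0 <= r < 1 ->
  psum a r N <= E2 b r f.
Proof.
move=> hf fa fA r01; have /andP[r0 r1] := r01.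
have H := E2_psum (b := b) hf fa fA r01.
rewrite -(cvg_lim _ H)//; apply: limr_ge; first by apply/cvg_ex; eexists; exact: H.
by exists N => // M /= NM; exact: le_psum.
Qed.

Lemma E2_le_psum b f a B A r (K : R) : holo f -> expands f a B -> bdd f A -> 0 <= r < 1 ->
  (forall N, psum a r N <= K) -> E2 b r f <= K.
Proof.
move=> hf fa fA r01 HK; have H := E2_psum (b := b) hf fa fA r01.
rewrite -(cvg_lim _ H)//; apply: limr_le; first by apply/cvg_ex; eexists; exact: H.
by near=> M; exact: HK.
Unshelve. all: by end_near. Qed.

Lemma E2_base b b' f B r : holo f -> bdd f B -> 0 <= r < 1 -> E2 b r f = E2 b' r f.
Proof.
move=> hf fB r01; have fa := taylor_expands hf fB.
have H := E2_psum (b := b) hf fa fB r01; have H' := E2_psum (b := b') hf fa fB r01.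
exact: cvg_unique H H'.
Qed.

Lemma le_E2 b f B r s : holo f -> bdd f B -> 0 <= r -> r <= s -> s < 1 ->
  E2 b r f <= E2 b s f.
Proof.
move=> hf fB r0 rs s1; have fa := taylor_expands hf fB.
have r01 : 0 <= r < 1 by rewrite r0 (le_lt_trans rs).
have s01 : 0 <= s < 1 by rewrite s1 (le_trans r0).
apply: (E2_le_psum b hf fa fB r01) => N; apply: le_trans (le_psum_radius _ _ r0 rs) _.
exact: (psum_le_E2 b N hf fa fB s01).
Qed.

Lemma E2_le_sqr b f B r : holo f -> bdd f B -> 0 <= r < 1 -> E2 b r f <= B ^+ 2.
Proof.
move=> hf fB r01; have /andP[r0 r1] := r01; rewrite -[leRHS](ravg_cst b); apply: le_ravg.
- exact: E2_continuous.
- by move=> t; exact: cvg_cst.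
- by move=> t; rewrite lerXn2r ?nnegrE ?modulus_ge0 ?(bound_ge0 fB)// fB// modulus_circ.
Qed.

Lemma continuous_psum a N : continuous (fun r => psum a r N).
Proof.
move=> r; elim: N => [|N IH].
  rewrite (_ : (fun _ => _) = fun=> 0); first exact: cvg_cst.
  by apply/funext => s; rewrite /psum big_ord0.
rewrite (_ : (fun _ => _) = fun s => psum a s N + normc (a N) ^+ 2 * s ^+ (2 * N)).
  apply: cvgD; first exact: IH.
  by apply: cvgM; [exact: cvg_cst | exact: exprn_continuous].
by apply/funext => s; rewrite /psum big_ord_recr.
Qed.

Lemma psum1_le f a B A K N : holo f -> expands f a B -> bdd f A ->
  (forall r, 0 < r < 1 -> E2 0 r f <= K) -> psum a 1 N <= K.
Proof.
move=> hf fa fA H; apply: (@le_left_limit1 R (fun r => psum a r N)).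
  exact: continuous_psum.
move=> r r01; apply: le_trans (H r r01); apply: psum_le_E2 hf fa fA _.
by case/andP: r01 => /ltW ->.
Qed.

Lemma psum_dilation_diff a (x s : R) N : 0 <= x <= 1 -> 0 <= s ->
  psum (fun n => a n * (1 - x%:C%C ^+ n)) s N <= psum a s N - psum a (x * s) N.
Proof.
move=> /andP[x0 x1] s0; rewrite /psum -sumrB; apply: ler_sum => i _.
have -> : 1 - x%:C%C ^+ i = (1 - x ^+ i)%:C%C by rewrite rmorphB rmorph1 rmorphXn.
rewrite Normc.normcM modulus_real.
have xi : 0 <= x ^+ i <= 1 by rewrite exprn_ge0//= exprn_ile1.
have /andP[xi0 xi1] := xi.
rewrite ger0_norm ?subr_ge0// !exprMn -mulrBr -mulrA ler_wpM2l ?sqr_ge0//.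
rewrite mulnC !exprM -[X in _ <= X - _]mul1r -mulrBl ler_wpM2r ?sqr_ge0 ?exprn_ge0//.
by move: xi0 xi1; set X := x ^+ i => ? ?; nra.
Qed.

(* Both sides are sums over the Taylor coefficients; termwise this is
   [(1 - x)^2 <= 1 - x^2] for [0 <= x <= 1]. *)
Lemma E2_radial_diff b f B r s : holo f -> bdd f B -> 0 <= r -> r <= s -> 0 < s -> s < 1 ->
  ravg b (fun t => normc (f (circ s t) - f (circ r t)) ^+ 2) <= E2 b s f - E2 b r f.
Proof.
move=> hf fB r0 rs s0 s1.
have r01 : 0 <= r < 1 by rewrite r0 (le_lt_trans rs).
have s01 : 0 <= s < 1 by rewrite s1 ltW.
(* The increment becomes u z = f z - f (x z) on the single circle of radius s, so that Parseval
   applies to u. *)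
pose x := r / s.
have x01 : 0 <= x <= 1 by rewrite divr_ge0 ?(ltW s0)//= ler_pdivrMr// mul1r.
have /andP[x0 x1] := x01.
have xs : x * s = r by rewrite /x divfK// gt_eqF.
pose u z := f z - f (x%:C%C * z).
have nx z : normc (x%:C%C * z) = x * normc z.
  by rewrite Normc.normcM modulus_real ger0_norm.
have nx1 z : normc z < 1 -> normc (x%:C%C * z) < 1.
  by move=> z1; rewrite nx; apply: le_lt_trans z1; rewrite ler_piMl ?modulus_ge0.
have hu : holo u.
  move=> z z1; have [l fl] := hf z z1; have [m fm] := hf _ (nx1 z z1).
  exists (l + (0 * m + -1 * (m * (0 * z + x%:C%C * 1)))).
  rewrite (_ : u = fun w => f w + -1 * f (x%:C%C * w)); last first.
    by apply/funext => w; rewrite /u mulN1r.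
  apply: cdiffD => //.
  have -> : 0 * m + -1 * (m * (0 * z + x%:C%C * 1)) =
    0 * f (x%:C%C * z) + -1 * (m * (0 * z + x%:C%C * 1)) by rewrite !mul0r.
  apply: cdiffM; first exact: cdiff_cst.
  apply: (@cdiff_comp _ (fun w => x%:C%C * w) f) => //.
  by apply: cdiffM; [exact: cdiff_cst | exact: cdiff_id].
have uB : bdd u (2 * B).
  move=> z z1; apply: le_trans (ler_modulusB _ _) _; rewrite mulr_natl mulr2n.
  by apply: lerD; apply: fB => //; exact: nx1.
have fa := taylor_expands hf fB.
have B0 : 0 <= B := bound_ge0 fB.
have ua : expands u (fun n => taylor f n * (1 - x%:C%C ^+ n)) (2 * B).
  split=> [n|z N z1].
    rewrite Normc.normcM mulrC; apply: ler_pM; rewrite ?modulus_ge0//; last exact: fa.1.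
    apply: le_trans (ler_modulusB _ _) _; rewrite Normc.normc1 modulusX modulus_real ger0_norm//.
    by have := exprn_ile1 n x0 x1; lra.
  rewrite (_ : _ - _ = (f z - \sum_(i < N) taylor f i * z ^+ i)
     - (f (x%:C%C * z) - \sum_(i < N) taylor f i * (x%:C%C * z) ^+ i)); last first.
    rewrite /u; move: (taylor f) => a.
    have -> : \sum_(i < N) a i * (1 - x%:C%C ^+ i) * z ^+ i =
      \sum_(i < N) a i * z ^+ i - \sum_(i < N) a i * (x%:C%C * z) ^+ i.
      by rewrite -sumrB; apply: eq_bigr => i _; rewrite exprMn; ring.
    by ring.
  apply: le_trans (ler_modulusB _ _) _; rewrite -mulrA [leRHS]mulr_natl mulr2n.
  apply: lerD; first exact: fa.2.
  apply: le_trans (fa.2 _ N (nx1 z z1)) _; rewrite ler_wpM2l// nx.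
  have zz : x * normc z <= normc z by rewrite ler_piMl ?modulus_ge0.
  apply: ler_pM.
  - by rewrite exprn_ge0// mulr_ge0 ?modulus_ge0.
  - by rewrite invr_ge0 subr_ge0 ltW// (le_lt_trans zz).
  - apply: lerXn2r zz; rewrite nnegrE; last exact: modulus_ge0.
    by rewrite mulr_ge0// modulus_ge0.
  - by rewrite lef_pV2 ?posrE ?subr_gt0//; [rewrite lerB | exact: le_lt_trans z1].
rewrite (@eq_ravg _ _ _ (fun t => normc (u (circ s t)) ^+ 2)); last first.
  by move=> t; rewrite /u /circ mulrA -rmorphM/= xs.
apply: (E2_le_psum b hu ua uB s01) => N.
apply: le_trans (psum_dilation_diff _ _ x01 (ltW s0)) _; rewrite xs.
rewrite lerBrDr -lerBrDl; apply: (E2_le_psum b hf fa fB r01) => M.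
rewrite opprB addrA lerBrDr.
have PN := psum_le_E2 b N hf fa fB s01.
have [MN|/ltnW NM] := leqP M N.
  by rewrite addrC; apply: lerD => //; apply: le_psum.
have PM := psum_le_E2 b M hf fa fB s01.
(* Each term of index from N to M weighs at least as much at radius s as at radius r, which lets M
   run past N. *)
suff : psum (taylor f) r M - psum (taylor f) r N <= psum (taylor f) s M - psum (taylor f) s N by lra.
rewrite /psum -(subnKC NM) !big_split_ord/= !(addrC (\sum_(i < N) _)) !addrK.
apply: ler_sum => i _; rewrite ler_wpM2l ?sqr_ge0//.
by rewrite lerXn2r ?nnegrE// (le_trans r0).
Qed.

End Parseval.

(** * Inner functions, through mean squares *)

Section CompositionOperators.
Context {R : realType}.
Local Notation C := R[i].
Implicit Types (r s t : R) (z w u : C) (N n m : nat) (f g k G H : C -> C) (c : nat -> C).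

(* For a bounded [f] vanishing at 0, the last clause says that the boundary
   values are unimodular almost everywhere, without mentioning them. *)
Definition inner0 f := [/\ holo f, bdd f 1, f 0 = 0 &
  forall e, 0 < e -> exists2 r, 0 < r < 1 & 1 - e <= E2 0 r f].

Lemma continuousX (v : R -> R) t m : {for t, continuous v} ->
  {for t, continuous (fun s => v s ^+ m)}.
Proof.
move=> cv; elim: m => [|m IH]; first exact: cvg_cst.
rewrite (_ : (fun s => _) = fun s => v s * v s ^+ m); first exact: cvgM cv IH.
by apply/funext => s; rewrite exprS.
Qed.

Lemma bddM f g A B : bdd f A -> bdd g B -> bdd (fun z => f z * g z) (A * B).
Proof.
by move=> fA gB z z1; rewrite Normc.normcM; apply: ler_pM;
  rewrite ?modulus_ge0//; [exact: fA | exact: gB].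
Qed.

Lemma bddX f n : bdd f 1 -> bdd (fun z => f z ^+ n) 1.
Proof.
by move=> f1 z z1; rewrite modulusX exprn_ile1 ?modulus_ge0//; exact: f1.
Qed.

Lemma bdd_sum (I : Type) (l : seq I) (F : I -> C -> C) (B : I -> R) :
  (forall i, bdd (F i) (B i)) -> bdd (fun z => \sum_(i <- l) F i z) (\sum_(i <- l) B i).
Proof.
by move=> FB z z1; apply: le_trans (sum_modulus_le _ _ _) _; apply: ler_sum => i _; exact: FB.
Qed.

(** The coefficient formula on a small circle of radius r gives |a_i| <= K r^(n-i) <= K r, which
    fails for small r if a_i is nonzero. *)
Lemma taylor_vanish g (B K : R) n i : holo g -> bdd g B -> (i < n)%N ->
  (forall z, normc z < 1 / 2 -> normc (g z) <= K * normc z ^+ n) -> taylor g i = 0.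
Proof.
move=> hg gB ni gK; apply/eqP; rewrite -modulus_eq0 eq_le modulus_ge0 andbT leNgt.
apply/negP => a0; set a := normc _ in a0.
have K0 : 0 <= K.
  have := gK (4^-1)%:C%C; rewrite modulus_real ger0_norm ?invr_ge0// => /(_ _).
  move=> /(_ ltac:(lra)) H; have := le_trans (modulus_ge0 _) H.
  by rewrite pmulr_lge0// exprn_gt0// invr_gt0.
pose r := Num.min (1 / 4) (a / (2 * (K + 1))).
have K1 : 0 < 2 * (K + 1) by lra.
have r0 : 0 < r by rewrite lt_min !divr_gt0.
have r4 : r <= 1 / 4 by rewrite ge_min lexx.
have rK : r * (2 * (K + 1)) <= a by rewrite -ler_pdivlMr// ge_min lexx orbT.
have r01 : 0 < r < 1 by rewrite r0; lra.
have : a <= K * r.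
  rewrite /a /taylor (tcoefE hg 0 i r01); apply: modulus_avg_le.
    exact: pcontT_tcoef.
  move=> t; have nr : normc (circ r t) = r by rewrite modulus_circ// ltW.
  rewrite Normc.normcM modulusX Normc.normcV nr exprVn ler_pdivrMr ?exprn_gt0//.
  apply: le_trans (gK _ _) _; first by rewrite nr; lra.
  rewrite nr -mulrA ler_wpM2l// -exprS -(subnKC ni) exprD.
  by rewrite ler_piMr ?exprn_ge0 ?(ltW r0)// exprn_ile1 ?(ltW r0)//; lra.
have : K * r <= r * (K + 1) by rewrite mulrC ler_wpM2l ?(ltW r0)//; lra.
lra.
Qed.

(** f^n is O(z^n) at 0, so its Taylor coefficients below n vanish and |f z|^n <= |z|^n / (1 - |z|);
    letting n grow excludes |f z| > |z|. *)
Lemma schwarz f : holo f -> bdd f 1 -> f 0 = 0 ->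
  forall z, normc z < 1 -> normc (f z) <= normc z.
Proof.
move=> hf f1 f0 z z1; rewrite leNgt; apply/negP => zf.
have z0 := modulus_ge0 z; have z10 : 0 < 1 - normc z by rewrite subr_gt0.
have fp : 0 < normc (f z) by apply: le_lt_trans zf.
have small w : normc w < 1 / 2 -> normc (f w) <= 2 * normc w.
  move=> w2; have w1 : normc w < 1 by lra.
  have := taylor_expansion 1 hf f1 w1.
  rewrite big_ord1 (taylor0 hf f1) f0 mul0r subr0 mul1r expr1 => /le_trans; apply.
  by rewrite mulrC ler_wpM2r ?modulus_ge0// -[leRHS]invrK lef_pV2 ?posrE ?invr_gt0//; lra.
have key n : normc (f z) ^+ n <= (1 - normc z)^-1 * normc z ^+ n.
  have := taylor_expansion n (holoX n hf) (bddX n f1) z1.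
  rewrite big1 ?subr0; first by rewrite modulusX mul1r mulrC.
  move=> i _; rewrite (@taylor_vanish _ 1 (2 ^+ n) n)//; first by rewrite mul0r.
  - exact: holoX.
  - exact: bddX.
  - by move=> w w2; rewrite modulusX -exprMn lerXn2r ?nnegrE ?mulr_ge0 ?modulus_ge0//; exact: small.
have q01 : 0 <= normc z / normc (f z) < 1.
  by rewrite divr_ge0 ?modulus_ge0//= ltr_pdivrMr// mul1r.
have [n Hn] := cvg_geometric_bound (1 - normc z)^-1 q01 ltr01.
have := Hn n (leqnn n); rewrite expr_div_n mulrA ger0_norm; last first.
  by rewrite !mulr_ge0 ?invr_ge0 ?exprn_ge0 ?modulus_ge0// ltW.
rewrite ltr_pdivrMr ?exprn_gt0// mul1r => /(le_lt_trans (key n)).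
by rewrite ltxx.
Qed.

Lemma schwarz_lt f : holo f -> bdd f 1 -> f 0 = 0 ->
  forall z, normc z < 1 -> normc (f z) < 1.
Proof. by move=> hf f1 f0 z z1; apply: le_lt_trans (schwarz hf f1 f0 z1) z1. Qed.

Lemma inner0_E2 f e : inner0 f -> 0 < e ->
  exists2 r0, 0 < r0 < 1 & forall r, r0 <= r -> r < 1 -> 1 - e <= E2 0 r f.
Proof.
move=> [hf f1 _ H] /H[r0 r01 E]; exists r0 => // r r0r r1.
by apply: le_trans E _; apply: le_E2 hf f1 _ r0r r1; case/andP: r01 => /ltW.
Qed.

Lemma E2_le1 f r : holo f -> bdd f 1 -> 0 <= r < 1 -> E2 0 r f <= 1.
Proof. by move=> hf f1 r01; have := E2_le_sqr 0 hf f1 r01; rewrite expr1n. Qed.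

Lemma bernoulli_le (x : R) m : 0 <= x <= 1 -> 1 - x ^+ m <= m%:R * (1 - x).
Proof.
move=> /andP[x0 x1]; elim: m => [|m IH]; first by rewrite expr0 subrr mul0r.
rewrite exprS -natr1; have : x ^+ m <= 1 by rewrite exprn_ile1.
have : 0 <= x ^+ m by rewrite exprn_ge0.
by move: IH; set y := x ^+ m => *; nra.
Qed.

Lemma ravg_powers G r m : holo G -> bdd G 1 -> 0 <= r < 1 ->
  ravg 0 (fun t => 1 - (normc (G (circ r t)) ^+ 2) ^+ m) <= m%:R * (1 - E2 0 r G).
Proof.
move=> hG G1 r01; have /andP[r0 r1] := r01.
have cG := E2_continuous hG r01.
have -> : 1 - E2 0 r G = ravg 0 (fun t => 1 - normc (G (circ r t)) ^+ 2).
  by rewrite ravgB ?ravg_cst// => t; exact: cvg_cst.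
have c1 : continuous (fun t => 1 - normc (G (circ r t)) ^+ 2).
  by move=> t; apply: cvgB; [exact: cvg_cst | exact: cG].
rewrite -ravgZ//; apply: le_ravg.
- move=> t; apply: cvgB; first exact: cvg_cst.
  exact: continuousX (cG t).
- by move=> t; apply: cvgM; [exact: cvg_cst | exact: c1].
- move=> t; apply: bernoulli_le; rewrite sqr_ge0/=.
  by rewrite exprn_ile1 ?modulus_ge0//; apply: G1; rewrite modulus_circ.
Qed.

Section Gram.
Variables (G : C -> C) (r : R).
Hypotheses (hG : holo G) (G1 : bdd G 1) (G0 : G 0 = 0) (r01 : 0 < r < 1).

Let g t := G (circ r t).

Let r01' : 0 <= r < 1. Proof. by case/andP: r01 => /ltW ->. Qed.

Let cg n : pcontT (fun t => g t ^+ n).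
Proof. by move=> t; apply: pcontX; exact: holo_circ. Qed.

Let g1 t : normc (g t) <= 1.
Proof. by apply: G1; case/andP: r01' => *; rewrite modulus_circ. Qed.

(* On the boundary [|G| = 1], so the weight [|G|^(2m)] may be dropped. *)
Lemma avg_drop_weight (h : R -> C) (m : nat) : pcontT h -> (forall t, normc (h t) <= 1) ->
  normc (avg 0 (fun t => h t * ((normc (g t) ^+ 2) ^+ m)%:C%C) - avg 0 h)
    <= m%:R * (1 - E2 0 r G).
Proof.
move=> ch h1.
have cw : continuous (fun t => (normc (g t) ^+ 2) ^+ m).
  by move=> t; exact: (@continuousX _ t m (E2_continuous hG r01' (x := t))).
have cm : pcontT (fun t => ((normc (g t) ^+ 2) ^+ m)%:C%C).
  by move=> t; apply: pcont_real; exact: cw.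
have chm : pcontT (fun t => h t * ((normc (g t) ^+ 2) ^+ m)%:C%C).
  by move=> t; apply: pcontM.
rewrite -avgB//; apply: le_trans (modulus_avg _ _) _.
  by move=> t; apply: pcontB.
apply: le_trans (ravg_powers m hG G1 r01'); apply: le_ravg.
- by apply: pcontT_modulus => t; apply: pcontB.
- move=> t; apply: cvgB; first exact: cvg_cst.
  exact: cw.
- move=> t; have x01 : 0 <= (normc (g t) ^+ 2) ^+ m <= 1.
    by rewrite exprn_ge0 ?sqr_ge0//= -exprM exprn_ile1 ?modulus_ge0.
  have -> : h t * ((normc (g t) ^+ 2) ^+ m)%:C%C - h t =
      - (h t * (1 - (normc (g t) ^+ 2) ^+ m)%:C%C).
    by rewrite rmorphB rmorph1; ring.
  have /andP[x0 x1] := x01.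
  rewrite normcN Normc.normcM modulus_real ger0_norm ?subr_ge0//.
  by rewrite ler_piMl ?subr_ge0.
Qed.

(** For n >= m the product is G^(n-m) times the weight |G|^(2m). Without the weight, G^(n-m)
    averages to its value at 0, which is 1 or 0 because G 0 = 0. The other case follows by
    conjugation. *)
Lemma gram_powers n m :
  normc (avg 0 (fun t => g t ^+ n * conjc (g t ^+ m)) - (n == m)%:R)
    <= (n + m)%:R * (1 - E2 0 r G).
Proof.
have E0 : 0 <= 1 - E2 0 r G by rewrite subr_ge0 E2_le1.
have base p q : normc (avg 0 (fun t => g t ^+ (q + p) * conjc (g t ^+ p)) - (q == 0%N)%:R)
    <= p%:R * (1 - E2 0 r G).
  have -> : (q == 0%N)%:R = avg 0 (fun t => g t ^+ q).
    by rewrite (@avg_holo _ 0 (fun z => G z ^+ q))// ?G0 ?expr0n//; exact: holoX.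
  rewrite (@eq_avg _ _ _ (fun t => g t ^+ q * ((normc (g t) ^+ 2) ^+ p)%:C%C)).
    apply: avg_drop_weight => // t; by rewrite modulusX exprn_ile1 ?modulus_ge0.
  by move=> t; rewrite exprD -mulrA mulC_conj modulusX -!exprM mulnC.
have [le|/ltnW le] := leqP m n.
  rewrite -{1}(subnK le) eqn_leq le andbT -subn_eq0.
  apply: le_trans (base _ _) _; by rewrite ler_wpM2r// ler_nat leq_addl.
rewrite -modulus_conj cconjB -avg_conj; last first.
  by move=> t; apply: pcontM; [exact: cg | apply: pcont_conj; exact: cg].
rewrite (@eq_avg _ _ _ (fun t => g t ^+ m * conjc (g t ^+ n))); last first.
  by move=> t; rewrite cconjM conjcK mulrC.
rewrite conjc_nat -{1}(subnK le) eqn_leq le/= -subn_eq0.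
by apply: le_trans (base _ _) _; rewrite ler_wpM2r// ler_nat leq_addr.
Qed.

(** Once the weight is dropped, z G^q vanishes at 0, while z conj(G^q) averages to r^2 times the
    conjugate of the first Taylor coefficient of G^q: G'(0) for q = 1, and 0 for q >= 2. This is the
    entry through which the multiplier damps the test products. *)
Lemma gram_shift l n m : cdiff G 0 l ->
  normc (avg 0 (fun t => circ r t * (g t ^+ n * conjc (g t ^+ m)))
         - (if m == n.+1 then (r ^+ 2)%:C%C * conjc l else 0))
    <= (n + m)%:R * (1 - E2 0 r G).
Proof.
move=> Gl; have /andP[r0 r1] := r01.
have E0 : 0 <= 1 - E2 0 r G by rewrite subr_ge0 E2_le1.
have nc t : normc (circ r t) = r by rewrite modulus_circ ?ltW.
have ng q t : normc (g t ^+ q) <= 1 by rewrite modulusX exprn_ile1 ?modulus_ge0.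
have [le|lt] := leqP m n.
  have -> : (m == n.+1) = false by apply/negbTE; rewrite neq_ltn ltnS le.
  rewrite -{1}(subnK le); set q := (n - m)%N.
  have E : avg 0 (fun t => circ r t * g t ^+ q) = 0.
    rewrite (@avg_holo _ 0 (fun z => z * G z ^+ q))// ?mul0r//.
    by apply: holoM; [exact: holo_id | exact: holoX].
  rewrite -{1}E (@eq_avg _ _ _ (fun t => circ r t * g t ^+ q * ((normc (g t) ^+ 2) ^+ m)%:C%C)).
    apply: le_trans (avg_drop_weight _ _ _) _.
    - by move=> t; apply: pcontM; [exact: pcont_circ | exact: cg].
    - by move=> t; rewrite Normc.normcM nc; have := ng q t; have := modulus_ge0 (g t ^+ q); nra.
    - by rewrite ler_wpM2r// ler_nat leq_addl.
  by move=> t; rewrite exprD -!mulrA mulC_conj modulusX -!exprM mulnC.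
have le := ltnW lt; rewrite -{1}(subnK le); set q := (m - n)%N.
have q0 : (0 < q)%N by rewrite subn_gt0.
have -> : (m == n.+1) = (q == 1%N).
  by rewrite -(eqn_add2r n q 1) /q subnK// add1n.
have E : avg 0 (fun t => circ r t * conjc (g t ^+ q)) =
    if q == 1%N then (r ^+ 2)%:C%C * conjc l else 0.
  have c1 : pcontT (fun t => G (circ r t) ^+ q * (circ r t)^-1 ^+ 1).
    by move=> t; apply: pcontM; [exact: cg | apply: pcontX; exact: pcontT_circV].
  rewrite (@eq_avg _ _ _ (fun t => (r ^+ 2)%:C%C * conjc (g t ^+ q * (circ r t)^-1 ^+ 1))); last first.
    move=> t; rewrite cconjM expr1 circV// cconjM conjcK conjc_real mulrCA -/(g t).
    rewrite [X in _ = conjc _ * X]mulrA -rmorphM/= divff ?mul1r; first by rewrite mulrC.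
    by rewrite gt_eqF// exprn_gt0.
  rewrite avgZ; last by move=> t; apply: pcont_conj.
  rewrite avg_conj// -(tcoefE (holoX q hG) 0 1 r01) -/(taylor _ 1).
  case: eqP => [q1|q1].
    rewrite (taylor1 (holoX q hG) (bddX q G1) (l := l))// q1.
    by under [X in cdiff X]eq_fun do rewrite expr1.
  have [k qk] : exists k : nat, q = k.+2 by move: q0 q1; case: (q) => [|[|k]]// *; exists k.
  have [m' Gm] := cdiffX k.+1 Gl.
  rewrite (taylor1 (holoX q hG) (bddX q G1) (l := 0)) ?conjc0 ?mulr0//.
  have := cdiffM Gl Gm; rewrite G0 expr0n mulr0 mul0r addr0 qk.
  by under [X in cdiff X]eq_fun do rewrite -exprS.
rewrite -E (@eq_avg _ _ _ (fun t => circ r t * conjc (g t ^+ q) * ((normc (g t) ^+ 2) ^+ n)%:C%C)).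
  apply: le_trans (avg_drop_weight _ _ _) _.
  - by move=> t; apply: pcontM; [exact: pcont_circ | apply: pcont_conj; exact: cg].
  - by move=> t; rewrite Normc.normcM nc modulus_conj; have := ng q t; have := modulus_ge0 (g t ^+ q); nra.
  - by rewrite ler_wpM2r// ler_nat leq_addr.
move=> t; have -> : ((normc (g t) ^+ 2) ^+ n)%:C%C = g t ^+ n * conjc (g t ^+ n).
  by rewrite mulC_conj modulusX -!exprM mulnC.
by rewrite exprD cconjM; ring.
Qed.

End Gram.

End CompositionOperators.

(** * Composition and damping *)

Section Contraction.
Context {R : realType}.
Local Notation C := R[i].
Implicit Types (r s t : R) (z w u : C) (N n m : nat) (f g k G H : C -> C) (c : nat -> C).

Definition lincomb c N G z : C := \sum_(i < N) c i * G z ^+ i.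

Lemma holo_lincomb c N G : holo G -> holo (lincomb c N G).
Proof.
by move=> hG; apply: holo_sum => i; apply: holoM; [exact: holo_cst | exact: holoX].
Qed.

Lemma bdd_lincomb c N G : bdd G 1 -> exists B, bdd (lincomb c N G) B.
Proof.
move=> G1; exists (\sum_(i < N) normc (c i) * 1).
by apply: bdd_sum => i; apply: bddM; [move=> z _ | exact: bddX].
Qed.

(* E2 is nondecreasing in the radius, so a defect vanishing at the boundary is
   harmless at every radius. *)
Lemma E2_le_inner0 H B K D G r : holo H -> bdd H B -> inner0 G -> 0 <= r < 1 ->
  (forall s, 0 < s < 1 -> E2 0 s H <= K + D * (1 - E2 0 s G)) -> E2 0 r H <= K.
Proof.
move=> hH HB iG /andP[r0 r1] HK; apply/ler_addgt0Pr => e e0.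
have D1 : 0 < `|D| + 1 by rewrite ltr_wpDl.
have [s0 /andP[s00 s01] Hs] := inner0_E2 iG (divr_gt0 e0 D1).
pose s := Num.max r s0.
have s1 : s < 1 by rewrite gt_max r1.
have rs : r <= s by rewrite le_max lexx.
have ss : s0 <= s by rewrite le_max lexx orbT.
have s0' : 0 < s by apply: lt_le_trans ss.
apply: le_trans (le_E2 0 hH HB r0 rs s1) _.
apply: le_trans (HK s _) _; first by rewrite s0'.
have [hG G1 _ _] := iG.
have E1 : E2 0 s G <= 1 by apply: E2_le1; rewrite // (ltW s0').
have := Hs s ss s1; set x := e / _ => Ex; rewrite lerD2l.
apply: le_trans (ler_wpM2r _ (ler_norm D)) _; first by rewrite subr_ge0.
apply: (@le_trans _ _ ((`|D| + 1) * x)); last by rewrite mulrC /x divfK// gt_eqF.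
by apply: ler_pM; rewrite ?subr_ge0//; lra.
Qed.

Section PolynomialGram.
Variables (G : C -> C) (c : nat -> C) (N : nat).
Hypothesis iG : inner0 G.

Definition gram_const : R :=
  \sum_(i < N) \sum_(j < N) normc (c i) * normc (c j) * (i + j)%:R.

Let p := lincomb c N G.

(** Shared by the two weights h in use: 1 for the mean square, z for the first moment. *)
Lemma gram_expansion (h : R -> C) r (L : nat -> nat -> C) : 0 < r < 1 -> pcontT h ->
  (forall i j, normc (avg 0 (fun t => h t * (G (circ r t) ^+ i * conjc (G (circ r t) ^+ j)))
      - L i j) <= (i + j)%:R * (1 - E2 0 r G)) ->
  normc (avg 0 (fun t => h t * (normc (p (circ r t)) ^+ 2)%:C%C)
     - \sum_(i < N) \sum_(j < N) c i * conjc (c j) * L i j)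
   <= gram_const * (1 - E2 0 r G).
Proof.
move=> /andP[r0 r1] ch HL; have [hG G1 G0 _] := iG.
have cg n : pcontT (fun t => G (circ r t) ^+ n).
  by move=> t; apply: pcontX; apply: holo_circ; rewrite // (ltW r0).
pose F i j t := h t * (G (circ r t) ^+ i * conjc (G (circ r t) ^+ j)).
have cF i j : pcontT (F i j).
  by move=> t; apply: pcontM => //; apply: pcontM; [exact: cg | apply: pcont_conj; exact: cg].
have cF' i j : pcontT (fun t => c i * conjc (c j) * F i j t).
  by move=> t; apply: pcontM; [exact: pcont_cst | exact: cF].
have -> : avg 0 (fun t => h t * (normc (p (circ r t)) ^+ 2)%:C%C) =
    \sum_(i < N) \sum_(j < N) c i * conjc (c j) * avg 0 (F i j).
  rewrite (@eq_avg _ _ _ (fun t => \sum_(i < N) \sum_(j < N) c i * conjc (c j) * F i j t)).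
    rewrite avg_sum; last by move=> i t; apply: pcont_sum => j _; exact: cF'.
    by apply: eq_bigr => i _; rewrite avg_sum//; apply: eq_bigr => j _; rewrite avgZ.
  move=> t; rewrite -mulC_conj /p /lincomb (rmorph_sum (@conjc R)) big_distrlr/= mulr_sumr.
  apply: eq_bigr => i _; rewrite mulr_sumr; apply: eq_bigr => j _.
  by rewrite cconjM /F; ring.
rewrite -sumrB; apply: le_trans (sum_modulus_le _ _ _) _.
rewrite /gram_const mulr_suml; apply: ler_sum => i _.
rewrite -sumrB; apply: le_trans (sum_modulus_le _ _ _) _.
rewrite mulr_suml; apply: ler_sum => j _.
rewrite -mulrBr !Normc.normcM modulus_conj -!mulrA.
do 2 (apply: ler_wpM2l; first exact: modulus_ge0).
exact: HL.
Qed.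

Lemma sum_delta (a : nat -> R) (j : nat) : (forall i, 0 <= a i) ->
  \sum_(i < N) (if i == j :> nat then a i else 0) <= a j.
Proof.
move=> a0; have [jN|Nj] := ltnP j N.
  rewrite (bigD1 (Ordinal jN))//= eqxx big1 ?addr0//.
  by move=> i ij; case: eqP => // Eij; case/eqP: ij; exact: val_inj.
rewrite big1// => i _; case: eqP => // ij.
by have := ltn_ord i; rewrite ij ltnNge Nj.
Qed.

Lemma E2_lincomb r : 0 < r < 1 ->
  `|E2 0 r p - psum c 1 N| <= gram_const * (1 - E2 0 r G).
Proof.
move=> r01; have [hG G1 G0 _] := iG.
have H i j : normc (avg 0 (fun t => 1 * (G (circ r t) ^+ i * conjc (G (circ r t) ^+ j)))
      - (i == j)%:R) <= (i + j)%:R * (1 - E2 0 r G).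
  by under eq_avg do rewrite mul1r; exact: gram_powers.
have := gram_expansion r01 (fun t => @pcont_cst R 1 t) H.
under eq_avg do rewrite mul1r.
rewrite avg_real -/(E2 0 r p).
have -> : \sum_(i < N) \sum_(j < N) c i * conjc (c j) * (i == j :> nat)%:R =
    (psum c 1 N)%:C%C.
  rewrite /psum rmorph_sum/=; apply: eq_bigr => i _.
  rewrite (bigD1 i)//= eqxx mulr1 mulC_conj expr1n mulr1 big1 ?addr0//.
  by move=> j ji; rewrite eq_sym (inj_eq val_inj) (negbTE ji) mulr0.
have -> : (E2 0 r p)%:C%C - (psum c 1 N)%:C%C = (E2 0 r p - psum c 1 N)%:C%C :> C.
  by rewrite rmorphB.
by rewrite modulus_real.
Qed.

Lemma psum1E : psum c 1 N = \sum_(i < N) normc (c i) ^+ 2.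
Proof. by apply: eq_bigr => i _; rewrite expr1n mulr1. Qed.

(** x_i x_(i+1) <= (x_i^2 + x_(i+1)^2) / 2, and each index occurs at most once as a left and once as
    a right neighbour. The constant 1 makes the first moment at most |G'(0)| times the mean
    square. *)
Lemma shifted_sum (x : nat -> R) : (forall i, 0 <= x i) ->
  \sum_(i < N) \sum_(j < N) (if j == i.+1 :> nat then x i * x j else 0)
    <= \sum_(i < N) x i ^+ 2.
Proof.
move=> x0; pose y (i j : 'I_N) := if j == i.+1 :> nat then x i ^+ 2 / 2 else 0.
pose y' (i j : 'I_N) := if j == i.+1 :> nat then x j ^+ 2 / 2 else 0.
apply: (@le_trans _ _ (\sum_(i < N) \sum_(j < N) y i j + \sum_(i < N) \sum_(j < N) y' i j)).
  rewrite -big_split/=; apply: ler_sum => i _; rewrite -big_split/=; apply: ler_sum => j _.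
  rewrite /y /y'; case: ifP => _; last by rewrite addr0.
  by have := sqr_ge0 (x i - x j); rewrite sqrrB; lra.
have s0 i : 0 <= x i ^+ 2 / 2 by rewrite divr_ge0// sqr_ge0.
have A : \sum_(i < N) \sum_(j < N) y i j <= \sum_(i < N) x i ^+ 2 / 2.
  apply: ler_sum => i _.
  exact: (@sum_delta (fun=> x i ^+ 2 / 2) i.+1 (fun=> s0 i)).
have B : \sum_(i < N) \sum_(j < N) y' i j <= \sum_(i < N) x i ^+ 2 / 2.
  rewrite exchange_big/=; apply: ler_sum => j _.
  rewrite /y'; case: (nat_of_ord j) (s0 j) => [|j'] sj; first by rewrite big1.
  under eq_bigr do rewrite eqSS eq_sym.
  exact: (@sum_delta (fun=> x j'.+1 ^+ 2 / 2) j' (fun=> sj)).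
apply: le_trans (lerD A B) _; rewrite -big_split/=; apply: ler_sum => i _; lra.
Qed.

Lemma avg_shift_lincomb r l : 0 < r < 1 -> cdiff G 0 l ->
  normc (avg 0 (fun t => circ r t * (normc (p (circ r t)) ^+ 2)%:C%C))
    <= normc l * psum c 1 N + gram_const * (1 - E2 0 r G).
Proof.
move=> r01 Gl; have [hG G1 G0 _] := iG; have /andP[r0 r1] := r01.
pose L i j : C := if j == i.+1 then (r ^+ 2)%:C%C * conjc l else 0.
have := gram_expansion (L := L) r01 (@pcont_circ R r) (fun i j => gram_shift hG G1 G0 r01 i j Gl).
set X := avg _ _; set Y := \sum_(i < N) _ => XY.
rewrite -(subrK Y X); apply: le_trans (le_normcD _ _) _; rewrite addrC; apply: lerD XY.
apply: le_trans (sum_modulus_le _ _ _) _.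
apply: (@le_trans _ _ (normc l * \sum_(i < N) \sum_(j < N)
    (if j == i.+1 :> nat then normc (c i) * normc (c j) else 0))).
  rewrite mulr_sumr; apply: ler_sum => i _; apply: le_trans (sum_modulus_le _ _ _) _.
  rewrite mulr_sumr; apply: ler_sum => j _; rewrite /L.
  case: ifP => _; last by rewrite !mulr0 Normc.normc0.
  rewrite !Normc.normcM !modulus_conj modulus_real ger0_norm ?sqr_ge0//.
  have r2 : r ^+ 2 <= 1 by rewrite exprn_ile1 ?ltW.
  rewrite [leLHS](_ : _ = r ^+ 2 * (normc l * (normc (c i) * normc (c j)))); last by ring.
  by rewrite ler_piMl// !mulr_ge0 ?modulus_ge0.
rewrite psum1E ler_wpM2l ?modulus_ge0//.
by apply: (@shifted_sum (fun i => normc (c i))) => i; exact: modulus_ge0.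
Qed.

End PolynomialGram.

Lemma pcontT_holo f r : holo f -> 0 < r < 1 -> pcontT (fun t => f (circ r t)).
Proof. by move=> hf /andP[r0 r1]; apply: holo_circ; rewrite // (ltW r0). Qed.

(* Polynomials in [G] are handled by the Gram matrix; the estimate passes to
   bounded functions since Taylor polynomials converge uniformly on smaller
   discs, which [G] maps into themselves. *)
Lemma contraction (M G : C -> C) (kap : R) : holo M -> bdd M 1 -> inner0 G -> 0 <= kap ->
  (forall c N r, 0 < r < 1 ->
     E2 0 r (fun z => M z * lincomb c N G z) <= kap * psum c 1 N) ->
  forall k B A, holo k -> bdd k B -> (forall r, 0 < r < 1 -> E2 0 r k <= A) ->
  forall r, 0 < r < 1 -> E2 0 r (fun z => M z * k (G z)) <= kap * A.
Proof.
move=> hM M1 iG kap0 Hp k B A hk kB kA r r01; have [hG G1 G0 _] := iG.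
have /andP[r0 r1] := r01.
have B0 : 0 <= B := bound_ge0 kB.
have ka := taylor_expands hk kB.
(* On the circle of radius r Schwarz's lemma gives |G| <= r, so the Taylor tail of k at G is at most
   [tau n]. *)
pose tau n := B / (1 - r) * r ^+ n.
have tau0 n : 0 <= tau n by rewrite mulr_ge0 ?exprn_ge0 ?(ltW r0)// divr_ge0// subr_ge0 ltW.
have hkG : holo (fun z => k (G z)).
  by apply: (holo_comp hG hk) => z z1; exact: (schwarz_lt hG G1 G0 z1).
have cx : pcontT (fun t => M (circ r t) * k (G (circ r t))).
  exact: (pcontT_holo (holoM hM hkG)).
have step n : E2 0 r (fun z => M z * k (G z)) <= kap * A + tau n * (2 * B + tau n).
  have hP := holoM hM (holo_lincomb (taylor k) n hG).
  have cy := pcontT_holo hP r01.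
  have le1 : E2 0 r (fun z => M z * lincomb (taylor k) n G z) <= kap * A.
    apply: le_trans (Hp _ _ _ r01) _; rewrite ler_wpM2l//.
    exact: psum1_le hk ka kB kA.
  apply: le_trans (lerD le1 (lexx _)); rewrite -[X in _ <= _ + X](ravg_cst 0) -ravgD.
  - apply: le_ravg.
    + exact: continuous_sqr_modulus.
    + by move=> t; apply: cvgD; [exact: (continuous_sqr_modulus cy) | exact: cvg_cst].
    + move=> t; have z1 : normc (circ r t) < 1 by rewrite modulus_circ ?ltW.
      have Gz := schwarz hG G1 G0 z1; rewrite modulus_circ ?(ltW r0)// in Gz.
      have Gz1 : normc (G (circ r t)) < 1 := le_lt_trans Gz r1.
      have xB : normc (M (circ r t) * k (G (circ r t))) <= B.
        rewrite Normc.normcM -[leRHS]mul1r.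
        by apply: ler_pM; rewrite ?modulus_ge0//; [exact: M1 | exact: kB].
      have xy : normc (M (circ r t) * k (G (circ r t)) -
          M (circ r t) * lincomb (taylor k) n G (circ r t)) <= tau n.
        rewrite -mulrBr Normc.normcM; apply: (@le_trans _ _ (1 * tau n)); last by rewrite mul1r.
        apply: ler_pM; rewrite ?modulus_ge0//; first exact: M1.
        apply: le_trans (ka.2 _ n Gz1) _; rewrite /tau -mulrA ler_wpM2l// mulrC.
        have G0' := modulus_ge0 (G (circ r t)).
        apply: ler_pM; rewrite ?exprn_ge0//; first by rewrite invr_ge0 subr_ge0 ltW.
          by rewrite lef_pV2 ?posrE ?subr_gt0// lerB.
        by apply: lerXn2r Gz; rewrite nnegrE// ltW.
      have := sqr_modulus_close (tau0 n) xB xy.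
      by move=> /(le_trans (ler_norm _)); rewrite lerBlDl.
  - exact: (continuous_sqr_modulus cy).
  - by move=> t; exact: cvg_cst.
apply/ler_addgt0Pr => e e0.
have D0 : 0 < 2 * B + 1 by rewrite ltr_wpDl// mulr_ge0.
have [n /(_ n (leqnn n)) Hn] := @cvg_geometric_bound R (B / (1 - r)) r (Num.min 1 (e / (2 * B + 1)))
   (introT andP (conj (ltW r0) r1)) (ltac:(by rewrite lt_min ltr01 divr_gt0)).
rewrite ger0_norm ?tau0// -/(tau n) lt_min in Hn; have /andP[n1 n2] := Hn.
apply: le_trans (step n) _; rewrite lerD2l.
apply: (@le_trans _ _ (e / (2 * B + 1) * (2 * B + 1))); last by rewrite divfK// gt_eqF.
apply: ler_pM; rewrite ?tau0 ?(ltW n2)//; last by rewrite lerD2l ltW.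
by have := tau0 n; lra.
Qed.

(** Littlewood's subordination principle in mean square; it controls the tail in [inner0_comp]. *)
Lemma E2_comp_le G k B A : inner0 G -> holo k -> bdd k B ->
  (forall r, 0 < r < 1 -> E2 0 r k <= A) ->
  forall r, 0 < r < 1 -> E2 0 r (fun z => k (G z)) <= A.
Proof.
move=> iG hk kB kA r r01; have [hG G1 G0 _] := iG.
have := @contraction (fun=> 1) G 1 (holo_cst 1) _ iG ler01 _ k B A hk kB kA r r01.
rewrite mul1r (_ : (fun z => 1 * k (G z)) = fun z => k (G z)); last first.
  by apply/funext => z; rewrite mul1r.
apply; first by move=> z _; rewrite Normc.normc1.
move=> c N s s01; have [B' pB] := bdd_lincomb c N G1.
rewrite (_ : (fun z => 1 * _) = lincomb c N G); last by apply/funext => z; rewrite mul1r.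
rewrite mul1r; apply: (E2_le_inner0 (D := gram_const c N) (holo_lincomb c N hG) pB iG).
  by case/andP: s01 => /ltW ->.
move=> s' s'01; have := E2_lincomb c N iG s'01; rewrite ler_norml => /andP[_].
by rewrite lerBlDl.
Qed.

Lemma Re_avg (h : R -> C) : Re (avg 0 h) = ravg 0 (fun t => Re (h t)).
Proof. by rewrite /avg cReM/= mul0r subr0. Qed.

(* [|1 + conj u z|^2 = 1 + |z|^2 + 2 Re (conj u z)] for [|u| = 1], and the first
   moment of [|k (G)|^2] is damped by [|G'(0)|]. *)
Lemma E2_test_factor G k B A u l : inner0 G -> cdiff G 0 l -> normc u = 1 ->
  holo k -> bdd k B -> (forall r, 0 < r < 1 -> E2 0 r k <= A) ->
  forall r, 0 < r < 1 ->
  E2 0 r (fun z => (1 + conjc u * z) / 2 * k (G z)) <= (1 + normc l) / 2 * A.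
Proof.
move=> iG Gl u1; have [hG G1 G0 _] := iG.
pose M z : C := (1 + conjc u * z) / 2.
have n2 : normc (2^-1 : C) = 2^-1.
  rewrite (_ : 2^-1 = (2^-1)%:C%C); last by rewrite fmorphV rmorph_nat.
  by rewrite modulus_real ger0_norm// invr_ge0.
have hM : holo M.
  apply: holoM; last exact: holo_cst; apply: holoD; first exact: holo_cst.
  by apply: holoM; [exact: holo_cst | exact: holo_id].
have M1 : bdd M 1.
  move=> z z1; rewrite /M Normc.normcM n2 ler_pdivrMr// mul1r.
  apply: le_trans (le_normcD _ _) _; rewrite Normc.normc1 Normc.normcM modulus_conj u1 mul1r.
  lra.
apply: (@contraction M G ((1 + normc l) / 2) hM M1 iG).
  by rewrite divr_ge0// addr_ge0// modulus_ge0.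
move=> c N r0 r01.
have hP := holoM hM (holo_lincomb c N hG).
have [B' pB] := bdd_lincomb c N G1.
apply: (E2_le_inner0 (D := gram_const c N) hP (bddM M1 pB) iG).
  by case/andP: r01 => /ltW ->.
move=> r rr1; have /andP[rr0 rr11] := rr1.
pose p := lincomb c N G.
have hp : holo p := holo_lincomb c N hG.
have cp := continuous_sqr_modulus (pcontT_holo hp rr1).
pose q t := circ r t * (normc (p (circ r t)) ^+ 2)%:C%C.
have cq : pcontT q.
  by move=> t; apply: pcontM; [exact: pcont_circ | apply: pcont_real; exact: cp].
have cuq : pcontT (fun t => conjc u * q t).
  by move=> t; apply: pcontM; [exact: pcont_cst | exact: cq].
have cRe : continuous (fun t => Re (conjc u * q t)) by move=> t; case: (cuq t).
apply: (@le_trans _ _ (ravg 0 (fun t => 2^-1 * normc (p (circ r t)) ^+ 2 + 2^-1 * Re (conjc u * q t)))).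
  apply: le_ravg.
  - exact: (continuous_sqr_modulus (pcontT_holo hP rr1)).
  - by move=> t; apply: cvgD; apply: cvgM; [exact: cvg_cst | exact: cp | exact: cvg_cst | exact: cRe].
  - move=> t; rewrite /q mulrA; set w := conjc u * circ r t.
    have -> : Re (w * (normc (p (circ r t)) ^+ 2)%:C%C) = Re w * normc (p (circ r t)) ^+ 2.
      by rewrite cReM/= mulr0 subr0.
    rewrite [X in _ <= _ + X]mulrA -mulrDl [X in X <= _](_ : _ = normc (M (circ r t)) ^+ 2 * normc (p (circ r t)) ^+ 2); last first.
      by rewrite Normc.normcM exprMn.
    rewrite ler_wpM2r ?sqr_ge0// /M Normc.normcM exprMn n2 sqr_modulus cReD cImD/= -/w add0r.
    have : normc w ^+ 2 <= 1.
      by rewrite Normc.normcM modulus_conj u1 mul1r modulus_circ ?(ltW rr0)// exprn_ile1 ?ltW.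
    rewrite sqr_modulus; move: (Re w) (Im w) => x y; lra.
rewrite ravgD; last 2 first.
  by move=> t; apply: cvgM; [exact: cvg_cst | exact: cp].
  by move=> t; apply: cvgM; [exact: cvg_cst | exact: cRe].
rewrite !ravgZ// -Re_avg avgZ//.
have A1 : ravg 0 (fun t => normc (p (circ r t)) ^+ 2) <= psum c 1 N + gram_const c N * (1 - E2 0 r G).
  have := E2_lincomb c N iG rr1; rewrite ler_norml => /andP[_].
  by rewrite lerBlDl.
have A2 : Re (conjc u * avg 0 q) <= normc l * psum c 1 N + gram_const c N * (1 - E2 0 r G).
  apply: le_trans (ler_norm _) _; apply: le_trans (Re_le_modulus _) _.
  rewrite Normc.normcM modulus_conj u1 mul1r; exact: avg_shift_lincomb.
lra.
Qed.

(** Split g into a Taylor polynomial P carrying all but e^2 of the mean square, and a tail t.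
    Composition with f nearly preserves the mean square of P, by the Gram matrix, and does not
    increase the bound e^2 for t. Pointwise |P(f)|^2 <= |g(f)|^2 + e + (1/e + 1) |t(f)|^2, so the
    mean square of g(f) stays near 1. *)
Lemma inner0_comp f g : inner0 f -> inner0 g -> inner0 (fun z => g (f z)).
Proof.
move=> iff ig; have [hf f1 f0 _] := iff; have [hg g1 g0 Hg] := ig.
have hgf : holo (fun z => g (f z)).
  by apply: (holo_comp hf hg) => z z1; exact: (schwarz_lt hf f1 f0 z1).
have gf1 : bdd (fun z => g (f z)) 1.
  by move=> z z1; apply: g1; exact: (schwarz_lt hf f1 f0 z1).
split=> //; first by rewrite f0 g0.
move=> e0 e00.
pose e := Num.min (e0 / 8) (1 / 2).
have e_gt0 : 0 < e by rewrite lt_min !divr_gt0.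
have e8 : 8 * e <= e0.
  have : e <= e0 / 8 by rewrite ge_min lexx.
  lra.
have e2 : e <= 1 / 2 by rewrite ge_min lexx orbT.
have ga := taylor_expands hg g1.
have [r1 r101 E1] := Hg (e ^+ 2 / 2) (ltac:(by rewrite divr_gt0// exprn_gt0)).
have r101' : 0 <= r1 < 1 by case/andP: r101 => /ltW ->.
have [N HN] : exists N, 1 - e ^+ 2 <= psum (taylor g) 1 N.
  apply: contrapT => /forallNP H.
  have : E2 0 r1 g <= 1 - e ^+ 2.
    apply: (E2_le_psum 0 hg ga g1 r101') => N.
    have /andP[r1_0 r1_1] := r101'.
    apply: le_trans (le_psum_radius (taylor g) N r1_0 (ltW r1_1)) _.
    by rewrite leNgt; apply/negP => /ltW; exact: H.
  have : 0 < e ^+ 2 by rewrite exprn_gt0.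
  lra.
pose t z := g z + -1 * lincomb (taylor g) N id z.
have ht : holo t.
  apply: holoD => //; apply: holoM; first exact: holo_cst.
  by apply: holo_lincomb; exact: holo_id.
have [B' pB'] : exists B, bdd (lincomb (taylor g) N id) B.
  by apply: bdd_lincomb => z /ltW.
have tB : bdd t (1 + B').
  move=> z z1; apply: le_trans (le_normcD _ _) _; apply: lerD; first exact: g1.
  by rewrite mulN1r normcN; exact: pB'.
have tE z : t z = g z - \sum_(i < N) taylor g i * z ^+ i by rewrite /t mulN1r.
(* The tail keeps the coefficients of g from N on; [maxn n N] below covers partial sums shorter than
   N, which vanish. *)
pose a' i := if (i < N)%N then 0 else taylor g i.
have sumS n (z : C) : \sum_(i < n) a' i * z ^+ i =
    \sum_(i < maxn n N) taylor g i * z ^+ i - \sum_(i < N) taylor g i * z ^+ i.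
  elim: n => [|n IH]; first by rewrite big_ord0 max0n subrr.
  rewrite big_ord_recr/= IH /a'; case: ifP => nN.
    rewrite mul0r addr0 (maxn_idPr (ltnW nN)) (maxn_idPr nN).
    by [].
  have Nn : (N <= n)%N by rewrite leqNgt nN.
  rewrite (maxn_idPl Nn) (maxn_idPl (leqW Nn)) big_ord_recr/=; ring.
have ta : expands t a' 1.
  split=> [n|z n z1]; first by rewrite /a'; case: ifP => _; [rewrite Normc.normc0 | exact: ga.1].
  rewrite tE sumS opprB addrA subrK.
  apply: le_trans (ga.2 z (maxn n N) z1) _; rewrite !mul1r.
  rewrite ler_wpM2r ?invr_ge0 ?subr_ge0 ?(ltW z1)//.
  by apply: ler_wiXn2l; rewrite ?modulus_ge0 ?(ltW z1)// leq_maxl.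
have psumS n : psum a' 1 n = psum (taylor g) 1 (maxn n N) - psum (taylor g) 1 N.
  elim: n => [|n IH]; first by rewrite max0n subrr /psum big_ord0.
  rewrite {1}/psum big_ord_recr/= -/(psum a' 1 n) IH /a'; case: ifP => nN.
    rewrite Normc.normc0 expr0n mul0r addr0 (maxn_idPr (ltnW nN)) (maxn_idPr nN).
    by [].
  have Nn : (N <= n)%N by rewrite leqNgt nN.
  have pS : psum (taylor g) 1 n.+1 = psum (taylor g) 1 n + normc (taylor g n) ^+ 2 * 1 ^+ (2 * n).
    by rewrite /psum big_ord_recr.
  by rewrite (maxn_idPl Nn) (maxn_idPl (leqW Nn)) pS addrAC.
have g_le1 n : psum (taylor g) 1 n <= 1.
  apply: (psum1_le _ hg ga g1) => r /andP[r0 rr1]; apply: E2_le1 => //.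
  by rewrite (ltW r0).
have tE2 r : 0 < r < 1 -> E2 0 r t <= e ^+ 2.
  move=> /andP[r0 rr1]; have r01 : 0 <= r < 1 by rewrite (ltW r0).
  apply: (E2_le_psum 0 ht ta tB r01) => n.
  apply: le_trans (le_psum_radius _ _ (ltW r0) (ltW rr1)) _.
  rewrite psumS; have := g_le1 (maxn n N); lra.
have tfE2 := E2_comp_le iff ht tB tE2.
have Df : 0 < `|gram_const (taylor g) N| + 1 by rewrite ltr_wpDl.
have [r0 r001 Hr] := inner0_E2 iff (divr_gt0 e_gt0 Df).
exists r0 => //; have /andP[r00 r0_1] := r001.
have {}Hr := Hr r0 (lexx _) r0_1.
have cgf := pcontT_holo hgf r001.
have htf : holo (fun z => t (f z)).
  by apply: (holo_comp hf ht) => z z1; exact: (schwarz_lt hf f1 f0 z1).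
have ctf := pcontT_holo htf r001.
have cg2 := continuous_sqr_modulus cgf.
have ct2 := continuous_sqr_modulus ctf.
have hpf := holo_lincomb (taylor g) N hf.
have cpf := continuous_sqr_modulus (pcontT_holo hpf r001).
have upper : E2 0 r0 (lincomb (taylor g) N f) <= E2 0 r0 (fun z => g (f z)) +
   (e + (e^-1 + 1) * E2 0 r0 (fun z => t (f z))).
  rewrite -[X in _ <= _ + (X + _)](ravg_cst 0) -ravgZ//.
  rewrite -ravgD; [|by move=> ?; exact: cvg_cst|by move=> x; apply: cvgM; [exact: cvg_cst | exact: ct2]].
  rewrite -ravgD//; last first.
    by move=> x; apply: cvgD; [exact: cvg_cst | apply: cvgM; [exact: cvg_cst | exact: ct2]].
  apply: le_ravg => //.
    move=> x; apply: cvgD; first exact: cg2.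
    by apply: cvgD; [exact: cvg_cst | apply: cvgM; [exact: cvg_cst | exact: ct2]].
  move=> x; have z1 : normc (circ r0 x) < 1 by rewrite modulus_circ ?ltW.
  have -> : lincomb (taylor g) N f (circ r0 x) = g (f (circ r0 x)) - t (f (circ r0 x)).
    by rewrite tE opprB addrC subrK.
  have := ler_modulusB (g (f (circ r0 x))) (t (f (circ r0 x))).
  have := gf1 _ z1.
  set X := normc (g (f _)); set T := normc (t _); set P := normc _ => X1 PXT.
  have X0 : 0 <= X by exact: modulus_ge0.
  have T0 : 0 <= T by exact: modulus_ge0.
  have P2 : P ^+ 2 <= (X + T) ^+ 2.
    by rewrite lerXn2r ?nnegrE ?modulus_ge0 ?addr_ge0.
  have T2 : 2 * T <= e + e^-1 * T ^+ 2.
    have eT : e * (e^-1 * T ^+ 2) = T ^+ 2 by rewrite mulrA mulfV ?gt_eqF// mul1r.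
    rewrite -(ler_pM2l e_gt0) mulrDr eT.
    by have := sqr_ge0 (T - e); rewrite sqrrB; lra.
  apply: le_trans P2 _; rewrite sqrrD mulrDl mul1r.
  have : X * T <= T by rewrite ler_piMl.
  lra.
have lower : 1 - e ^+ 2 - e <= E2 0 r0 (lincomb (taylor g) N f).
  have := E2_lincomb (taylor g) N iff r001; rewrite ler_norml => /andP[+ _].
  have E1f : E2 0 r0 f <= 1 by apply: E2_le1; rewrite // (ltW r00).
  have : gram_const (taylor g) N * (1 - E2 0 r0 f) <= e.
    apply: (@le_trans _ _ ((`|gram_const (taylor g) N| + 1) * (e / (`|gram_const (taylor g) N| + 1)))).
      apply: (@le_trans _ _ ((`|gram_const (taylor g) N| + 1) * (1 - E2 0 r0 f))).
        rewrite ler_wpM2r ?subr_ge0//; have := ler_norm (gram_const (taylor g) N); lra.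
      by rewrite ler_wpM2l ?(ltW Df)//; lra.
    by rewrite mulrC divfK// gt_eqF.
  lra.
have := tfE2 r0 r001; set T := E2 0 r0 (fun z => t (f z)) in upper * => Te.
have : (e^-1 + 1) * T <= e + e ^+ 2.
  apply: (@le_trans _ _ ((e^-1 + 1) * e ^+ 2)).
    by rewrite ler_wpM2l// addr_ge0// invr_ge0 ltW.
  by rewrite mulrDl mul1r expr2 mulrA mulVf ?gt_eqF// mul1r.
have : e ^+ 2 <= e * (1 / 2) by rewrite expr2 ler_wpM2l// ltW.
lra.
Qed.

Lemma inner0_id : inner0 (@id C).
Proof.
split=> //; first exact: holo_id.
  by move=> z /ltW.
move=> e e0; pose r := 1 - Num.min (e / 2) (1 / 2).
have m0 : 0 < Num.min (e / 2) (1 / 2) by rewrite lt_min !divr_gt0.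
have m1 : Num.min (e / 2) (1 / 2) <= 1 / 2 by rewrite ge_min lexx orbT.
have m2 : Num.min (e / 2) (1 / 2) <= e / 2 by rewrite ge_min lexx.
exists r; first by rewrite /r; apply/andP; split; lra.
have r0 : 0 <= r by rewrite /r; lra.
rewrite /E2; under eq_ravg do rewrite modulus_circ//.
rewrite ravg_cst /r; nra.
Qed.

End Contraction.

(** * Boundary values *)

Section Bridge.
Context {R : realType}.
Local Notation C := R[i].
Local Notation mu := (@lebesgue_measure R).
Implicit Types (r s t : R) (z w : C) (N n m : nat) (f g : C -> C).

Lemma normCE z : `|z| = (normc z)%:C%C.
Proof. by []. Qed.

Lemma derivable_cdiff f z : derivable (f : C^o -> C^o) z 1 ->
  cdiff f z ('D_1 (f : C^o -> C^o) z).
Proof.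
move=> fz e e0.
have [|d d0 H] := derivable_small fz (e := e%:C%C); first by rewrite ltcE/= eqxx.
move: d0; rewrite ltcE/= => /andP[/eqP di dr].
have dE : d = (Re d)%:C%C by apply: complex_ext; rewrite /=.
exists (Re d) => // h hd.
have := H h; rewrite !normCE dE ltcR => /(_ hd).
by rewrite -rmorphM/= lecR.
Qed.

Lemma nontangential_limitP g zeta w : nontangential_limit g zeta w <->
  forall M, 1 < M -> forall e, 0 < e -> exists2 d, 0 < d &
    forall z, normc (z - zeta) < d -> normc (z - zeta) < M * (1 - normc z) ->
    normc (g z - w) < e.
Proof.
split=> H M M1.
- move=> e e0; have e0' : 0 < (e%:C%C : C) by rewrite ltcE/= eqxx.
  have := (cvgrPdist_lt _ _).1 (H M M1) _ e0'.
  move=> /(_ (within_filter _ _)); rewrite near_withinE => /nbhs_normP[d /= d0 Hd].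
  move: d0; rewrite ltcE/= => /andP[/eqP di dr].
  have dE : d = (Re d)%:C%C by apply: complex_ext; rewrite /=.
  exists (Re d) => // z zd zM.
  have := Hd z; rewrite /ball_/= normCE dE ltcR (modulusBC zeta) => /(_ zd zM).
  by rewrite normCE ltcR modulusBC.
- apply/cvgrPdist_lt => e; rewrite ltcE/= => /andP[/eqP ei er].
  have eE : e = (Re e)%:C%C by apply: complex_ext; rewrite /=.
  have [d d0 Hd] := H M M1 _ er.
  rewrite near_withinE; apply/(@nbhs_normP _ C^o); exists d%:C%C => /=; first by rewrite ltcE/= eqxx.
  move=> z; rewrite /ball_/= normCE ltcR (modulusBC zeta) => zd zM.
  by rewrite normCE eE ltcR modulusBC; exact: Hd.
Qed.

Lemma nontangential_unique g t w w' : nontangential_limit g (cis t) w ->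
  nontangential_limit g (cis t) w' -> w = w'.
Proof.
move=> /nontangential_limitP H /nontangential_limitP H'.
apply/eqP; rewrite -subr_eq0 -modulus_eq0 eq_le modulus_ge0 andbT.
apply/ler_addgt0Pl => e e0; rewrite addr0.
have e2 : 0 < e / 2 by rewrite divr_gt0.
have M1 : (1 : R) < 2 by lra.
have [d d0 Hd] := H 2 M1 _ e2; have [d' d'0 Hd'] := H' 2 M1 _ e2.
pose m := Num.min (Num.min d d') 1 / 2.
have m0 : 0 < Num.min (Num.min d d') 1 by rewrite !lt_min d0 d'0 ltr01.
have [md md' m1] : [/\ Num.min (Num.min d d') 1 <= d, Num.min (Num.min d d') 1 <= d'
  & Num.min (Num.min d d') 1 <= 1] by rewrite !ge_min !lexx !orbT.
(* On the radius |z - e^(it)| = 1 - |z|, so it lies in the Stolz region of parameter 2. *)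
pose z := circ (1 - m) t.
have zt : normc (z - cis t) = m.
  rewrite (_ : z - cis t = - (m%:C%C * cis t)).
    by rewrite normcN modulus_circ// /m; lra.
  by rewrite /z /circ rmorphB rmorph1; ring.
have zz : normc z = 1 - m by rewrite modulus_circ// /m; lra.
have zM : normc (z - cis t) < 2 * (1 - normc z) by rewrite zt zz /m; lra.
have A := Hd z; rewrite zt in A; have A' := Hd' z; rewrite zt in A'.
rewrite (_ : w - w' = (g z - w') - (g z - w)); last by ring.
apply: le_trans (ler_modulusB _ _) _.
rewrite zt in zM.
have := A _ zM; have := A' _ zM; rewrite /m => B B'.
by have := B ltac:(lra); have := B' ltac:(lra); lra.
Qed.

Lemma boundary_valueE g t w : nontangential_limit g (cis t) w ->
  boundary_value g (cis t) = w.
Proof.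
move=> gw; apply: xget_unique => // w' gw'; exact: nontangential_unique gw' gw.
Qed.

Lemma radial_limit g t w : nontangential_limit g (cis t) w ->
  forall e, 0 < e -> exists2 d, 0 < d & forall r, 0 <= r < 1 -> 1 - r < d ->
    normc (g (circ r t) - w) < e.
Proof.
move=> /nontangential_limitP H e e0; have M1 : (1 : R) < 2 by lra.
have [d d0 Hd] := H 2 M1 _ e0; exists d => // r /andP[r0 r1] rd.
have zt : normc (circ r t - cis t) = 1 - r.
  rewrite (_ : circ r t - cis t = - ((1 - r)%:C%C * cis t)).
    by rewrite normcN modulus_circ// subr_ge0 ltW.
  by rewrite /circ rmorphB rmorph1; ring.
by apply: Hd; rewrite zt// modulus_circ//; lra.
Qed.

Lemma ae_imply (P Q : R -> Prop) : {ae mu, forall t, P t} -> (forall t, P t -> Q t) ->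
  {ae mu, forall t, Q t}.
Proof.
move=> aP PQ; have FF := ae_filter_ringOfSetsType mu.
exact: (@filterS _ _ FF P Q PQ aP).
Qed.

Lemma ae_and (P Q : R -> Prop) : {ae mu, forall t, P t} -> {ae mu, forall t, Q t} ->
  {ae mu, forall t, P t /\ Q t}.
Proof.
move=> aP aQ; have FF := ae_filter_ringOfSetsType mu.
exact: (@filterI _ _ FF P Q aP aQ).
Qed.

(** Dominated convergence with limit 1; as u n t <= 1, convergence amounts to lower bounds. It turns
    boundary values into mean squares here, and yields the contradiction in
    [bowen_separated_extend]. *)
Lemma ravg_ae_limit1 (u : nat -> R -> R) : (forall n, continuous (u n)) ->
  (forall n t, 0 <= u n t <= 1) ->
  {ae mu, forall t, `[0, 2 * pi[%classic t ->
     forall e, 0 < e -> exists N, forall n, (N <= n)%N -> 1 - e <= u n t} ->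
  forall e, 0 < e -> exists N, forall n, (N <= n)%N -> 1 - e <= ravg 0 (u n).
Proof.
move=> cu u01 aeu.
pose D := `[0, 2 * pi[%classic : set R.
have mD : measurable D by exact: measurable_itv.
have muD : mu D = (2 * pi)%:E.
  by rewrite /D lebesgue_measure_itv/= lte_fin twopi_gt0 oppr0 adde0.
have mDoo : (mu D < +oo)%E by rewrite muD ltry.
have mun n : measurable_fun D (EFin \o u n).
  apply/measurable_EFinP; apply: measurable_funTS; exact: continuous_measurable_fun.
have i1 : mu.-integrable D (cst 1%E : R -> \bar R).
  apply/integrableP; split; first exact: measurable_cst.
  under eq_integral do rewrite /= normr1.
  by rewrite integral_cst// mul1e.
have [] := @dominated_convergence _ _ R mu D mD (fun n => EFin \o u n) (cst 1%E) (cst 1%E)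
  mun (measurable_cst _) _ i1 _.
- apply: (ae_imply aeu) => t H Dt; apply/fine_cvgP; split; first by near=> n.
  apply/cvgrPdist_le => e e0; have [N HN] := H Dt e e0.
  near=> n; have Nn : (N <= n)%N by near: n; exists N.
  have := HN n Nn; have /andP[_ u1] := u01 n t => /=.
  by move=> A; rewrite ger0_norm ?subr_ge0//; lra.
- apply: aeW => t n _; rewrite /= lee_fin; have /andP[u0 u1] := u01 n t.
  by rewrite ger0_norm.
move=> _ _ H e e0.
have Iu n : (\int[mu]_(x in D) (EFin \o u n) x = (rint 0 (2 * pi) (u n))%:E)%E.
  rewrite EFin_rint; last by move=> x _; exact: cu.
  by rewrite /D integral_itv_bndo_bndc.
have I1 : (\int[mu]_(x in D) cst 1%E x = (2 * pi)%:E :> \bar R)%E.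
  by rewrite integral_cst// mul1e; exact: muD.
move: H; rewrite I1; under eq_fun do rewrite Iu.
move=> /fine_cvgP[_] /cvgrPdist_le/(_ (2 * pi * e) _)[|N _ HN].
  by rewrite mulr_gt0// twopi_gt0.
exists N => n Nn; have := HN n Nn => /=.
move=> /(le_trans (ler_norm _)); rewrite /ravg add0r => A.
rewrite mulrC ler_pdivlMr ?twopi_gt0//; lra.
Unshelve. all: by end_near. Qed.

Lemma inner_function_inner0 f : inner_function f -> centred f -> inner0 f.
Proof.
move=> [df f1 aef] f0; have hf : holo f by move=> z /df/derivable_cdiff; exists ('D_1 (f : C^o -> C^o) z).
split=> // e e0.
pose r n : R := 1 - n.+2%:R^-1.
have r01 n : 0 < r n < 1.
  have : (n.+2%:R : R)^-1 < 1 by rewrite invf_lt1// ltr1n.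
  have : 0 < (n.+2%:R : R)^-1 by rewrite invr_gt0.
  by rewrite /r; move: (_^-1) => x *; apply/andP; split; lra.
have r01' n : 0 <= r n < 1 by case/andP: (r01 n) => /ltW ->.
have rcvg d : 0 < d -> exists N, forall n, (N <= n)%N -> 1 - r n < d.
  move=> d0; have := @cvg_harmonic R => /cvgrPdist_lt/(_ d d0)[N _ HN].
  exists N => n Nn; have := HN n.+1 (leqW Nn); rewrite /= sub0r normrN.
  by move=> /(le_lt_trans (ler_norm _)); rewrite /r opprB addrC subrK.
have [|||N HN] := @ravg_ae_limit1 (fun n t => normc (f (circ (r n) t)) ^+ 2) _ _ _ e e0.
- by move=> n; exact: E2_continuous.
- move=> n t; rewrite sqr_ge0/= exprn_ile1 ?modulus_ge0//.
  have /andP[r0 r1] := r01' n.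
  by apply: f1; rewrite /unit_disc; apply: (_ : normc _ < 1); rewrite modulus_circ.
- apply: (ae_imply aef) => t H Dt e' e'0; have [w w1 fw] := H Dt.
  (* Half of e' is taken because 1 - x^2 <= 2 (1 - x). *)
  have [d d0 Hd] := radial_limit fw (divr_gt0 e'0 (ltr0n R 2)).
  have [N HN] := rcvg d d0; exists N => n /HN/(Hd _ (r01' n)) A.
  have := modulus_sub_ge w (f (circ (r n) t)); rewrite modulusBC w1 => B.
  have := modulus_ge0 (f (circ (r n) t)).
  by move: A B; set x := normc (f _); set y := normc (_ - _) => *; nra.
by exists (r N) => //; exact: HN.
Qed.

Lemma multiplier_cdiff f l : inner_function f -> cdiff f 0 l -> multiplier f = normc l.
Proof.
move=> [df _ _] fl; rewrite /multiplier derive1E.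
have d0 : normc (0 : C) < 1 by rewrite Normc.normc0.
have /derivable_cdiff fD := df 0 d0.
by rewrite (cdiff_unique fl fD).
Qed.

End Bridge.

(** * Fatou's theorem on Stolz regions *)

Section StolzEstimate.
Context {R : realType}.
Local Notation C := R[i].
Implicit Types (r s t x y : R) (z w : C) (v k : R -> R).

Lemma cos_sin_quarter y : 0 <= y <= pi / 4 -> 1 / 2 <= cos y /\ y / 2 <= sin y.
Proof.
move=> /andP[y0 y4]; have p0 := @pi_gt0 R.
have cpos x : 0 <= x <= pi / 4 -> 1 / 2 <= cos x.
  move=> /andP[x0 x4].
  have c4 : cos (pi / 4 : R) ^+ 2 = 1 / 2.
    have := cos_mulr2n (pi / 4 : R); rewrite (_ : pi / 4 *+ 2 = pi / 2); last by rewrite mulr2n; lra.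
    by rewrite cos_pihalf mulr2n; lra.
  have cp : 0 < cos (pi / 4 : R) by apply: cos_gt0_pihalf; apply/andP; split; lra.
  have le : cos (pi / 4) <= cos x.
    move: x4; rewrite le_eqVlt => /predU1P[->//|x4]; apply/ltW; rewrite ltr_cos//.
      by rewrite in_itv/=; apply/andP; split; lra.
    by rewrite in_itv/=; apply/andP; split; lra.
  by apply: le_trans le; nra.
split; first by apply: cpos; rewrite y0.
have [c] := @MVT_segment R sin cos 0 y y0 (fun x _ => is_derive_sin x)
  (continuous_subspaceT (@continuous_sin R)).
rewrite in_itv/= sin0 !subr0 => /andP[c0 cy] ->.
have : 1 / 2 <= cos c by apply: cpos; apply/andP; split; lra.
nra.
Qed.

(** By sin x = 2 cos (x/2) sin (x/2), where x/2 is at most pi/4: there the cosine is at least 1/2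
    and the sine at least half its argument. *)
Lemma sin_lower_bound x : 0 <= x <= pi / 2 -> x / 4 <= sin x.
Proof.
move=> /andP[x0 x2]; have [] := @cos_sin_quarter (x / 2).
  by apply/andP; split; lra.
have := sin_mulr2n (x / 2); rewrite (_ : x / 2 *+ 2 = x); last by rewrite mulr2n; lra.
move=> -> ch sh; rewrite mulr2n.
have : 0 <= (cos (x / 2) - 1 / 2) * sin (x / 2) by rewrite mulr_ge0 ?subr_ge0//; lra.
nra.
Qed.

Lemma chord_lower_bound s t : `|s - t| <= pi -> `|s - t| / 4 <= normc (cis s - cis t).
Proof.
move=> st; set u := `|s - t| / 2.
have u0 : 0 <= u by rewrite divr_ge0.
have su : u / 4 <= sin u by apply: sin_lower_bound; rewrite u0/= /u; lra.
have E : normc (cis s - cis t) ^+ 2 = (2 * sin u) ^+ 2.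
  rewrite sqr_modulus cReD cImD cReN cImN/=.
  have A : cos (s - t) = 1 - 2 * sin u ^+ 2.
    rewrite -cos_norm (_ : `|s - t| = u *+ 2); last by rewrite /u mulr2n; lra.
    by rewrite cos_mulr2n cos2sin2 mulr2n; lra.
  rewrite cosB in A; have := cos2Dsin2 s; have := cos2Dsin2 t.
  move: A; set a := cos s; set b := sin s; set c := cos t; set d := sin t => *; nra.
have n0 := modulus_ge0 (cis s - cis t).
rewrite -(ler_pXn2r (_ : 0 < 2)%N) ?nnegrE ?divr_ge0// E.
rewrite lerXn2r ?nnegrE ?divr_ge0 ?mulr_ge0//; rewrite /u in su u0 *; lra.
Qed.

(** In a Stolz region the distance from z to e^(is) dominates 1 - |z| and also, by the triangle
    inequality through z, |s - t| / (4 (1 + M)). The first fact bounds the height of the kernel, the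
    second gives its quadratic decay. *)
Lemma pois_stolz (M : R) z s t : 1 < M -> normc z < 1 ->
  normc (z - cis t) < M * (1 - normc z) -> `|s - t| <= pi ->
  pois (z * conjc (cis s)) <= 2 / (1 - normc z) /\
  pois (z * conjc (cis s)) * (s - t) ^+ 2 <= 2 * (1 - normc z) * (4 * (1 + M)) ^+ 2.
Proof.
move=> M1 z1 zM st; set h := 1 - normc z in zM *.
have h0 : 0 < h by rewrite subr_gt0.
pose D := normc (cis s - z).
have cs : cis s * conjc (cis s) = 1 by rewrite mulC_conj modulus_cis expr1n.
have ED : normc (1 - z * conjc (cis s)) = D.
  by rewrite -cs -mulrBl Normc.normcM modulus_conj modulus_cis mulr1.
have hD : h <= D.
  by have := modulus_sub_ge (cis s) z; rewrite modulus_cis.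
have D0 : 0 < D by apply: lt_le_trans hD.
have stD : `|s - t| <= 4 * (1 + M) * D.
  have := chord_lower_bound st.
  have := le_normcD (cis s - z) (z - cis t); rewrite addrA subrK -/D.
  by nra.
have zz : 1 - normc z ^+ 2 <= 2 * h by rewrite /h; have := modulus_ge0 z; nra.
rewrite /pois Normc.normcM modulus_conj modulus_cis mulr1 ED.
have zz0 : 0 <= 1 - normc z ^+ 2 by have := modulus_ge0 z; nra.
split.
  rewrite ler_pdivrMr ?exprn_gt0// mulrAC ler_pdivlMr//.
  apply: (@le_trans _ _ (2 * h * h)); first by rewrite ler_wpM2r// ltW.
  by nra.
rewrite mulrAC ler_pdivrMr ?exprn_gt0//.
apply: (@le_trans _ _ (2 * h * (s - t) ^+ 2)); first by rewrite ler_wpM2r ?sqr_ge0.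
rewrite -[leRHS]mulrA -exprMn -[leRHS]mulrA.
rewrite -mulrA ler_wpM2l// ler_wpM2l ?(ltW h0)//.
rewrite -[leLHS]real_normK ?num_real// lerXn2r ?nnegrE// mulr_ge0 ?(ltW D0)//; lra.
Qed.

(* [k] is dominated by a dyadic sum of normalized indicators of intervals
   around t, over each of which the mean of [v] is at most [e]. *)
Lemma dyadic_bound v k t (h L e : R) : continuous v -> continuous k ->
  (forall s, 0 <= v s) -> (forall s, 0 <= k s) -> 0 < h -> h <= pi -> 0 <= e ->
  (forall x, 0 < x <= pi -> rint (t - x) (t + x) v <= 2 * x * e) ->
  (forall s, `|s - t| <= pi -> k s <= 2 / h) ->
  (forall s, `|s - t| <= pi -> k s * (s - t) ^+ 2 <= 2 * h * L ^+ 2) ->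
  rint (t - pi) (t + pi) (fun s => v s * k s) <= (4 + 16 * L ^+ 2) * e.
Proof.
move=> cv ck v0 k0 h0 hpi e0 Hv Hk1 Hk2.
have cvk : continuous (fun s => v s * k s).
  by move=> s; apply: cvgM; [exact: cv | exact: ck].
pose S x := rint (t - x) (t + x) (fun s => v s * k s).
(* For x <= |s - t| <= y the kernel is at most K, and the integral of v there is bounded through its
   mean over all of |s - t| <= y; y <= 2 x keeps the two scales comparable. *)
have shell x y : 0 < x -> x <= y -> y <= 2 * x -> y <= pi ->
    S y <= S x + 8 * h * L ^+ 2 * e / x.
  move=> x0 xy y2 ypi; have y0 : 0 < y by apply: lt_le_trans xy.
  have x20 : 0 < x ^+ 2 by rewrite exprn_gt0.
  pose K := 2 * h * L ^+ 2 / x ^+ 2.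
  have K0 : 0 <= K by rewrite /K divr_ge0 ?sqr_ge0// mulr_ge0 ?sqr_ge0// mulr_ge0// ltW.
  have part a b : a <= b -> (forall s, a <= s <= b -> x <= `|s - t| <= pi) ->
      rint a b (fun s => v s * k s) <= K * rint a b v.
    move=> ab H; rewrite -rintZ//; last exact: continuous_rcont.
    apply: le_rint; first exact: continuous_rcont.
      by apply: rcontZ; exact: continuous_rcont.
    move=> s /H/andP[xs spi]; rewrite mulrC ler_wpM2r//.
    rewrite /K ler_pdivlMr//; apply: le_trans (Hk2 s spi).
    rewrite ler_wpM2l// -[leRHS]real_normK ?num_real//.
    by rewrite lerXn2r ?nnegrE ?(ltW x0)// (le_trans (ltW x0)).
  have l1 : t - y <= t - x by lra.
  have l2 : t - x <= t + x by lra.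
  have l3 : t + x <= t + y by lra.
  have l4 : t - x <= t + y by lra.
  have E f : continuous f -> rint (t - y) (t + y) f =
      rint (t - y) (t - x) f + (rint (t - x) (t + x) f + rint (t + x) (t + y) f).
    move=> cf; rewrite (rint_cat l1 l4) ?(rint_cat l2 l3)//; exact: continuous_rcont.
  have := Hv y; rewrite y0 ypi => /(_ isT); rewrite E// => Vy.
  have V0 : 0 <= rint (t - x) (t + x) v by apply: rint_ge0 => s _.
  have V1 : 0 <= rint (t - y) (t - x) v by apply: rint_ge0 => s _.
  have V2 : 0 <= rint (t + x) (t + y) v by apply: rint_ge0 => s _.
  have P1 : rint (t - y) (t - x) (fun s => v s * k s) <= K * rint (t - y) (t - x) v.
    apply: part => // s /andP[s1 s2]; rewrite ler0_norm; last by lra.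
    by apply/andP; split; lra.
  have P2 : rint (t + x) (t + y) (fun s => v s * k s) <= K * rint (t + x) (t + y) v.
    apply: part => // s /andP[s1 s2]; rewrite ger0_norm; last by lra.
    by apply/andP; split; lra.
  rewrite /S E//.
  have -> : 8 * h * L ^+ 2 * e / x = K * (2 * (2 * x) * e).
    by rewrite /K; field; rewrite gt_eqF.
  have : K * (rint (t - y) (t - x) v + rint (t + x) (t + y) v) <= K * (2 * (2 * x) * e).
    rewrite ler_wpM2l//.
    have : 2 * y * e <= 2 * (2 * x) * e by rewrite ler_wpM2r//; lra.
    lra.
  rewrite mulrDr; lra.
have base : S h <= 4 * e.
  apply: (@le_trans _ _ (2 / h * rint (t - h) (t + h) v)).
    rewrite -rintZ; last exact: continuous_rcont.
    apply: le_rint; first exact: continuous_rcont.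
      by apply: rcontZ; exact: continuous_rcont.
    move=> s /andP[s1 s2]; rewrite mulrC ler_wpM2r//; apply: Hk1.
    rewrite ler_norml; apply/andP; split; lra.
  have := Hv h; rewrite h0 hpi => /(_ isT) H.
  apply: le_trans (ler_wpM2l _ H) _; first by rewrite divr_ge0// ltW.
  rewrite le_eqVlt; apply/orP; left; apply/eqP; field; by rewrite gt_eqF.
have dy n : 2 ^+ n * h <= pi -> S (2 ^+ n * h) <= 4 * e + 16 * L ^+ 2 * e * (1 - 2 ^- n).
  elim: n => [|n IH] Hn; first by rewrite expr0 mul1r invr1 subrr mulr0 addr0.
  have p0 : 0 < (2 : R) ^+ n by rewrite exprn_gt0.
  have xn0 : 0 < 2 ^+ n * h by rewrite mulr_gt0.
  have le1 : 2 ^+ n * h <= 2 ^+ n.+1 * h by rewrite ler_pM2r// ler_weXn2l ?ler1n.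
  apply: le_trans (shell (2 ^+ n * h) _ xn0 le1 _ Hn) _; first by rewrite exprS mulrA.
  apply: le_trans (lerD (IH (le_trans le1 Hn)) (lexx _)) _.
  rewrite le_eqVlt; apply/orP; left; apply/eqP.
  rewrite (exprS 2 n); move: (2 ^+ n) p0 => q q0; field; by rewrite !gt_eqF.
have [n [nl nu]] : exists n, 2 ^+ n * h <= pi /\ pi <= 2 * (2 ^+ n * h).
  pose P n := pi < (2 : R) ^+ n * h.
  have exP : exists n, P n.
    have [N HN] := @cvg_geometric_bound R pi (1 / 2) h (ltac:(by apply/andP; split; lra)) h0.
    exists N; have := HN N (leqnn N); rewrite ger0_norm; last by rewrite mulr_ge0 ?pi_ge0 ?exprn_ge0.
    by rewrite /P expr_div_n expr1n mulrA mulr1 ltr_pdivrMr ?exprn_gt0// mulrC.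
  have := ex_minnP exP; case=> m Pm mmin.
  have m0 : (0 < m)%N.
    by rewrite lt0n; apply/eqP => m0; move: Pm; rewrite /P m0 expr0 mul1r ltNge hpi.
  exists m.-1; split.
    by rewrite leNgt; apply/negP => /mmin; rewrite leqNgt ltn_predL m0.
  by move: Pm; rewrite /P -{1}(prednK m0) exprS -mulrA => /ltW.
have p0 : 0 < (2 : R) ^+ n by rewrite exprn_gt0.
have xn0 : 0 < 2 ^+ n * h by rewrite mulr_gt0.
(* The last shell, from 2^n h to pi, may be shorter than a doubling; its cost is covered by the term
   16 L^2 e 2^-n left over in [dy]. *)
apply: le_trans (shell (2 ^+ n * h) pi xn0 nl nu (lexx _)) _.
apply: le_trans (lerD (dy n nl) (lexx _)) _.
have -> : 8 * h * L ^+ 2 * e / (2 ^+ n * h) = 8 * L ^+ 2 * e * 2 ^- n.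
  move: (2 ^+ n) p0 => q q0; field; by rewrite !gt_eqF.
have Le : 0 <= L ^+ 2 * e by rewrite mulr_ge0 ?sqr_ge0.
have := divr_ge0 Le (ltW p0).
move: (2 ^- n) => q; lra.
Qed.

End StolzEstimate.

(** * Maximal inequality and comparison of radii *)

Section Fatou.
Context {R : realType}.
Local Notation C := R[i].
Local Notation mu := (@lebesgue_measure R).
Implicit Types (r s t x y e : R) (z w : C) (u v : R -> R) (n N j : nat) (F : C -> C).

Lemma borel_cantelli_geometric (A : nat -> set R) (K : R) : 0 <= K ->
  (forall n, measurable (A n)) -> (forall n, (mu (A n) <= (K / 2 ^+ n.+1)%:E)%E) ->
  {ae mu, forall t, exists N, forall n, (N <= n)%N -> ~ A n t}.
Proof.
move=> K0 mA muA.
have B0 : mu (lim_sup_set A) = 0%E.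
  apply: lim_sup_set_cvg0 => //; apply: (@le_lt_trans _ _ K%:E); last exact: ltry.
  apply: le_trans (epsilon_trick0 xpredT K0).
  apply: lee_nneseries => [n _ _|n _]; first exact: measure_ge0.
  by rewrite natrX; exact: muA.
exists (lim_sup_set A); split => //.
  by apply: bigcapT_measurable => n; apply: bigcup_measurable => i _; exact: mA.
move=> t /= /forallNP H n _ /=; have /existsNP[i /not_implyP[ni /contrapT Ai]] := H n.
by exists i.
Qed.

(** The Hardy-Littlewood weak-type inequality, with its constant 3, for v cut off to [-pi, 3 pi]:
    this interval contains (t - x, t + x) for all t in [0, 2 pi] and x <= pi. *)
Lemma maximal_exceptional v (K c : R) : continuous v -> (forall t, 0 <= v t) ->
  rint (- pi) (3 * pi) v <= K -> 0 < c ->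
  exists A, [/\ measurable A, (mu A <= (3 / c * K)%:E)%E &
    forall t, 0 <= t <= 2 * pi -> ~ A t ->
    forall x, 0 < x <= pi -> rint (t - x) (t + x) v <= 2 * x * c].
Proof.
move=> cv v0 vK c0; have p0 := @pi_gt0 R.
pose B := `[- pi, 3 * pi]%classic : set R; pose w := v \_ B.
have mB : measurable B by exact: measurable_itv.
have ci : mu.-integrable B (EFin \o v) by apply: rcont_integrable; exact: continuous_rcont.
have iw : mu.-integrable setT (EFin \o w).
  by rewrite /w -restrict_EFin; apply/integrable_restrict => //; rewrite setTI.
have lw : locally_integrable setT w by apply: open_integrable_locally => //; exact: openT.
exists [set t | (HL_maximal w t > c%:E)%E]; split.
- rewrite -[X in measurable X]setTI; apply: emeasurable_fun_o_infty => //.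
  exact: measurable_HL_maximal.
- apply: le_trans (maximal_inequality lw c0) _.
  have -> : (\int[mu]_(y in setT) `|(w y)%:E| = (rint (- pi) (3 * pi) v)%:E)%E.
    rewrite EFin_rint; last exact: continuous_rcont.
    rewrite -/B [RHS]integral_mkcond; apply: eq_integral => t _.
    by rewrite /w !patchE; case: ifP => _; rewrite ?normr0// abse_EFin ger0_norm.
  by rewrite -EFinM lee_fin ler_wpM2l// divr_ge0// ltW.
- move=> t /andP[t0 t2] /negP; rewrite -leNgt => HL x /andP[x0 xpi].
  have bB : ball t x `<=` B.
    move=> y; rewrite ball_itv/= !in_itv/= => /andP[y1 y2].
    rewrite /B /= in_itv/=.
    by rewrite (le_trans _ (ltW y1)) ?(le_trans (ltW y2))//; lra.
  have : (iavg w (ball t x) <= c%:E)%E.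
    by apply: le_trans HL; apply: ereal_sup_ubound; exists x => //=; rewrite in_itv/= x0.
  rewrite /iavg lebesgue_measure_ball ?(ltW x0)//.
  have -> : (\int[mu]_(y in ball t x) `|(w y)%:E| = (rint (t - x) (t + x) v)%:E)%E.
    rewrite EFin_rint; last exact: continuous_rcont.
    rewrite (@integral_itv_bndoo _ _ _ _ true false); last first.
      by apply/measurable_EFinP; apply: measurable_funTS; exact: continuous_measurable_fun.
    rewrite ball_itv; apply: eq_integral => y /set_mem/= yb.
    have yB : y \in B by apply/mem_set; apply: bB; rewrite ball_itv.
    by rewrite /w patchE yB ger0_norm.
  have x20 : 0 < x *+ 2 by rewrite mulrn_wgt0.
  rewrite inver gt_eqF// -EFinM lee_fin mulrC ler_pdivrMr//.
  by rewrite mulr2n => H; apply: le_trans H _; lra.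
Qed.

Lemma mean_bound_value v t c : continuous v ->
  (forall x, 0 < x <= pi -> rint (t - x) (t + x) v <= 2 * x * c) -> v t <= c.
Proof.
move=> cv H; apply/ler_addgt0Pl => e e0; have p0 := @pi_gt0 R.
have [d /= d0 Hd] := (nbhs_normP _ _).1 ((cvgrPdist_lt _ _).1 (cv t) _ e0).
pose x := Num.min (d / 2) pi.
have x0 : 0 < x by rewrite lt_min p0 divr_gt0.
have xd : x < d by rewrite gt_min; apply/orP; left; lra.
have xp : x <= pi by rewrite ge_min lexx orbT.
have := H x; rewrite x0 xp => /(_ isT) B.
have : rint (t - x) (t + x) (fun=> v t - e) <= rint (t - x) (t + x) v.
  apply: le_rint; [by apply: continuous_rcont => s; exact: cvg_cst|exact: continuous_rcont|].
  move=> s /andP[s1 s2]; have : `|v t - v s| < e.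
    by apply: Hd; rewrite /ball_/= ltr_norml; apply/andP; split; lra.
  by rewrite ltr_norml => /andP[_]; lra.
rewrite rint_cst; last by lra.
move=> B'; have : (v t - e) * (2 * x) <= c * (2 * x) by lra.
by rewrite ler_pM2r; lra.
Qed.

Lemma E2_close F b r s e : holo F -> bdd F 1 -> 0 < r < 1 -> 0 < s < 1 ->
  1 - e <= E2 0 r F -> 1 - e <= E2 0 s F ->
  ravg b (fun t => normc (F (circ s t) - F (circ r t)) ^+ 2) <= e.
Proof.
move=> hF F1 /andP[r0 r1] /andP[s0 s1] Er Es.
have Er1 := @E2_le1 _ F r hF F1; have Es1 := @E2_le1 _ F s hF F1.
rewrite (E2_base 0 b hF F1) in Er Er1; last by rewrite ltW.
rewrite (E2_base 0 b hF F1) in Es Es1; last by rewrite ltW.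
have := Er1 ltac:(by rewrite ltW); have := Es1 ltac:(by rewrite ltW) => {}Er1 {}Es1.
have [rs|sr] := leP r s.
  by apply: le_trans (E2_radial_diff b hF F1 (ltW r0) rs s0 s1) _; lra.
have -> : ravg b (fun t => normc (F (circ s t) - F (circ r t)) ^+ 2) =
    ravg b (fun t => normc (F (circ r t) - F (circ s t)) ^+ 2).
  by apply: eq_ravg => t; rewrite modulusBC.
by apply: le_trans (E2_radial_diff b hF F1 (ltW s0) (ltW sr) r0 r1) _; lra.
Qed.

Lemma rint_two_periods v K : continuous v -> ravg (- pi) v <= K -> ravg pi v <= K ->
  rint (- pi) (3 * pi) v <= 4 * pi * K.
Proof.
move=> cv; have p0 := @pi_gt0 R.
rewrite /ravg (_ : - pi + 2 * pi = pi); last by ring.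
rewrite (_ : pi + 2 * pi = 3 * pi); last by ring.
rewrite !(mulrC (2 * pi)^-1) !ler_pdivrMr ?twopi_gt0// => H1 H2.
rewrite (@rint_cat _ _ pi); [lra|lra|lra|exact: continuous_rcont].
Qed.

(** The constant of [dyadic_bound] for L = 4 (1 + M), the decay constant found in [pois_stolz]. *)
Definition stolz_const (M : R) : R := 4 + 16 * (4 * (1 + M)) ^+ 2.

Lemma stolz_const_ge0 M : 0 <= stolz_const M.
Proof. by rewrite addr_ge0// mulr_ge0// sqr_ge0. Qed.

(** By [poisson_formula] the difference at z is a Poisson integral of the difference on the circle.
    Taken over the period centred at t, it falls under [dyadic_bound]. *)
Lemma stolz_step F B r s t e M z : holo F -> bdd F B -> 0 < r < 1 -> 0 < s < 1 -> 0 <= e ->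
  (forall x, 0 < x <= pi ->
     rint (t - x) (t + x) (fun y => normc (F (circ s y) - F (circ r y))) <= 2 * x * e) ->
  1 < M -> normc (z - cis t) < M * (1 - normc z) ->
  normc (F (s%:C%C * z) - F (r%:C%C * z)) <= stolz_const M * e.
Proof.
move=> hF FB r01 s01 e0 H M1 zM; have p0 := @pi_gt0 R.
have z1 : normc z < 1.
  rewrite -subr_gt0 -(@pmulr_rgt0 _ M); last by lra.
  by apply: le_lt_trans zM; exact: modulus_ge0.
have cs : pcontT (fun y => F (circ s y)) by exact: pcontT_holo.
have cr : pcontT (fun y => F (circ r y)) by exact: pcontT_holo.
pose k y := pois (z * conjc (cis y)).
have zk y : normc (z * conjc (cis y)) < 1.
  by rewrite Normc.normcM modulus_conj modulus_cis mulr1.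
have ck : continuous k.
  rewrite (_ : k = fun y => pois (z * (circ 1 y)^-1)); first exact: continuous_pois.
  by apply/funext => y; rewrite circV// expr1n invr1 /circ !mul1r.
have k0 y : 0 <= k y by exact: pois_ge0.
have ckC : pcontT (fun y => (k y)%:C%C) by move=> y; apply: pcont_real; exact: ck.
rewrite (poisson_formula hF FB (t - pi) s01 z1) (poisson_formula hF FB (t - pi) r01 z1).
rewrite -avgB; [|by move=> y; apply: pcontM|by move=> y; apply: pcontM].
pose v y := normc (F (circ s y) - F (circ r y)).
have cv : continuous v by apply: pcontT_modulus => y; exact: pcontB.
rewrite (@eq_avg _ _ _ (fun y => (F (circ s y) - F (circ r y)) * (k y)%:C%C)); last first.
  by move=> y; rewrite mulrBl.
apply: le_trans (modulus_avg _ _) _; first by move=> y; apply: pcontM => //; exact: pcontB.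
rewrite (@eq_ravg _ _ _ (fun y => v y * k y)); last first.
  by move=> y; rewrite Normc.normcM modulus_real ger0_norm.
rewrite /ravg (_ : t - pi + 2 * pi = t + pi); last by ring.
have h0 : 0 < 1 - normc z by rewrite subr_gt0.
have hpi : 1 - normc z <= pi by have := modulus_ge0 z; have := @pi_ge2 R; lra.
have D := dyadic_bound (L := 4 * (1 + M)) cv ck (fun y => modulus_ge0 _) k0 h0 hpi e0 H
  (fun y yt => (pois_stolz M1 z1 zM yt).1) (fun y yt => (pois_stolz M1 z1 zM yt).2).
rewrite mulrC ler_pdivrMr ?twopi_gt0//; apply: le_trans D _.
rewrite -/(stolz_const M) ler_peMr ?mulr_ge0 ?stolz_const_ge0//.
by have := @pi_ge2 R; lra.
Qed.

Lemma geometric_cauchy (x : nat -> R) (K : R) : 0 <= K ->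
  (forall n, `|x n.+1 - x n| <= K / 2 ^+ n) ->
  exists p, forall n, `|x n - p| <= 4 * K / 2 ^+ n.
Proof.
move=> K0 H.
(* With q = K / 2^n the left endpoints advance by between q and 3 q, and 3 q is half the length 6
   q. *)
have [] := @nested_halves _ (fun n => x n - 4 * K / 2 ^+ n) (6 * K); first by rewrite mulr_ge0.
  move=> n; have := H n; rewrite ler_norml => /andP[H1 H2].
  rewrite (exprS 2 n); have : 0 < (2 : R) ^+ n by rewrite exprn_gt0.
  move: (2 ^+ n) H1 H2 => q H1 H2 q0.
  have -> : 4 * K / (2 * q) = 2 * (K / q) by field; rewrite gt_eqF.
  have -> : 4 * K / q = 4 * (K / q) by field; rewrite gt_eqF.
  have -> : 6 * K / q / 2 = 3 * (K / q) by field; rewrite gt_eqF.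
  by apply/andP; split; lra.
move=> p Hp; exists p => n; have /andP[] := Hp n.
have p0 : 0 < (2 : R) ^+ n by rewrite exprn_gt0.
have : 0 <= K / 2 ^+ n by rewrite divr_ge0// ltW.
rewrite -!mulrA; move: (K / 2 ^+ n) => q q0 A B.
by rewrite ler_norml; apply/andP; split; lra.
Qed.

Lemma geometric_cauchyC (a : nat -> C) (K : R) : 0 <= K ->
  (forall n, normc (a n.+1 - a n) <= K / 2 ^+ n) ->
  exists p, forall n, normc (a n - p) <= 8 * K / 2 ^+ n.
Proof.
move=> K0 H.
have [] := @geometric_cauchy (fun n => Re (a n)) K K0.
  by move=> n; apply: le_trans (H n); rewrite -cReN -cReD; exact: Re_le_modulus.
move=> p Hp.
have [] := @geometric_cauchy (fun n => Im (a n)) K K0.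
  by move=> n; apply: le_trans (H n); rewrite -cImN -cImD; exact: Im_le_modulus.
move=> q Hq; exists (Complex p q) => n.
apply: le_trans (modulus_le_ReIm _) _; rewrite cReD cImD cReN cImN/=.
have := Hp n; have := Hq n; rewrite -!mulrA; move: (K / 2 ^+ n) => c; lra.
Qed.

End Fatou.

(** * Existence of unimodular non-tangential limits *)

Section BoundaryValues.
Context {R : realType}.
Local Notation C := R[i].
Local Notation mu := (@lebesgue_measure R).
Implicit Types (r s t x y e : R) (z w : C) (n N j : nat) (F : C -> C).

(** At level 2^-j the maximal inequality leaves an exceptional set of measure O(4^-j / 2^-j) =
    O(2^-j), which is summable, so Borel-Cantelli applies. *)
Lemma ae_small_means (v : nat -> R -> R) : (forall j, continuous (v j)) ->
  (forall j t, 0 <= v j t) -> (forall j b, ravg b (v j) <= 1 / 4 ^+ j) ->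
  {ae mu, forall t, 0 <= t <= 2 * pi -> exists N, forall j, (N <= j)%N ->
    forall x, 0 < x <= pi -> rint (t - x) (t + x) (v j) <= 2 * x * (1 / 2 ^+ j)}.
Proof.
move=> cv v0 vb; have p0 := @pi_gt0 R.
(* 24 pi / 2^(j+1) = 3 2^j (4 pi / 4^j): weak-type constant, inverse level, integral over two
   periods. *)
have /choice[A HA] : forall j, exists A, [/\ measurable A,
    (mu A <= (24 * pi / 2 ^+ j.+1)%:E)%E &
    forall t, 0 <= t <= 2 * pi -> ~ A t -> forall x, 0 < x <= pi ->
      rint (t - x) (t + x) (v j) <= 2 * x * (1 / 2 ^+ j)].
  move=> j; have q0 : 0 < (2 : R) ^+ j by rewrite exprn_gt0.
  have [] := @maximal_exceptional R (v j) (4 * pi * (1 / 4 ^+ j)) (1 / 2 ^+ j) (cv j) (v0 j).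
  - exact: rint_two_periods.
  - by rewrite divr_gt0.
  - move=> A [mA muA H]; exists A; split=> //; apply: le_trans muA _.
    rewrite lee_fin (_ : (4 : R) = 2 * 2); last by ring.
    rewrite exprMn (exprS 2 j) le_eqVlt; apply/orP; left; apply/eqP.
    by move: (2 ^+ j) q0 => q q0; field; rewrite gt_eqF.
have K0 : 0 <= 24 * pi :> R by rewrite mulr_ge0// ltW.
have := @borel_cantelli_geometric R A _ K0 (fun n => let: And3 m _ _ := HA n in m)
  (fun n => let: And3 _ m _ := HA n in m).
move=> /ae_imply; apply => t [N HN] t01; exists N => j Nj x x0.
by have [_ _ H] := HA j; apply: (H t t01 (HN j Nj)).
Qed.

(** Cauchy-Schwarz, by way of v <= 4^j v^2 / 2 + 4^-j / 2. *)
Lemma ravg_sqr_le b (v : R -> R) j : continuous v ->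
  ravg b (fun t => v t ^+ 2) <= 1 / 16 ^+ j -> ravg b v <= 1 / 4 ^+ j.
Proof.
move=> cv H; have q0 : 0 < (4 : R) ^+ j by rewrite exprn_gt0.
have cv2 : continuous (fun t => v t ^+ 2) by move=> t; apply: cvgM; exact: cv.
have cu : continuous (fun t => 4 ^+ j / 2 * v t ^+ 2).
  by move=> t; apply: cvgM; [exact: cvg_cst | exact: cv2].
have cc : continuous (fun t : R => 1 / 4 ^+ j / 2 : R) by move=> t; exact: cvg_cst.
apply: (@le_trans _ _ (ravg b (fun t => 4 ^+ j / 2 * v t ^+ 2 + 1 / 4 ^+ j / 2))).
  apply: le_ravg => //; first by move=> t; apply: cvgD; [exact: cu | exact: cc].
  move=> t; rewrite -subr_ge0.
  have -> : 4 ^+ j / 2 * v t ^+ 2 + 1 / 4 ^+ j / 2 - v t =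
      (4 ^+ j * v t - 1) ^+ 2 / (2 * 4 ^+ j).
    by move: (4 ^+ j) q0 => q q0; field; rewrite gt_eqF.
  by rewrite divr_ge0 ?sqr_ge0// mulr_ge0// ltW.
rewrite ravgD// ravgZ// ravg_cst.
apply: le_trans (lerD (ler_wpM2l _ H) (lexx _)) _; first by rewrite divr_ge0// ltW.
rewrite (_ : (16 : R) = 4 * 4); last by ring.
rewrite exprMn le_eqVlt; apply/orP; left; apply/eqP.
by move: (4 ^+ j) q0 => q q0; field; rewrite gt_eqF.
Qed.

(** The defect 16^-j in mean square becomes 4^-j in mean, and then 2^-j for all centred means off a
    small exceptional set, so that the increments are summable. *)
Lemma fatou_radii F : inner0 F -> exists rho : nat -> R, forall j,
  [/\ 0 < rho j < 1, 1 - rho j <= 1 / 2 ^+ j & 1 - 1 / 16 ^+ j <= E2 0 (rho j) F].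
Proof.
move=> iF.
suff /choice[rho H] : forall j, exists r,
    [/\ 0 < r < 1, 1 - r <= 1 / 2 ^+ j & 1 - 1 / 16 ^+ j <= E2 0 r F] by exists rho.
move=> j; have q0 : 0 < (16 : R) ^+ j by rewrite exprn_gt0.
have p0 : 0 < (2 : R) ^+ j by rewrite exprn_gt0.
have e0 : 0 < 1 / (16 : R) ^+ j by rewrite divr_gt0.
have d0 : 0 < 1 / (2 : R) ^+ j by rewrite divr_gt0.
have [r0 /andP[r00 r01] H] := inner0_E2 iF e0.
pose r := Num.max r0 (1 - 1 / 2 ^+ j / 2).
have r1 : r < 1 by rewrite gt_max r01; lra.
have rr : 1 - 1 / 2 ^+ j / 2 <= r by rewrite le_max lexx orbT.
have rr0 : r0 <= r by rewrite le_max lexx.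
exists r; split; [by rewrite r1 (lt_le_trans r00)|by lra|exact: H].
Qed.

Lemma cvg_radii F z0 : ccont F z0 -> forall M, (forall d, 0 < d -> exists2 z, normc (z - z0) < d &
  normc (F z) <= M) -> normc (F z0) <= M.
Proof.
move=> cF M H; apply/ler_addgt0Pl => e /cF[d /H[z zd zM] Hd].
have := Hd z zd; have := ler_modulusB (F z) (F z - F z0); rewrite opprB addrCA subrr addr0.
lra.
Qed.

(* On a Stolz region F (rho_j z) converges to F z geometrically, uniformly in z,
   by [stolz_step]; so F z is close to the value of F at rho_j e^(it). *)
Lemma nontangential_of_means F (rho : nat -> R) t N : holo F -> bdd F 1 ->
  (forall j, 0 < rho j < 1) -> (forall j, 1 - rho j <= 1 / 2 ^+ j) ->
  (forall j, (N <= j)%N -> forall x, 0 < x <= pi ->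
     rint (t - x) (t + x)
       (fun y => normc (F (circ (rho j.+1) y) - F (circ (rho j) y))) <= 2 * x * (1 / 2 ^+ j)) ->
  (forall j, (N <= j)%N -> 1 - normc (F (circ (rho j) t)) ^+ 2 <= 1 / 2 ^+ j) ->
  has_unimodular_boundary_value F (cis t).
Proof.
move=> hF F1 rho01 rho1 Hv Hu.
have p2 n : 0 < (2 : R) ^+ n by rewrite exprn_gt0.
have small K e : 0 < e -> exists n, (N <= n)%N /\ `|K / 2 ^+ n| < e.
  move=> e0; have [n0 Hn] := cvg_geometric_bound K (q := 1 / 2) (ltac:(by apply/andP; split; lra)) e0.
  exists (maxn N n0); split; first exact: leq_maxl.
  by have := Hn _ (leq_maxr N n0); rewrite expr_div_n expr1n mul1r.
have step M z j : 1 < M -> normc (z - cis t) < M * (1 - normc z) -> (N <= j)%N ->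
    normc (F ((rho j.+1)%:C%C * z) - F ((rho j)%:C%C * z)) <= stolz_const M * (1 / 2 ^+ j).
  move=> M1 zM Nj; have e0 : 0 <= 1 / (2 : R) ^+ j by rewrite divr_ge0// ltW.
  exact: (stolz_step hF F1 (rho01 j) (rho01 j.+1) e0 (Hv j Nj) M1 zM).
have disc M z : 1 < M -> normc (z - cis t) < M * (1 - normc z) -> normc z < 1.
  move=> M1 zM; rewrite -subr_gt0 -(@pmulr_rgt0 _ M); last by lra.
  by apply: le_lt_trans zM; exact: modulus_ge0.
have tele M z j n : 1 < M -> normc (z - cis t) < M * (1 - normc z) -> (N <= j)%N ->
    normc (F ((rho (j + n)%N)%:C%C * z) - F ((rho j)%:C%C * z)) <=
    stolz_const M * (2 / 2 ^+ j) * (1 - 1 / 2 ^+ n).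
  move=> M1 zM Nj; elim: n => [|n IH].
    by rewrite addn0 subrr Normc.normc0 expr0 divr1 subrr mulr0.
  rewrite addnS; have := step M z (j + n)%N M1 zM (leq_trans Nj (leq_addr _ _)).
  have -> : F ((rho (j + n)%N.+1)%:C%C * z) - F ((rho j)%:C%C * z) =
    (F ((rho (j + n)%N.+1)%:C%C * z) - F ((rho (j + n)%N)%:C%C * z)) +
    (F ((rho (j + n)%N)%:C%C * z) - F ((rho j)%:C%C * z)) by ring.
  move=> S; apply: le_trans (le_normcD _ _) _; apply: le_trans (lerD S IH) _.
  rewrite exprD (exprS 2 n) le_eqVlt; apply/orP; left; apply/eqP.
  move: (stolz_const M) (2 ^+ j) (2 ^+ n) (p2 j) (p2 n) => K p q pp qq.
  by field; rewrite !gt_eqF.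
have toz z : normc z < 1 -> forall d, 0 < d -> forall j, exists n,
    normc ((rho (j + n)%N)%:C%C * z - z) < d.
  move=> z1 d d0 j; have [n [_ Hn]] := small 1 d d0; exists n.
  rewrite (_ : _ - z = - ((1 - rho (j + n)%N)%:C%C * z)); last by rewrite rmorphB rmorph1; ring.
  have /andP[r0 r1] := rho01 (j + n)%N.
  rewrite normcN Normc.normcM modulus_real ger0_norm ?subr_ge0 ?(ltW r1)//.
  apply: le_lt_trans (_ : 1 - rho (j + n)%N < d); last first.
    apply: le_lt_trans (rho1 _) _; apply: le_lt_trans Hn.
    rewrite ger0_norm ?divr_ge0 ?(ltW (p2 n))// exprD ler_pdivrMr ?mulr_gt0//.
    by rewrite mulrCA mul1r mulVf ?gt_eqF// mulr1 exprn_ege1// ler1n.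
  by rewrite ler_piMr ?subr_ge0 ?(ltW r1) ?(ltW z1).
(* Let n grow in [tele]: rho (j + n) z tends to z, where F is continuous. *)
have near_radius M z j : 1 < M -> normc (z - cis t) < M * (1 - normc z) -> (N <= j)%N ->
    normc (F z - F ((rho j)%:C%C * z)) <= stolz_const M * (2 / 2 ^+ j).
  move=> M1 zM Nj; have z1 := disc M z M1 zM.
  have cG : ccont (fun w => F w - F ((rho j)%:C%C * z)) z.
    move=> e e0; have [d d0 Hd] := holo_ccont hF z1 e0; exists d => // w wd.
    by rewrite opprB addrA subrK; exact: Hd.
  apply: (cvg_radii cG) => d d0.
  have [n Hn] := toz z z1 d d0 j; exists ((rho (j + n)%N)%:C%C * z) => //.
  apply: le_trans (tele M z j n M1 zM Nj) _; rewrite ler_piMr//.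
  by rewrite mulr_ge0 ?stolz_const_ge0 ?divr_ge0 ?(ltW (p2 j)).
have radial r : 0 < r < 1 -> normc (circ r t - cis t) = 1 - r.
  move=> /andP[r0 r1]; rewrite (_ : circ r t - cis t = - ((1 - r)%:C%C * cis t)).
    by rewrite normcN modulus_circ// subr_ge0 ltW.
  by rewrite /circ rmorphB rmorph1; ring.
(* The boundary point lies in none of its Stolz regions, so [step] is applied along the radius and
   passed to the limit; F is continuous at the limit points, since rho j < 1. *)
have cauchy j : (N <= j)%N -> normc (F (circ (rho j.+1) t) - F (circ (rho j) t)) <=
    stolz_const 2 * (1 / 2 ^+ j).
  move=> Nj.
  have r1 k : normc ((rho k)%:C%C * cis t) < 1.
    by have /andP[k0 k1] := rho01 k; rewrite modulus_circ// ltW.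
  pose G w := F ((rho j.+1)%:C%C * w) - F ((rho j)%:C%C * w).
  have cG : ccont G (cis t).
    move=> e e0; have e2 : 0 < e / 2 by rewrite divr_gt0.
    have [d d0 Hd] := holo_ccont hF (r1 j.+1) e2.
    have [d' d0' Hd'] := holo_ccont hF (r1 j) e2.
    exists (Num.min d d'); first by rewrite lt_min d0.
    move=> w; rewrite lt_min => /andP[wd wd'].
    have sc k : normc ((rho k)%:C%C * w - (rho k)%:C%C * cis t) <= normc (w - cis t).
      have /andP[k0 k1] := rho01 k.
      rewrite -mulrBr Normc.normcM modulus_real ger0_norm ?(ltW k0)//.
      by rewrite ler_piMl ?modulus_ge0 ?(ltW k1).
    have A := Hd _ (le_lt_trans (sc j.+1) wd); have A' := Hd' _ (le_lt_trans (sc j) wd').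
    have -> : G w - G (cis t) =
      (F ((rho j.+1)%:C%C * w) - F ((rho j.+1)%:C%C * cis t)) -
      (F ((rho j)%:C%C * w) - F ((rho j)%:C%C * cis t)) by rewrite /G; ring.
    by apply: le_lt_trans (ler_modulusB _ _) _; lra.
  apply: (cvg_radii cG) => d d0.
  pose r := 1 - Num.min d 1 / 2.
  have m0 : 0 < Num.min d 1 by rewrite lt_min d0 ltr01.
  have [md m1] : Num.min d 1 <= d /\ Num.min d 1 <= 1 by rewrite !ge_min !lexx !orbT.
  have r01 : 0 < r < 1 by rewrite /r; apply/andP; split; lra.
  exists (circ r t); first by rewrite radial// /r; lra.
  apply: step => //; first by lra.
  have /andP[r00 r01'] := r01.
  by rewrite radial// modulus_circ ?(ltW r00)//; lra.
have [] := @geometric_cauchyC R (fun n => F (circ (rho (N + n)%N) t)) (stolz_const 2 / 2 ^+ N).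
- by rewrite divr_ge0 ?stolz_const_ge0 ?(ltW (p2 N)).
- move=> n; rewrite addnS; apply: le_trans (cauchy (N + n)%N (leq_addr _ _)) _.
  by rewrite exprD mul1r invfM mulrA.
move=> w Hw.
have Hw' j : (N <= j)%N -> normc (F (circ (rho j) t) - w) <= 8 * stolz_const 2 / 2 ^+ j.
  move=> Nj; have := Hw (j - N)%N; rewrite subnKC// => H; apply: le_trans H _.
  by rewrite -{2}(subnKC Nj) exprD invfM !mulrA.
exists w.
- rewrite /unit_circle/=; apply/eqP; rewrite eq_le; apply/andP; split.
    apply/ler_addgt0Pl => e e0; have [j [Nj Hj]] := small (8 * stolz_const 2) e e0.
    have := Hw' j Nj; have /andP[k0 k1] := rho01 j.
    have := F1 (circ (rho j) t); rewrite modulus_circ ?(ltW k0)// => /(_ k1).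
    have := ler_modulusB (F (circ (rho j) t)) (F (circ (rho j) t) - w).
    rewrite opprB addrCA subrr addr0; have := ler_norm (8 * stolz_const (2 : R) / 2 ^+ j).
    by lra.
  apply/ler_addgt0Pl => e e0; have e2 : 0 < e by [].
  have [j [Nj Hj]] := small (8 * stolz_const 2 + 1) e e2.
  rewrite mulrDl in Hj; have q0 := p2 j.
  have := Hw' j Nj; have /andP[k0 k1] := rho01 j.
  have := F1 (circ (rho j) t); rewrite modulus_circ ?(ltW k0)// => /(_ k1).
  have := Hu j Nj; have := modulus_ge0 (F (circ (rho j) t)).
  have := le_normcD w (F (circ (rho j) t) - w); rewrite addrCA subrr addr0.
  have := ler_norm ((8 * stolz_const (2 : R) + 1) / 2 ^+ j); rewrite mulrDl.
  set m := normc (F _).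
  move=> A B m0 m1 m2; have : 1 - m <= 1 / 2 ^+ j by nra.
  by lra.
- apply/nontangential_limitP => M M1 e e0.
  have [j [Nj Hj]] := small (2 * stolz_const M + 8 * stolz_const 2) (e / 2) ltac:(by rewrite divr_gt0).
  have e2 : 0 < e / 2 by rewrite divr_gt0.
  have /andP[k0 k1] := rho01 j.
  have r1 : normc ((rho j)%:C%C * cis t) < 1 by rewrite modulus_circ// ltW.
  have [d d0 Hd] := holo_ccont hF r1 e2; exists d => // z zd zM.
  have A := near_radius M z j M1 zM Nj.
  have B := Hw' j Nj.
  have D : normc (F ((rho j)%:C%C * z) - F (circ (rho j) t)) < e / 2.
    apply: Hd; rewrite -mulrBr Normc.normcM modulus_real ger0_norm ?(ltW k0)//.
    by apply: le_lt_trans zd; rewrite ler_piMl ?modulus_ge0 ?(ltW k1).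
  have -> : F z - w = (F z - F ((rho j)%:C%C * z)) +
    ((F ((rho j)%:C%C * z) - F (circ (rho j) t)) + (F (circ (rho j) t) - w)) by ring.
  apply: le_lt_trans (le_normcD _ _) _.
  apply: le_lt_trans (lerD A (le_trans (le_normcD _ _) (lerD (ltW D) B))) _.
  have := ler_norm ((2 * stolz_const M + 8 * stolz_const (2 : R)) / 2 ^+ j).
  have -> : stolz_const M * (2 / 2 ^+ j) = 2 * stolz_const M / 2 ^+ j by ring.
  by rewrite mulrDl in Hj *; lra.
Qed.

(** Two sequences of means are controlled at once: the increments between consecutive radii give the
    limit, and the defects 1 - |F|^2 on these radii force its modulus to be 1. *)
Theorem fatou_inner F : inner0 F ->
  {ae mu, forall t, `[0, 2 * pi[%classic t -> has_unimodular_boundary_value F (cis t)}.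
Proof.
move=> iF; have [hF F1 _ _] := iF; have [rho Hrho] := fatou_radii iF.
have rho01 j : 0 < rho j < 1 by have [] := Hrho j.
have rho1 j : 1 - rho j <= 1 / 2 ^+ j by have [] := Hrho j.
have rhoE j : 1 - 1 / 16 ^+ j <= E2 0 (rho j) F by have [] := Hrho j.
have cr j : pcontT (fun t => F (circ (rho j) t)) by exact: pcontT_holo.
have q0 j : 0 < (16 : R) ^+ j by rewrite exprn_gt0.
have cd j : pcontT (fun t => F (circ (rho j.+1) t) - F (circ (rho j) t)).
  by move=> t; apply: pcontB; exact: cr.
have cu j : continuous (fun t => normc (F (circ (rho j) t)) ^+ 2).
  exact: continuous_sqr_modulus.
have cu' j : continuous (fun t => 1 - normc (F (circ (rho j) t)) ^+ 2).
  by move=> t; apply: cvgB; [exact: cvg_cst | exact: cu].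
have u0 j t : 0 <= 1 - normc (F (circ (rho j) t)) ^+ 2.
  have /andP[k0 k1] := rho01 j; rewrite subr_ge0 expr_le1 ?modulus_ge0//.
  by apply: F1; rewrite modulus_circ// ltW.
have le16 j : 1 / (16 : R) ^+ j.+1 <= 1 / 16 ^+ j.
  by rewrite !mul1r lef_pV2 ?posrE// ler_weXn2l// ler1n.
have le4 j : 1 / (16 : R) ^+ j <= 1 / 4 ^+ j.
  by rewrite !mul1r lef_pV2 ?posrE ?exprn_gt0// lerXn2r ?nnegrE// ler_nat.
have Hv j b : ravg b (fun t => normc (F (circ (rho j.+1) t) - F (circ (rho j) t))) <= 1 / 4 ^+ j.
  apply: ravg_sqr_le; first exact: pcontT_modulus.
  apply: E2_close => //; apply: le_trans (rhoE j.+1).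
  by have := le16 j; lra.
have Hu j b : ravg b (fun t => 1 - normc (F (circ (rho j) t)) ^+ 2) <= 1 / 4 ^+ j.
  rewrite ravgB//; last by move=> t; exact: cvg_cst.
  have /andP[k0 k1] := rho01 j.
  rewrite ravg_cst -/(E2 b (rho j) F) (E2_base b 0 hF F1); last by rewrite k1 ltW.
  by have := le4 j; have := rhoE j; lra.
have aev := ae_small_means (fun j => pcontT_modulus (cd j)) (fun j t => modulus_ge0 _) Hv.
have aeu := ae_small_means cu' u0 Hu.
apply: (ae_imply (ae_and aev aeu)) => t [Av Au] t2.
have t02 : 0 <= t <= 2 * pi by move: t2; rewrite /= in_itv/= => /andP[-> /ltW].
have [N1 H1] := Av t02; have [N2 H2] := Au t02.
apply: (@nontangential_of_means F rho t (maxn N1 N2)) => // j.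
  by rewrite geq_max => /andP[j1 _]; exact: H1.
by rewrite geq_max => /andP[_ j2]; apply: (mean_bound_value (cu' j)); exact: H2.
Qed.

End BoundaryValues.

(** * Separated sets *)

Section Counting.
Context {R : realType}.
Local Notation C := R[i].
Local Notation mu := (@lebesgue_measure R).
Implicit Types (r s t x y e : R) (z w : C) (n N j m p q k : nat) (f g : nat -> C -> C).
Implicit Types (u l : nat -> C).

(** [forward_comp] unfolds at the last map, whereas the induction on test products peels off the
    first. *)
Lemma forward_comp_shift g j z :
  forward_comp g j.+1 z = forward_comp (fun i => g i.+1) j (g 1%N z).
Proof. by elim: j => [//|j IH]; rewrite /= -IH. Qed.

Lemma forward_comp_add f p k z :
  forward_comp f (p + k)%N z = forward_comp (fun i => f (p + i)%N) k (forward_comp f p z).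
Proof. by elim: k => [|k IH]; rewrite ?addn0// addnS /= IH addnS. Qed.

Lemma inner0_forward_comp f n : (forall k, (k < n)%N -> inner0 (f k.+1)) ->
  inner0 (forward_comp f n).
Proof.
elim: n => [|n IH] H; first exact: inner0_id.
by apply: inner0_comp; [apply: IH => k kn; apply: H; exact: ltnW | exact: H].
Qed.

Lemma cdiff_forward_comp f l n : (forall k, (k < n)%N -> cdiff (f k.+1) 0 (l k.+1)) ->
  (forall k, (k < n)%N -> f k.+1 0 = 0) ->
  cdiff (forward_comp f n) 0 (\prod_(0 <= k < n) l k.+1) /\ forward_comp f n 0 = 0.
Proof.
elim: n => [|n IH] H H0; first by rewrite big_nil; split=> //; exact: cdiff_id.
have [d0 z0] := IH (fun k kn => H k (ltnW kn)) (fun k kn => H0 k (ltnW kn)).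
split; last by rewrite /= z0; exact: H0.
rewrite big_nat_recr//= mulrC; apply: cdiff_comp => //.
by rewrite z0; exact: H.
Qed.

(** There are m + 1 factors for m blocks: the index j = 0 belongs to the starting point itself. *)
Definition test_product m g u z : C :=
  \prod_(j < m.+1) ((1 + conjc (u j) * forward_comp g j z) / 2).

(** The first factor multiplies the product of the shifted orbit composed with [g 1], so
    [E2_test_factor] gives (1 + 1/2) / 2 = 3/4 per block. The last factor has no block after it and
    is only bounded by 1, hence the exponent m for m + 1 factors. The derivative of [g j.+1] is
    numbered [l j]. *)
Lemma test_product_E2 m g l u : (forall j, (j < m)%N -> inner0 (g j.+1)) ->
  (forall j, (j < m)%N -> cdiff (g j.+1) 0 (l j) /\ normc (l j) <= 1 / 2) ->
  (forall j, normc (u j) = 1) ->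
  [/\ holo (test_product m g u), bdd (test_product m g u) 1 &
    forall r, 0 < r < 1 -> E2 0 r (test_product m g u) <= (3 / 4) ^+ m].
Proof.
have hfac (v : C) : holo (fun z => (1 + conjc v * z) / 2).
  apply: holoM; last exact: holo_cst.
  by apply: holoD; [exact: holo_cst | apply: holoM; [exact: holo_cst | exact: holo_id]].
have bfac (v : C) : normc v = 1 -> bdd (fun z => (1 + conjc v * z) / 2) 1.
  move=> v1 z z1; rewrite Normc.normcM (_ : (2 : C)^-1 = (2^-1 : R)%:C%C); last by rewrite fmorphV rmorph_nat.
  rewrite modulus_real ger0_norm ?invr_ge0// ler_pdivrMr// mul1r.
  apply: le_trans (le_normcD _ _) _; rewrite Normc.normc1 Normc.normcM modulus_conj v1 mul1r.
  by lra.
elim: m g l u => [|m IH] g l u ig gl u1.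
  have E : test_product 0 g u = fun z => (1 + conjc (u 0%N) * z) / 2.
    by apply/funext => z; rewrite /test_product big_ord_recl big_ord0 mulr1.
  rewrite E; split=> [|//|r /andP[r0 r1]]; first by []; first exact: bfac.
  rewrite expr0 -[leRHS](expr1n _ 2); apply: E2_le_sqr => //; first exact: bfac.
  by rewrite r1 ltW.
have [hK bK EK] := IH (fun i => g i.+1) (fun i => l i.+1) (fun i => u i.+1)
  (fun j jm => ig j.+1 jm) (fun j jm => gl j.+1 jm) (fun j => u1 j.+1).
have E : test_product m.+1 g u = fun z => (1 + conjc (u 0%N) * z) / 2 *
    test_product m (fun i => g i.+1) (fun i => u i.+1) (g 1%N z).
  apply/funext => z; rewrite /test_product big_ord_recl; congr (_ * _).
  by apply: eq_bigr => i _; rewrite -forward_comp_shift.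
have iG := ig 0%N isT; have [hG G1 G0 _] := iG; have [Gl l2] := gl 0%N isT.
have Gd z : normc z < 1 -> normc (g 1%N z) < 1 by exact: schwarz_lt.
rewrite E; split.
- by apply: holoM => //; exact: holo_comp.
- have bG : bdd (fun z => test_product m (fun i => g i.+1) (fun i => u i.+1) (g 1%N z)) 1.
    by move=> z z1; apply: bK; exact: Gd.
  by have := bddM (bfac _ (u1 0%N)) bG; rewrite mulr1.
- move=> r r01; apply: le_trans (E2_test_factor iG Gl (u1 0%N) hK bK EK r01) _.
  by rewrite exprS ler_wpM2r ?exprn_ge0//; lra.
Qed.

Lemma sqr_modulus_test (v w : C) : normc v = 1 -> normc w = 1 ->
  normc ((1 + conjc v * w) / 2) ^+ 2 = 1 - normc (v - w) ^+ 2 / 4.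
Proof.
move=> v1 w1; have V := sqr_modulus v; have W := sqr_modulus w.
rewrite v1 expr1n in V; rewrite w1 expr1n in W.
rewrite Normc.normcM (_ : (2 : C)^-1 = (2^-1 : R)%:C%C); last by rewrite fmorphV rmorph_nat.
rewrite modulus_real ger0_norm ?invr_ge0// exprMn !sqr_modulus.
rewrite !(cReD, cImD, cReN, cImN, cReM, cImM, cRe_conj, cIm_conj) /=.
move: V W; move: (Re v) (Im v) (Re w) (Im w) => a b c d V W.
have X : (a ^+ 2 + b ^+ 2) * (c ^+ 2 + d ^+ 2) = 1 by rewrite -V -W mulr1.
have -> : (1 + (a * c - - b * d)) ^+ 2 + (0 + (a * d + - b * c)) ^+ 2 =
  1 + 2 * (a * c + b * d) + (a ^+ 2 + b ^+ 2) * (c ^+ 2 + d ^+ 2) by ring.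
rewrite X; have -> : (a - c) ^+ 2 + (b - d) ^+ 2 =
  (a ^+ 2 + b ^+ 2) + (c ^+ 2 + d ^+ 2) - 2 * (a * c + b * d) by ring.
by rewrite -V -W; field.
Qed.

Definition radius n : R := 1 - n.+2%:R^-1.

Lemma radius_itv n : 0 < radius n < 1.
Proof.
rewrite /radius subr_gt0 invf_lt1 ?ltr0n// ltr1n/= ltrBlDr ltrDl invr_gt0.
by rewrite ltr0n.
Qed.

Lemma test_factor_cvg (h : C -> C) (v w : C) t : nontangential_limit h (cis t) w ->
  normc ((1 + conjc v * h (circ (radius n) t)) / 2) ^+ 2 @[n --> \oo] -->
  normc ((1 + conjc v * w) / 2) ^+ 2.
Proof.
move=> hw; suff H : normc ((1 + conjc v * h (circ (radius n) t)) / 2) @[n --> \oo] -->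
  normc ((1 + conjc v * w) / 2) by apply: cvgM.
apply/cvgrPdist_lt => e e0; pose M := normc v + 1.
have M0 : 0 < M by rewrite ltr_wpDl ?modulus_ge0.
have [d d0 Hd] := radial_limit hw (divr_gt0 e0 M0).
have [n0 Hn0] : exists n0, forall n, (n0 <= n)%N -> n.+2%:R^-1 < d.
  exists (Num.truncn d^-1) => n nn; rewrite -[ltRHS]invrK ltf_pV2 ?posrE ?invr_gt0//.
  by rewrite (lt_le_trans (truncnS_gt _))// ler_nat ltnS (leq_trans nn).
near=> n; have nn : (n0 <= n)%N by near: n; exists n0.
have /andP[r0 r1] := radius_itv n.
have D : normc (h (circ (radius n) t) - w) < e / M.
  by apply: Hd; rewrite ?r1 ?(ltW r0)// /radius opprB addrCA subrr addr0 Hn0.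
set a := (1 + conjc v * w) / 2; set b := _ / 2.
have ab : normc (a - b) <= normc v * normc (h (circ (radius n) t) - w).
  have -> : a - b = (conjc v / 2) * (w - h (circ (radius n) t)) by rewrite /a /b; field.
  rewrite !Normc.normcM modulus_conj (modulusBC w) ler_wpM2r ?modulus_ge0//.
  rewrite (_ : (2 : C)^-1 = (2^-1 : R)%:C%C); last by rewrite fmorphV rmorph_nat.
  rewrite modulus_real ger0_norm ?invr_ge0//; have := modulus_ge0 v; lra.
have H1 : normc (a - b) < e.
  apply: le_lt_trans ab _; apply: (@le_lt_trans _ _ (normc v * (e / M))).
    by rewrite ler_wpM2l ?modulus_ge0// ltW.
  rewrite mulrCA gtr_pMr// ltr_pdivrMr// mul1r /M; lra.
have := le_normcD b (a - b); have := le_normcD a (b - a).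
rewrite !addrA [_ + a]addrC addrK [_ + b]addrC addrK (modulusBC b) => A B.
by rewrite ltr_norml; apply/andP; split; lra.
Unshelve. all: by end_near. Qed.

Lemma cvg_prod_ord (I : nat) (a : nat -> nat -> R) (b : nat -> R) :
  (forall j, (j < I)%N -> a j n @[n --> \oo] --> b j) ->
  \prod_(j < I) a j n @[n --> \oo] --> \prod_(j < I) b j.
Proof.
elim: I => [|I IH] H.
  by rewrite big_ord0; under eq_fun do rewrite big_ord0; exact: cvg_cst.
rewrite big_ord_recr; under eq_fun do rewrite big_ord_recr.
by apply: cvgM; [apply: IH => j jI; apply: H; exact: ltnW | exact: H].
Qed.

Definition good_angle f n t : Prop := `[0, 2 * pi[%classic t /\
  forall k, (k <= n)%N -> has_unimodular_boundary_value (forward_comp f k) (cis t).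

Definition bowen_dist f n z w : R := \big[Num.max/0]_(k < n.+1)
  normc (boundary_value (forward_comp f k) z - boundary_value (forward_comp f k) w).

Lemma ae_good_angle f n : (forall k, inner0 (f k.+1)) ->
  {ae mu, forall t, `[0, 2 * pi[%classic t -> good_angle f n t}.
Proof.
move=> fi; elim: n => [|n IH].
  apply: (ae_imply (fatou_inner inner0_id)) => t H t2; split=> // k.
  by rewrite leqn0 => /eqP ->; exact: H.
have iF : inner0 (forward_comp f n.+1) by apply: inner0_forward_comp.
apply: (ae_imply (ae_and IH (fatou_inner iF))) => t [H H'] t2.
have [_ Hn] := H t2; split=> // k; rewrite leq_eqVlt => /predU1P[->|]; first exact: H'.
by rewrite ltnS; exact: Hn.
Qed.

Lemma good_angle_value f n t k : good_angle f n t -> (k <= n)%N ->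
  let w := boundary_value (forward_comp f k) (cis t) in
  normc w = 1 /\ nontangential_limit (forward_comp f k) (cis t) w.
Proof.
move=> [_ H] /H[w w1 fw]; rewrite /= (boundary_valueE fw); split => //.
Qed.

(* If every good angle were close to one of s, then at almost every boundary
   point one of the test products of the points of s would have modulus bounded
   below, although all of them are small in mean. *)
Lemma bowen_separated_extend f n m (d : nat -> nat) g l (s : seq R) :
  (forall k, inner0 (f k.+1)) ->
  (forall j, (j < m)%N -> inner0 (g j.+1)) ->
  (forall j, (j < m)%N -> cdiff (g j.+1) 0 (l j) /\ normc (l j) <= 1 / 2) ->
  (forall j, (j <= m)%N -> (d j <= n)%N) ->
  (forall j z, (j <= m)%N -> forward_comp g j z = forward_comp f (d j) z) ->
  {in s, forall t, good_angle f n t} ->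
  (size s)%:R * (3 / 4) ^+ m < (15 / 16 : R) ^+ m.+1 ->
  exists2 t, good_angle f n t & {in s, forall t', 1 / 2 <= bowen_dist f n (cis t) (cis t')}.
Proof.
move=> fi gi gl dn gf sg Hs; set c := (15 / 16 : R) ^+ m.+1 in Hs.
have c0 : 0 < c by rewrite exprn_gt0.
apply: contrapT => /forall2NP no.
(* The default 1 keeps every value unimodular, as [test_product_E2] requires. *)
pose bv t j := if (j <= m)%N && `[< good_angle f n t >] then
  boundary_value (forward_comp f (d j)) (cis t) else 1.
have bv1 t j : normc (bv t j) = 1.
  rewrite /bv; case: ifPn => [/andP[jm /asboolP gt]|_]; last exact: Normc.normc1.
  by have [] := good_angle_value gt (dn j jm).
have bvE t j : good_angle f n t -> (j <= m)%N ->
    bv t j = boundary_value (forward_comp f (d j)) (cis t).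
  by move=> gt jm; rewrite /bv jm/=; case: asboolP.
pose K t := test_product m g (bv t).
have HK t := test_product_E2 gi gl (bv1 t).
pose T N t := \sum_(t' <- s) normc (K t' (circ (radius N) t)) ^+ 2.
have cT N : continuous (T N).
  have cK t' : continuous (fun t => normc (K t' (circ (radius N) t)) ^+ 2).
    by have [hK _ _] := HK t'; apply: E2_continuous => //; have /andP[/ltW -> ->] := radius_itv N.
  rewrite /T; elim: (s) => [|t' s' IH] t.
    by under eq_fun do rewrite big_nil; exact: cvg_cst.
  rewrite (_ : (fun x => _) = fun x => normc (K t' (circ (radius N) x)) ^+ 2 +
    \sum_(t1 <- s') normc (K t1 (circ (radius N) x)) ^+ 2).
    by apply: cvgD; [exact: cK | exact: IH].
  by apply/funext => x; rewrite big_cons.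
have T0 N t : 0 <= T N t by apply: sumr_ge0 => t' _; exact: sqr_ge0.
have rT N : ravg 0 (T N) <= (size s)%:R * (3 / 4) ^+ m.
  rewrite ravg_sum; last first.
    by move=> t'; have [hK _ _] := HK t'; apply: E2_continuous => //; have /andP[/ltW -> ->] := radius_itv N.
  rewrite -sum1_size natr_sum mulr_suml; apply: ler_sum => t' _; rewrite mul1r.
  by have [_ _ EK] := HK t'; exact/EK/radius_itv.
(* Truncation at 1 gives functions with values in [0, 1] that tend to 1 almost everywhere, while
   their means stay below a constant smaller than 1. *)
pose phi N t := Num.min (T N t / c) 1.
have cphi N : continuous (phi N).
  apply: (@min_fun_continuous _ R R (fun t => T N t / c) (fun=> 1)); last by move=> t; exact: cvg_cst.
  by move=> t; apply: cvgM; [exact: cT | exact: cvg_cst].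
have phi01 N t : 0 <= phi N t <= 1.
  by rewrite /phi le_min ler01 ge_min lexx orbT divr_ge0 ?(ltW c0).
have rphi N : ravg 0 (phi N) <= (size s)%:R * (3 / 4) ^+ m / c.
  have cTc : continuous (fun t => c^-1 * T N t).
    by move=> t; apply: cvgM; [exact: cvg_cst | exact: cT].
  apply: (@le_trans _ _ (ravg 0 (fun t => c^-1 * T N t))).
    by apply: le_ravg => // t; rewrite /phi ge_min mulrC lexx.
  by rewrite ravgZ// mulrC ler_wpM2r ?invr_ge0 ?(ltW c0).
have [] := @ravg_ae_limit1 R phi cphi phi01 _ ((1 - (size s)%:R * (3 / 4) ^+ m / c) / 2) _; last 2 first.
- by rewrite divr_gt0// subr_gt0 ltr_pdivrMr// mul1r.
- move=> N /(_ N (leqnn N)); have := rphi N.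
  have : (size s)%:R * (3 / 4) ^+ m / c < 1 by rewrite ltr_pdivrMr// mul1r.
  lra.
apply: (ae_imply (ae_good_angle n fi)) => t H t2 e e0; have gt := H t2.
have [//|/existsNP[t' /not_implyP[t's /negP]]] := no t.
rewrite -ltNge => close.
have gt' := sg t' t's.
have lim : normc (K t' (circ (radius N) t)) ^+ 2 @[N --> \oo] -->
    \prod_(j < m.+1) normc ((1 + conjc (bv t' j) * bv t j) / 2) ^+ 2.
  rewrite /K /test_product; under eq_fun do rewrite prod_modulus -prodrXl.
  apply: (@cvg_prod_ord m.+1 (fun j N => normc ((1 + conjc (bv t' j) * forward_comp g j (circ (radius N) t)) / 2) ^+ 2)
    (fun j => normc ((1 + conjc (bv t' j) * bv t j) / 2) ^+ 2)) => j; rewrite ltnS => jm.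
  have gfj : forward_comp g j = forward_comp f (d j) by apply/funext => z; exact: gf.
  have [_ nt] := good_angle_value gt (dn j jm).
  rewrite -(bvE t j gt jm) -gfj in nt.
  have := @test_factor_cvg (forward_comp g j) (bv t' j) (bv t j) t nt.
  by move=> X; exact: X.
have cle : c <= \prod_(j < m.+1) normc ((1 + conjc (bv t' j) * bv t j) / 2) ^+ 2.
  have -> : c = \prod_(j < m.+1) (15 / 16) by rewrite prodr_const card_ord.
  apply: ler_prod => j _.
  rewrite divr_ge0//= sqr_modulus_test//.
  (* Distance below 1/2 makes the squared factor at least 1 - (1/2)^2 / 4 = 15/16. *)
  have B : normc (bv t j - bv t' j) < 1 / 2.
    apply: le_lt_trans close; have jm : (j <= m)%N by rewrite -ltnS.
    rewrite !bvE//.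
    have dj : (d j < n.+1)%N by rewrite ltnS; exact: dn.
    exact: (@le_bigmax _ _ _ 0 (fun k : 'I_n.+1 => normc (boundary_value (forward_comp f k) (cis t) -
      boundary_value (forward_comp f k) (cis t'))) (Ordinal dj)).
  rewrite modulusBC; have := modulus_ge0 (bv t j - bv t' j); nra.
have [N0 HN] : exists N0, forall N, (N0 <= N)%N -> c - c * e <= normc (K t' (circ (radius N) t)) ^+ 2.
  have ce : 0 < c * e by rewrite mulr_gt0.
  have [N0 _ HN] := (cvgrPdist_lt _ _).1 lim _ ce; exists N0 => N /HN/=.
  by rewrite ltr_norml => /andP[_]; lra.
exists N0 => N NN; rewrite /phi le_min gerBl (ltW e0) andbT ler_pdivlMr// mulrBl mul1r mulrC.
apply: le_trans (HN N NN) _; rewrite /T (big_rem t')//= lerDl.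
by apply: sumr_ge0 => i _; exact: sqr_ge0.
Qed.

End Counting.

(** * Counting and blocks *)

Section SeparatedSets.
Context {R : realType}.
Local Notation C := R[i].
Implicit Types (t x y e : R) (z w : C) (n N j m p q k : nat) (f g : nat -> C -> C).

Lemma bowen_distC f n z w : bowen_dist f n z w = bowen_dist f n w z :> R.
Proof. by rewrite /bowen_dist; apply: eq_bigr => k _; exact: modulusBC. Qed.

Lemma bowen_distxx f n z : bowen_dist f n z z = 0 :> R.
Proof.
rewrite /bowen_dist; elim/big_ind: _ => // [x y -> ->|k _]; first exact: maxxx.
by rewrite subrr Normc.normc0.
Qed.

Definition separated_angles f n (s : seq R) : Prop :=
  [/\ uniq s, {in s, forall t, good_angle f n t} &
    {in s &, forall t t', t <> t' -> 1 / 2 <= bowen_dist f n (cis t) (cis t')}].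

Lemma separated_angles_number f n s delta : separated_angles f n s -> delta <= 1 / 2 ->
  ((size s)%:R%:E <= separation_number f n delta)%E.
Proof.
move=> [us gs ss] d12.
(* Equal boundary points have Bowen distance 0, so separation itself prevents a point from being
   counted twice. *)
have inj : {in s &, injective (@cis R)}.
  move=> t t' ts t's tt'; apply: contrapT => /(ss _ _ ts t's).
  by rewrite tt' bowen_distxx; lra.
pose A := [fset z in [seq cis t | t <- s]]%fset.
have AE z : [set` A] z -> exists2 t, t \in s & z = cis t.
  by rewrite /= /A in_fset => /mapP[t ts ->]; exists t.
apply: le_ereal_sup_tmp; exists (counting [set` A]); last first.
  rewrite /counting asboolT; last exact: finite_fset.
  by rewrite set_fsetK card_fseq undup_id ?map_inj_in_uniq// size_map.
exists [set` A] => //; split.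
- by move=> z /AE[t _ ->]; exact: modulus_cis.
- by move=> z /AE[t ts ->] k kn; have [_] := gs t ts; exact.
- move=> z z' /AE[t ts ->] /AE[t' t's ->] zz'.
  by apply: le_trans d12 _; apply: ss => // tt'; apply: zz'; rewrite tt'.
Qed.

Lemma separation_lower_bound f n m (d : nat -> nat) g l delta :
  (forall k, inner0 (f k.+1)) ->
  (forall j, (j < m)%N -> inner0 (g j.+1)) ->
  (forall j, (j < m)%N -> cdiff (g j.+1) 0 (l j) /\ normc (l j) <= 1 / 2) ->
  (forall j, (j <= m)%N -> (d j <= n)%N) ->
  (forall j z, (j <= m)%N -> forward_comp g j z = forward_comp f (d j) z) ->
  delta <= 1 / 2 ->
  ((15 / 16 * (5 / 4) ^+ m)%:E <= separation_number f n delta)%E.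
Proof.
move=> fi gi gl dn gf d12; set X := 15 / 16 * (5 / 4) ^+ m.
(* X is the exact size below which [bowen_separated_extend] can add a point. *)
have X34 : X * (3 / 4) ^+ m = (15 / 16) ^+ m.+1.
  rewrite /X -mulrA -exprMn (_ : 5 / 4 * (3 / 4) = 15 / 16) ?exprS//; lra.
suff [s [vs Xs]] : exists s, separated_angles f n s /\ X <= (size s)%:R.
  by apply: le_trans (separated_angles_number vs d12); rewrite lee_fin.
(* Either a large enough set has been reached, or M points have been produced; an M beyond X settles
   both cases. *)
have H M : (exists s, separated_angles f n s /\ X <= (size s)%:R) \/
    exists s, separated_angles f n s /\ size s = M.
  elim: M => [|M [IH|[s [vs sM]]]]; [by right; exists [::]|by left|].
  have [Xs|sX] := leP X (size s)%:R; first by left; exists s.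
  have [us gs ss] := vs.
  have [] := bowen_separated_extend fi gi gl dn gf gs.
    by rewrite -X34 ltr_pM2r// exprn_gt0.
  move=> t gt st; right; exists (t :: s); split; last by rewrite /= sM.
  split.
  - rewrite /= us andbT; apply/negP => /st; rewrite bowen_distxx; lra.
  - by move=> t'; rewrite inE => /predU1P[->//|/gs].
  - move=> t1 t2; rewrite !inE => /predU1P[->|t1s] /predU1P[->|t2s] // t12.
    + exact: st.
    + by rewrite bowen_distC; exact: st.
    + exact: ss.
have [//|[s [vs sX]]] := H (Num.truncn X).+1.
by exists s; split=> //; rewrite sX ltW// truncnS_gt.
Qed.

Lemma separation_number_anti f n delta delta' : delta <= delta' ->
  (separation_number f n delta' <= separation_number f n delta :> \bar R)%E.
Proof.
move=> dd'; apply: ereal_sup_le => _ [S [S1 S2 S3] <-]; exists S => //; split=> // z z' Sz Sz' zz'.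
by apply: le_trans dd' _; exact: S3.
Qed.

End SeparatedSets.

(** * Greedy blocks of multipliers *)

Section Blocks.
Context {R : realType}.
Local Notation C := R[i].
Implicit Types (a x y e : R) (z : C) (n N j m p q k : nat) (lam : nat -> R) (d : nat -> nat).

Definition span lam p q : R := \prod_(p <= k < q) lam k.+1.

Lemma spanS lam p q : (p <= q)%N -> span lam p q.+1 = span lam p q * lam q.+1.
Proof. by move=> pq; rewrite /span big_nat_recr. Qed.

Lemma span_cat lam p q r : (p <= q)%N -> (q <= r)%N -> span lam p r = span lam p q * span lam q r.
Proof. by move=> pq qr; rewrite /span (@big_cat_nat _ _ _ q). Qed.

Lemma span_shift lam p q : span lam p q = \prod_(0 <= k < q - p) lam (p + k)%N.+1.
Proof.
rewrite /span -{1}[p]add0n big_addn.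
by apply: eq_bigr => k _; rewrite addnC.
Qed.

Lemma span_gt0 lam p q : (forall k, 0 < lam k.+1) -> 0 < span lam p q.
Proof. by move=> l0; apply: prodr_gt0. Qed.

(* Greedy decomposition into blocks: each is stopped as soon as its multiplier
   drops to 1/2 or below, hence has multiplier at least a/2. *)
Lemma greedy_blocks a lam n : 0 < a -> (forall k, a <= lam k.+1) ->
  exists m d, [/\ d 0%N = 0%N, forall j, (j < m)%N -> (d j <= d j.+1)%N,
    forall j, (j <= m)%N -> (d j <= n)%N,
    forall j, (j < m)%N -> span lam (d j) (d j.+1) <= 1 / 2 &
    (a / 2) ^+ m / 2 <= span lam 0 n].
Proof.
move=> a0 al; have l0 k : 0 < lam k.+1 by apply: lt_le_trans (al k).
(* The invariant isolates the unfinished last block, whose multiplier exceeds 1/2; it accounts for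
   the extra factor 1/2. *)
suff [m [d [d0 dm dn d2 [H1 H2]]]] : exists m d, [/\ d 0%N = 0%N,
    forall j, (j < m)%N -> (d j <= d j.+1)%N,
    forall j, (j <= m)%N -> (d j <= n)%N,
    forall j, (j < m)%N -> span lam (d j) (d j.+1) <= 1 / 2 &
    (a / 2) ^+ m <= span lam 0 (d m) /\ 1 / 2 < span lam (d m) n].
  exists m, d; split=> //; rewrite (@span_cat _ _ (d m))//; last exact: dn.
  have A0 : 0 <= (a / 2) ^+ m by rewrite exprn_ge0// divr_ge0// ltW.
  by rewrite ler_pM// ?invr_ge0//; lra.
elim: n => [|n [m [d [d0 dm dn d2 [H1 H2]]]]].
  exists 0%N, (fun=> 0%N); split=> //; rewrite /span !big_geq// expr0; split=> //; lra.
have [le|gt] := leP (span lam (d m) n.+1) (1 / 2); last first.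
  exists m, d; split=> // j jm; exact: leq_trans (dn j jm) _.
exists m.+1, (fun j => if (j <= m)%N then d j else n.+1); split.
- by rewrite leq0n.
- move=> j; rewrite ltnS => jm; rewrite jm; case: ifPn => [jm'|_]; first exact: dm.
  by rewrite ltnW// ltnS dn.
- by move=> j _; case: ifPn => // jm; rewrite ltnW// ltnS dn.
- move=> j; rewrite ltnS => jm; rewrite jm; case: ifPn => [jm'|]; first exact: d2.
  by rewrite -leqNgt => mj; rewrite (_ : j = m)//; apply/eqP; rewrite eqn_leq jm -ltnS.
- rewrite ltnn; split; last by rewrite /span big_geq//; lra.
  have dmn := dn m (leqnn m).
  rewrite (@span_cat _ _ (d m))// ?(leq_trans dmn)// exprSr.
  have A0 : 0 <= (a / 2) ^+ m by rewrite exprn_ge0// divr_ge0// ltW.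
  have a2 : 0 <= a / 2 by rewrite divr_ge0// ltW.
  (* Before its last map the block still exceeded 1/2, and that map contributes a factor of at least
     a. *)
  by apply: ler_pM => //; rewrite spanS//; have := al n; have := l0 n; nra.
Qed.

Lemma ln_span lam p q : (forall k, 0 < lam k.+1) ->
  ln (span lam p q) = \sum_(p <= k < q) ln (lam k.+1).
Proof.
move=> l0; have [pq|qp] := leqP p q; last by rewrite /span !big_geq ?ln1// ltnW.
elim: q pq => [|q IH]; first by rewrite leqn0 => /eqP ->; rewrite /span !big_geq ?ln1.
rewrite leq_eqVlt => /predU1P[->|]; first by rewrite /span !big_geq ?ln1.
by rewrite ltnS => pq; rewrite spanS// lnM ?posrE ?span_gt0// IH// big_nat_recr.
Qed.

(** Termwise 1 - x <= - ln x. *)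
Lemma sum_le_ln_span lam n : (forall k, 0 < lam k.+1) ->
  \sum_(1 <= k < n.+1) (1 - lam k) <= - ln (span lam 0 n).
Proof.
move=> l0; rewrite ln_span// -sumrN big_add1; apply: ler_sum_nat => k _.
have := @le_ln1Dx _ (lam k.+1 - 1); rewrite addrCA subrr addr0 => /(_ _); have := l0 k.
by move=> + H; move=> ?; have := H ltac:(lra); lra.
Qed.

(** Termwise - ln x <= 1/x - 1 = (1 - x) / x <= (1 - x) / a. *)
Lemma ln_span_le_sum lam a n : 0 < a -> (forall k, a <= lam k.+1 <= 1) ->
  - ln (span lam 0 n) <= (\sum_(1 <= k < n.+1) (1 - lam k)) / a.
Proof.
move=> a0 al; have l0 k : 0 < lam k.+1 by apply: lt_le_trans a0 _; case/andP: (al k).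
rewrite ln_span// -sumrN big_add1 mulr_suml; apply: ler_sum_nat => k _.
have /andP[ak k1] := al k; have k0 := l0 k.
have := @le_ln1Dx _ ((lam k.+1)^-1 - 1); rewrite addrCA subrr addr0 lnV ?posrE//.
have : 0 < (lam k.+1)^-1 by rewrite invr_gt0.
move=> i0 H; have {}H := H ltac:(lra); apply: le_trans H _.
have -> : (lam k.+1)^-1 - 1 = (1 - lam k.+1) / lam k.+1 by field; rewrite gt_eqF.
by rewrite ler_wpM2l ?subr_ge0// lef_pV2.
Qed.

End Blocks.

(** * Upper limits of extended real sequences *)

Section LimSup.
Context {R : realType}.
Implicit Types (u v : (\bar R)^nat) (x : \bar R) (n N : nat).
Local Open Scope ereal_scope.

Lemma limn_esup_ge u x : (forall N, exists2 n, (N <= n)%N & x <= u n) -> x <= limn_esup u.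
Proof.
move=> H; apply: le_ereal_inf_tmp => _ [V [N _ NV] <-].
by have [n Nn xn] := H N; apply: le_ereal_sup_tmp; exists (u n) => //; exists n => //; exact: NV.
Qed.

Lemma limn_esup_le u x N : (forall n, (N <= n)%N -> u n <= x) -> limn_esup u <= x.
Proof.
move=> H; apply: ge_ereal_inf; exists (ereal_sup (u @` [set n | (N <= n)%N])).
  by exists [set n | (N <= n)%N] => //; exists N.
by apply: ge_ereal_sup => _ [n Nn <-]; exact: H.
Qed.

Lemma limn_esup_homo u v : (forall n, u n <= v n) -> limn_esup u <= limn_esup v.
Proof.
move=> uv; apply: le_ereal_inf_tmp => _ [V FV <-]; apply: ge_ereal_inf.
exists (ereal_sup (u @` V)); first by exists V.
apply: ge_ereal_sup => _ [n Vn <-]; apply: le_ereal_sup_tmp; by exists (v n) => //; exists n.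
Qed.

(** Boundedness of A makes its upper limit a real number, so that scaling by c and losing e can be
    handled in the reals. *)
Lemma limn_esup_transfer (c : R) (A : nat -> R) u : (0 < c)%R -> (forall n, 0 <= A n <= 1)%R ->
  (forall e, (0 < e)%R -> exists N, forall n, (N <= n)%N -> (c * A n - e)%:E <= u n) ->
  c%:E * limn_esup (fun n => (A n)%:E) <= limn_esup u.
Proof.
move=> c0 A01 H; set L := limn_esup (fun n => _).
have L0 : 0 <= L by apply: limn_esup_ge => N; exists N => //; rewrite lee_fin; case/andP: (A01 N).
have L1 : L <= 1 by apply: (@limn_esup_le _ _ 0%N) => n _; rewrite lee_fin; case/andP: (A01 n).
have LE : L = (fine L)%:E.
  by rewrite fineK// ge0_fin_numE// (le_lt_trans L1)// ltry.
rewrite LE; apply/lee_addgt0Pr => e e0.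
have e20 : (0 < e / 2)%R by rewrite divr_gt0.
have [N1 HN1] := H _ e20.
suff : (c * fine L - e)%:E <= limn_esup u.
  by rewrite EFinB leeBlDr.
apply: limn_esup_ge => N.
apply: contrapT => no.
have : L <= (fine L - e / 2 / c)%:E.
  apply: (@limn_esup_le _ _ (maxn N N1)) => n; rewrite geq_max => /andP[Nn N1n].
  rewrite leNgt; apply/negP; rewrite lte_fin => An; apply: no; exists n => //.
  apply: le_trans (HN1 n N1n); rewrite lee_fin.
  have : (c * (fine L - e / 2 / c) < c * A n)%R by rewrite ltr_pM2l.
  by rewrite mulrBr mulrCA divff ?gt_eqF// mulr1; lra.
have : (0 < e / 2 / c)%R by rewrite divr_gt0.
by rewrite {1}LE lee_fin; lra.
Qed.

End LimSup.

(** * Entropy *)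

Section Entropy.
Context {R : realType}.
Local Notation C := R[i].
Implicit Types (a x y e : R) (z : C) (n N j m p q k : nat) (f g : nat -> C -> C).

Lemma multiplier_le1 (h : C -> C) l : inner_function h -> centred h -> cdiff h 0 l ->
  normc l <= 1.
Proof.
move=> ih ch hl; have [hh h1 _ _] := inner_function_inner0 ih ch.
by rewrite -(taylor1 hh h1 hl); exact: taylor_bound.
Qed.

Definition entropy_rate a : R := ln (5 / 4) / ln (2 / a).

Lemma entropy_rate_gt0 a : 0 < a <= 1 -> 0 < ln (2 / a) /\ 0 < entropy_rate a.
Proof.
move=> /andP[a0 a1].
have p0 : 0 < ln (2 / a) by rewrite ln_gt0// ltr_pdivlMr// mul1r; lra.
by split=> //; rewrite divr_gt0// ln_gt0//; lra.
Qed.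

(** Collects what does not grow with n: ln 2 from the unfinished block and ln (15/16) from the
    prefactor of the separation bound. *)
Definition entropy_defect a : R := entropy_rate a * ln 2 - ln (15 / 16).

Lemma separation_growth f a n delta : 0 < a <= 1 ->
  (forall k, inner_function (f k.+1) /\ centred (f k.+1)) ->
  (forall k, a <= multiplier (f k.+1)) -> delta <= 1 / 2 ->
  ((entropy_rate a * (n%:R^-1 * \sum_(1 <= k < n.+1) (1 - multiplier (f k))) -
     entropy_defect a * n%:R^-1)%:E <=
   (n%:R^-1)%:E * lne (separation_number f n delta))%E.
Proof.
move=> a01 fi al d12; have /andP[a0 a1] := a01.
pose l k := 'D_1 (f k : C^o -> C^o) 0.
have d0 : normc (0 : C) < 1 by rewrite Normc.normc0.
have fl k : cdiff (f k.+1) 0 (l k.+1).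
  by have [[df _ _] _] := fi k; apply: derivable_cdiff; exact: df.
have lE k : multiplier (f k.+1) = normc (l k.+1).
  by have [ik _] := fi k; exact: multiplier_cdiff.
have f0 k : f k.+1 0 = 0 by have [] := fi k.
have fI k : inner0 (f k.+1) by have [] := fi k; exact: inner_function_inner0.
have l0 k : 0 < multiplier (f k.+1) by apply: lt_le_trans (al k).
have [m [d [dz dm dn d2 Hn]]] := greedy_blocks (lam := fun k => multiplier (f k)) n a0 al.
(* [g j.+1] composes the maps of index d j + 1 up to d (j + 1); the maps inside a block are again
   numbered from 1. *)
pose g j := if j is j'.+1 then
  forward_comp (fun i => f (d j' + i)%N) (d j'.+1 - d j')%N else id.
pose lg j := \prod_(0 <= k < d j.+1 - d j) l (d j + k.+1)%N.
have gi j : (j < m)%N -> inner0 (g j.+1).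
  by move=> jm; apply: inner0_forward_comp => k _; rewrite addnS.
have gl j : (j < m)%N -> cdiff (g j.+1) 0 (lg j) /\ normc (lg j) <= 1 / 2.
  move=> jm; split.
    have [] := @cdiff_forward_comp _ (fun i => f (d j + i)%N) (fun i => l (d j + i)%N) (d j.+1 - d j).
    - by move=> k _; rewrite addnS.
    - by move=> k _; rewrite addnS.
    - by [].
  apply: le_trans (d2 j jm); rewrite prod_modulus le_eqVlt; apply/orP; left; apply/eqP.
  by rewrite span_shift; apply: eq_big_nat => k _; rewrite addnS lE.
have gf j z : (j <= m)%N -> forward_comp g j z = forward_comp f (d j) z.
  elim: j => [|j IH] jm; first by rewrite dz.
  by rewrite /= IH ?(ltnW jm)// -forward_comp_add subnKC// dm.
have := separation_lower_bound fI gi gl dn gf d12.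
set X := 15 / 16 * (5 / 4) ^+ m => XS.
have X0 : 0 < X by rewrite mulr_gt0// exprn_gt0.
have [p0 c0] := entropy_rate_gt0 a01.
have lnX : entropy_rate a * \sum_(1 <= k < n.+1) (1 - multiplier (f k)) - entropy_defect a <= ln X.
  have S := sum_le_ln_span (lam := fun k => multiplier (f k)) n l0.
  have a2 : 0 < a / 2 by rewrite divr_gt0.
  have A : ln ((a / 2) ^+ m / 2) <= ln (span (fun k => multiplier (f k)) 0 n).
    by rewrite ler_ln ?posrE ?span_gt0// divr_gt0 ?exprn_gt0.
  have EA : ln ((a / 2) ^+ m / 2) = - (ln (2 / a) *+ m) - ln 2.
    have -> : ln (2 / a) = - ln (a / 2) by rewrite -lnV ?posrE// invf_div.
    by rewrite mulNrn opprK ln_div ?posrE ?exprn_gt0// lnXn.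
  have EX : ln X = ln (15 / 16) + ln (5 / 4) *+ m.
    by rewrite /X lnM ?posrE ?exprn_gt0// lnXn.
  have Sm : \sum_(1 <= k < n.+1) (1 - multiplier (f k)) <= ln (2 / a) *+ m + ln 2.
    by apply: le_trans S _; rewrite EA in A; lra.
  have := ler_wpM2l (ltW c0) Sm; rewrite mulrDr mulrnAr {2}/entropy_rate mulfVK ?gt_eqF//.
  by rewrite /entropy_defect EX; lra.
have n0 : 0 <= n%:R^-1 :> R by rewrite invr_ge0.
apply: (@le_trans _ _ ((n%:R^-1)%:E * (ln X)%:E)%E).
  by rewrite -EFinM lee_fin mulrCA (mulrC (entropy_defect a)) -mulrBr ler_wpM2l.
apply: lee_wpmul2l; first by rewrite lee_fin.
rewrite -lne_EFin// lee_lne// in_itv/= leey andbT ?lee_fin ?ltW//.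
by apply: lt_le_trans XS; rewrite lte_fin.
Qed.

Lemma limn_esup_sep_anti f :
  {in `]0, 1 / 2[ &, nonincreasing_fun (fun delta : R => limn_esup (fun n : nat =>
    ((n%:R^-1)%:E * lne (separation_number f n delta))%E))}.
Proof.
move=> d d' _ _ dd'; apply: limn_esup_homo => n.
apply: lee_wpmul2l; first by rewrite lee_fin invr_ge0.
have s0 x : (0 <= separation_number f n x)%E.
  apply: le_ereal_sup_tmp; exists (counting (set0 : set C)).
    by exists set0 => //; split=> // z [].
  by rewrite /counting asboolT ?fset_set0 ?lee_fin//; exact: finite_set0.
by rewrite lee_lne ?in_itv/= ?s0 ?leey//; exact: separation_number_anti.
Qed.

(** The growth rate does not decrease as delta decreases, so its limit at 0 is its supremum over ]0,
    1/2[, which dominates the value at 1/4. *)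
Lemma htop_ge f (x : \bar R) :
  (forall delta : R, 0 < delta < 1 / 2 -> (x <= limn_esup (fun n : nat =>
    ((n%:R^-1)%:E * lne (separation_number f n delta))%E))%E) ->
  (x <= htop f)%E.
Proof.
move=> H; have b0 : (BRight (0 : R) < BLeft (1 / 2 : R))%O by rewrite bnd_simp; lra.
have cv := nonincreasing_at_right_cvge _ b0 (@limn_esup_sep_anti f).
rewrite /htop (cvg_lim _ cv)//; apply: le_ereal_sup_tmp.
exists (limn_esup (fun n : nat => ((n%:R^-1)%:E * lne (separation_number f n (1 / 4)))%E)).
  by exists (1 / 4) => //; rewrite /= in_itv/=; apply/andP; split; lra.
by apply: H; apply/andP; split; lra.
Qed.

Lemma root_span (lam : nat -> R) n : (forall k, 0 < lam k.+1) ->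
  span lam 0 n `^ n%:R^-1 = expR (- (n%:R^-1 * - ln (span lam 0 n))).
Proof. by move=> l0; rewrite /powR gt_eqF ?span_gt0// mulrN opprK. Qed.

(** With b_n = - ln (span lam 0 n) / n, the n-th root is exp (- b_n), and A n <= b_n <= A n / a: the
    two conditions both say that b_n does not tend to 0. *)
Lemma liminf_root_lt1 (lam : nat -> R) a : 0 < a -> (forall k, a <= lam k.+1 <= 1) ->
  (limn_einf (fun n => (span lam 0 n `^ n%:R^-1)%:E) < 1)%E <->
  (0 < limn_esup (fun n => (n%:R^-1 * \sum_(1 <= k < n.+1) (1 - lam k))%:E))%E.
Proof.
move=> a0 al; have l0 k : 0 < lam k.+1 by apply: lt_le_trans a0 _; case/andP: (al k).
set A := fun n => n%:R^-1 * \sum_(1 <= k < n.+1) (1 - lam k).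
have i0 n : 0 <= n%:R^-1 :> R by rewrite invr_ge0.
have AB n : A n <= n%:R^-1 * - ln (span lam 0 n) by rewrite ler_wpM2l// sum_le_ln_span.
have BA n : n%:R^-1 * - ln (span lam 0 n) <= A n / a.
  by rewrite /A -mulrA ler_wpM2l// ln_span_le_sum.
split=> [inf1|sup0].
- rewrite ltNge; apply/negP => sup0; move: inf1; rewrite ltNge => /negP; apply.
  apply/lee_addgt0Pr => e e0; rewrite -leeBlDr//.
  have ea : 0 < e * a by rewrite mulr_gt0.
  have [N HN] : exists N, forall n, (N <= n)%N -> A n < e * a.
    apply: contrapT => no; have : ((e * a)%:E <= limn_esup (fun n => (A n)%:E))%E.
      apply: limn_esup_ge => N; apply: contrapT => noN; apply: no; exists N => n Nn.
      by rewrite ltNge; apply/negP => An; apply: noN; exists n.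
    by move=> /le_trans/(_ sup0); rewrite lee_fin; lra.
  rewrite /limn_einf leeNr; apply: (@limn_esup_le _ _ _ N) => n Nn.
  rewrite root_span// -EFinB -!EFinN lee_fin lerN2.
  apply: le_trans (expR_ge1Dx _); rewrite lerD2l lerN2.
  by apply: le_trans (BA n) _; rewrite ler_pdivrMr// ltW// HN.
- have [e e0 eA] : exists2 e : R, 0 < e & forall N, exists2 n, (N <= n)%N & e <= A n.
    apply: contrapT => no; move: sup0; rewrite ltNge => /negP; apply.
    apply/lee_addgt0Pr => e e0; rewrite add0e.
    have [N HN] : exists N, forall n, (N <= n)%N -> A n <= e.
      apply: contrapT => noN; apply: no; exists e => // N; apply: contrapT => non.
      apply: noN; exists N => n Nn; rewrite leNgt; apply/negP => /ltW An.
      by apply: non; exists n.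
    by apply: (@limn_esup_le _ _ _ N) => n Nn; rewrite lee_fin HN.
  apply: (@le_lt_trans _ _ (expR (- e))%:E); last first.
    by rewrite lte_fin expR_lt1; lra.
  rewrite /limn_einf leeNl; apply: limn_esup_ge => N; have [n Nn An] := eA N.
  exists n => //; rewrite root_span// -!EFinN lee_fin lerN2 ler_expR lerN2.
  exact: le_trans An (AB n).
Qed.

End Entropy.

Theorem theoremD (R : realType) (a : R) (a_gt0 : 0 < a) :
  exists2 c : R, 0 < c &
  forall f : nat -> R[i] -> R[i],
  let lambda := fun n => multiplier (f n) in
  let mu_ := fun n => 1 - lambda n in
  let mu := limn_esup (fun n : nat =>
    (n%:R^-1 * \sum_(1 <= k < n.+1) mu_ k)%:E) in
  let liminf_geom_mean := limn_einf (fun n : nat =>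
    ((\prod_(1 <= k < n.+1) lambda k) `^ (n%:R^-1))%:E) in
  (forall n, (1 <= n)%N -> inner_function (f n) /\ centred (f n)) ->
  (forall n, (1 <= n)%N -> a <= lambda n) ->
  \prod_(1 <= k < n.+1) lambda k @[n --> \oo] --> (0 : R) ->
  ((liminf_geom_mean < 1)%E <-> (0 < mu)%E) /\
  ((liminf_geom_mean < 1)%E -> (c%:E * mu <= htop f)%E).
Proof.
(* The cap at 1 makes ln (2 / a') positive, so that the rate is positive for every a > 0. *)
pose a' := Num.min a 1.
have a'01 : 0 < a' <= 1 by rewrite lt_min a_gt0 ltr01 ge_min lexx orbT.
have /andP[a'0 a'1] := a'01; have [_ c0] := entropy_rate_gt0 a'01.
exists (entropy_rate a') => // f lambda mu_ mu liminf_geom_mean fi al _.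
have fi' k : inner_function (f k.+1) /\ centred (f k.+1) by exact: fi.
have al' k : a' <= lambda k.+1 by rewrite ge_min al.
have l1 k : lambda k.+1 <= 1.
  have [ik ck] := fi' k; have [df _ _] := ik.
  have d0 : normc (0 : R[i]) < 1 by rewrite Normc.normc0.
  have fl := derivable_cdiff (df 0 d0).
  by rewrite /lambda (multiplier_cdiff ik fl); exact: multiplier_le1 ik ck fl.
have al1 k : a' <= lambda k.+1 <= 1 by rewrite al' l1.
split.
  have := liminf_root_lt1 a'0 al1; rewrite /liminf_geom_mean.
  by under [in X in _ -> X]eq_fun do rewrite big_add1.
move=> _; apply: htop_ge => delta /andP[d0 /ltW d12].
apply: (limn_esup_transfer c0) => [n|e e0].
- have S0 : 0 <= \sum_(1 <= k < n.+1) mu_ k.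
    by rewrite big_add1; apply: sumr_ge0 => k _; rewrite subr_ge0.
  rewrite mulr_ge0 ?invr_ge0//=; case: n S0 => [|n] S0; first by rewrite invr0 mul0r.
  rewrite mulrC ler_pdivrMr// mul1r big_add1.
  apply: (@le_trans _ _ (\sum_(0 <= k < n.+1) (1 : R))); last by rewrite sumr_const_nat subn0.
  by apply: ler_sum_nat => k _; rewrite gerBl; exact: le_trans (ltW a'0) (al' k).
- pose K := entropy_defect a'.
  (* From this index on |K| / n <= e, so the defect is absorbed by e. *)
  exists (Num.truncn (`|K| / e)).+1 => n Nn.
  apply: le_trans (separation_growth n a'01 fi' al' d12); rewrite lee_fin lerD2l lerN2.
  have n0 : 0 < n%:R :> R by rewrite ltr0n; exact: leq_trans Nn.
  rewrite ler_pdivrMr//; apply: le_trans (ler_norm _) _; rewrite mulrC -ler_pdivrMr//.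
  by rewrite ltW// (lt_le_trans (truncnS_gt _))// ler_nat.
Qed.
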